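(* For all nonnegative integers $n,k$, $$\gamma_{n,k,0}=(-1)^{k}\,\frac{(2n)!}{2^{n}\,n!}\,\frac{d^{2k}r_{n}}{dx^{2k}}(0)=\frac{(2n)!\,(2k)!}{2^{n}\,n!}\,s_{n,k}=\frac{(2n)!}{2^{n}\,n!}\,\frac{(2k)!}{k!}\,\frac{d^{k}M_{n,k}}{d\theta^{k}}(0),$$ where $\gamma_{n,k,0}=E\big[\{\Delta W_{1}(t,t+1)\}^{2n}\{A_{1,2}(t,t+1)\}^{2k}\big]$.
   Context: Let $W_{1},W_{2}$ be independent standard (real-valued) Wiener processes and $t\ge 0$. Put $\Delta W_{i}(t,t+1)=W_{i}(t+1)-W_{i}(t)$, $i=1,2$, and define the stochastic area integral (Itô integrals) $$A_{1,2}(t,t+1)=\int_{t}^{t+1}\int_{t}^{s}dW_{1}(r)\,dW_{2}(s)-\int_{t}^{t+1}\int_{t}^{s}dW_{2}(r)\,dW_{1}(s).$$ For nonnegative integers $n,k,l$, $\gamma_{n,k,l}=E\big[\{\Delta W_{1}(t,t+1)\}^{2n}\{A_{1,2}(t,t+1)\}^{2k}\{\Delta W_{2}(t,t+1)\}^{2l}\big]$. For $n=0,1,\ldots$, the function $r_n:\mathbb{R}\to\mathbb{R}$ is $r_{n}(x)=\left(\frac{\tanh x}{x}\right)^{n}\frac{1}{\cosh x}$ for $x\ne 0$, and $r_{n}(0)=1$ (the limit as $x\to0$). $B_{2j}$ denotes the $2j$-th Bernoulli number ($B_2=1/6$, $B_4=-1/30$, ...). For $n\ge 0$, $j\ge 1$,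 $$\beta_{n,j}=\frac{2^{2j-1}|B_{2j}|\{(2^{2j}-1)(n+1)-n\}}{(2j)!}.$$ Define $s_{n,0}=1$ and, for $k\ge1$, $$s_{n,k}=\sum_{l_{1}+2l_{2}+\cdots+kl_{k}=k}\ \prod_{j=1}^{k}\frac{\beta_{n,j}^{l_{j}}}{j^{l_{j}}\,l_{j}!},$$ the sum being over nonnegative integers $l_1,\dots,l_k$. For a nonnegative integer $L$ and $\theta\in\mathbb{R}$, $$M_{n,L}(\theta)=\exp\left(\sum_{j=1}^{L}\frac{\beta_{n,j}}{j}\theta^{j}\right)$$ (so $M_{n,0}\equiv1$). *)

(* Defs.v *)
From HB Require Import structures.
From mathcomp Require Import all_boot all_order all_algebra.
From mathcomp Require Import all_classical all_reals all_analysis.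

Set Implicit Arguments.
Unset Strict Implicit.
Unset Printing Implicit Defensive.

Import Order.TTheory GRing.Theory Num.Theory.
Import numFieldNormedType.Exports.

Local Open Scope classical_set_scope.
Local Open Scope ring_scope.

Section independence.
Context {d : measure_display} {T : measurableType d} {R : realType}.
Variable P : probability T R.

Definition independent_systems (G H : set (set T)) : Prop :=
  forall A B, G A -> H B -> (P (A `&` B) = P A * P B)%E.

(* The product rule over the whole finite family gives it over every subfamily,
   since B i may be setT. *)
Definition mutually_independent (m : nat) (X : 'I_m -> T -> R) : Prop :=
  forall B : 'I_m -> set R, (forall i, measurable (B i)) ->
    (P (\bigcap_i (X i @^-1` B i)) = \prod_(i < m) P (X i @^-1` B i))%E.

End independence.

Section wiener.
Context {d : measure_display} {T : measurableType d} {R : realType}.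
Variable P : probability T R.

(* Processes are indexed by R for convenience: only times r >= 0 matter. *)
Definition process_sigma (W : R -> {RV P >-> R}) : set (set T) :=
  <<s \bigcup_(r in `[0, +oo[) preimage_set_system setT (W r) measurable >>.

Definition independent_processes (W1 W2 : R -> {RV P >-> R}) : Prop :=
  independent_systems P (process_sigma W1) (process_sigma W2).

(* The second parameter of normal_prob is the standard deviation. *)
Record is_wiener (W : R -> {RV P >-> R}) : Prop := IsWiener {
  wiener_start : {ae P, forall w, W 0 w = 0} ;
  wiener_independent_increments : forall (m : nat) (tau : nat -> R),
    0 <= tau 0%N -> (forall i, (i < m)%N -> tau i <= tau i.+1) ->
    mutually_independent P (fun (i : 'I_m) w => W (tau i.+1) w - W (tau i) w) ;
  wiener_gaussian_increments : forall (s r : R) (B : set R),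
    0 <= s -> s < r -> measurable B ->
    P ((fun w => W r w - W s w) @^-1` B) = normal_prob 0 (Num.sqrt (r - s)) B ;
  wiener_continuous :
    {ae P, forall w, {within `[0, +oo[, continuous (fun r => W r w)}}
}.

End wiener.

Section ito.
Context {d : measure_display} {T : measurableType d} {R : realType}.
Variable P : probability T R.

Definition natural_filtration (W1 W2 : R -> {RV P >-> R}) (s : R) :
    set (set T) :=
  <<s \bigcup_(r in `[0, s])
        (preimage_set_system setT (W1 r) measurable `|`
         preimage_set_system setT (W2 r) measurable) >>.

(* Represents the process equal to step_coef i on
   [step_time i, step_time i.+1[ for i < step_size. *)
Record step_process := StepProcess {
  step_size : nat ;
  step_time : nat -> R ;
  step_coef : nat -> T -> R
}.

Definition is_step_process (F : R -> set (set T)) (a b : R)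
    (S : step_process) : Prop :=
  [/\ step_time S 0%N = a,
      step_time S (step_size S) = b &
      forall i, (i < step_size S)%N ->
        [/\ step_time S i <= step_time S i.+1,
            preimage_set_system setT (step_coef S i) measurable
              `<=` F (step_time S i) &
            ('E_P[fun w => (step_coef S i w ^+ 2)%R] < +oo)%E] ].

Definition step_value (S : step_process) (s : R) (w : T) : R :=
  \sum_(i < step_size S)
     step_coef S i w * \1_(`[step_time S i, step_time S i.+1[%classic) s.

Definition step_integral (W : R -> {RV P >-> R}) (S : step_process) (w : T) : R :=
  \sum_(i < step_size S)
     step_coef S i w * (W (step_time S i.+1) w - W (step_time S i) w).

(* I is a version of \int_a^b H(s) dW(s): the L^2(P) limit of the integrals of
   F-adapted step processes approximating H in L^2(P x ds).  Ito integrals being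
   defined up to P-null sets, this is a relation. Adaptedness of H (up to null
   sets) and E \int_a^b H(s)^2 ds < +oo follow from the approximability of H. *)
Definition is_ito_integral (F : R -> set (set T)) (W : R -> {RV P >-> R})
    (a b : R) (H : R -> T -> R) (I : {RV P >-> R}) : Prop :=
  measurable_fun (`[a, b]%classic `*` [set: T]) (fun p : R * T => H p.1 p.2) /\
  exists S : nat -> step_process,
    [/\ forall j, is_step_process F a b (S j),
        (\int[P]_w \int[lebesgue_measure]_(s in `[a, b])
            ((H s w - step_value (S j) s w) ^+ 2)%:E)%E @[j --> \oo] --> 0%E &
        'E_P[fun w => ((I w - step_integral W (S j) w) ^+ 2)%R]%E
          @[j --> \oo] --> 0%E].

(* I is a version of \int_a^b \int_a^s dV(r) dW(s). *)
Definition is_iterated_ito_integral (F : R -> set (set T))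
    (V W : R -> {RV P >-> R}) (a b : R) (I : {RV P >-> R}) : Prop :=
  exists J : R -> {RV P >-> R},
    (forall s, a <= s <= b -> is_ito_integral F V a s (fun _ _ => 1) (J s)) /\
    is_ito_integral F W a b J I.

(* A is a version of the stochastic area integral A_{1,2}(t, t + 1). *)
Definition is_area_integral (W1 W2 : R -> {RV P >-> R}) (t : R)
    (A : {RV P >-> R}) : Prop :=
  let F := natural_filtration W1 W2 in
  exists I12 I21 : {RV P >-> R},
    [/\ is_iterated_ito_integral F W1 W2 t (t + 1) I12,
        is_iterated_ito_integral F W2 W1 t (t + 1) I21 &
        forall w, A w = I12 w - I21 w].

Definition area_moment (W1 W2 : R -> {RV P >-> R}) (A : {RV P >-> R}) (t : R)
    (n k l : nat) : \bar R :=
  'E_P[fun w => ((W1 (t + 1) w - W1 t w) ^+ (2 * n) * A w ^+ (2 * k)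
                 * (W2 (t + 1) w - W2 t w) ^+ (2 * l))%R]%E.

End ito.

Section special_functions.
Context {R : realType}.

Definition cosh (x : R) : R := (expR x + expR (- x)) / 2.
Definition sinh (x : R) : R := (expR x - expR (- x)) / 2.
Definition tanh (x : R) : R := sinh x / cosh x.

Definition r_fun (n : nat) (x : R) : R :=
  if x == 0 then 1 else (tanh x / x) ^+ n * (cosh x)^-1.

End special_functions.

(* The sequence [:: B_0; ...; B_(n - 1)] of Bernoulli numbers (B_1 = - 1/2). *)
Fixpoint bernoulli_seq (n : nat) : seq rat :=
  if n is m.+1 then
    let s := bernoulli_seq m in
    rcons s (((m == 0%N)%:R - \sum_(i < m) 'C(m.+1, i)%:R * s`_i) / m.+1%:R)
  else [::].

Definition bernoulli_number (n : nat) : rat := (bernoulli_seq n.+1)`_n.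

Lemma size_bernoulli_seq n : size (bernoulli_seq n) = n.
Proof. by elim: n => //= n IHn; rewrite size_rcons IHn. Qed.

Lemma nth_bernoulli_seq n i :
  (i < n)%N -> (bernoulli_seq n)`_i = bernoulli_number i.
Proof.
elim: n => // n IHn; rewrite ltnS leq_eqVlt => /orP[/eqP -> // | ltin].
by rewrite /= nth_rcons size_bernoulli_seq ltin IHn.
Qed.

Lemma bernoulli_number_rec n :
  \sum_(i < n.+1) 'C(n.+1, i)%:R * bernoulli_number i = (n == 0%N)%:R.
Proof.
rewrite big_ord_recr /= binSn {2}/bernoulli_number /= nth_rcons.
rewrite size_bernoulli_seq ltnn eqxx mulrCA divff ?mulr1 ?pnatr_eq0//.
rewrite addrC -[RHS]subr0 -addrA; congr (_ + _).
rewrite oppr0; apply/eqP; rewrite addrC subr_eq0; apply/eqP.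
by apply: eq_bigr => i _; rewrite nth_bernoulli_seq.
Qed.

Section coefficients.
Context {R : realType}.

Definition beta_coef (n j : nat) : R :=
  2 ^+ (2 * j - 1) * `|ratr (bernoulli_number (2 * j))|
  * ((2 ^+ (2 * j) - 1) * n.+1%:R - n%:R) / ((2 * j)`!)%:R.

(* l i stands for l_(i + 1).  The constraint forces l_j <= k, so that restricting
   to values in 'I_k.+1 loses no term; for k = 0 the sum is the empty product 1. *)
Definition s_coef (n k : nat) : R :=
  \sum_(l : {ffun 'I_k -> 'I_k.+1} | (\sum_(i < k) i.+1 * l i == k)%N)
    \prod_(i < k) (beta_coef n i.+1 ^+ l i / (i.+1%:R ^+ l i * ((l i)`!)%:R)).

Definition M_fun (n L : nat) (theta : R) : R :=
  expR (\sum_(1 <= j < L.+1) beta_coef n j / j%:R * theta ^+ j).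

End coefficients.

(* Main.v *)
Require Import Defs.
From HB Require Import structures.
From mathcomp Require Import all_boot all_order all_algebra.
From mathcomp Require Import all_classical all_reals all_analysis.
From mathcomp Require Import measurable_realfun.
From mathcomp Require Import ring lra zify.

(* Put [x, y, a] for the increments of [W1], [W2] and for the Riemann sum of the area over a uniform
   partition into [N] steps.  The Ito isometry gives [E (A - a_N) ^ 2 <= 32 / N].  Expanding one step
   of the chain [(x, y, a)] shows that its mixed moments satisfy, up to [O(1 / N ^ 2)], the moment
   recursion of the generator
     [L = (dx ^ 2 + dy ^ 2 + (x ^ 2 + y ^ 2) da ^ 2) / 2 + x dy da - y dx da],
   so they converge to the homogeneous solution of that recursion; this gives
   [E x ^ (2 n) A ^ (2 k) = g_(2 n) (2 k)! alpha_(n, k)] with [g] the Gaussian moments and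
     [(n + 2 k) alpha_(n, k) = n alpha_(n - 1, k) + (n + 1) alpha_(n + 1, k - 1)].
   The numbers [(-1) ^ k r_n ^ (2 k) (0) / (2 k)!] obey the same recursion because
     [n r_n + x r_n' = n r_(n - 1) - (n + 1) x ^ 2 r_(n + 1)].
   With [b y = y / (e ^ y - 1)] one has
     [x r_n' = (n (2 b (2 x) - b (4 x) - 1) - (x - b (2 x) + b (4 x))) r_n],
   whose Taylor expansion reads [k alpha_(n, k) = sum_(1 <= j <= k) beta_(n, j) alpha_(n, k - j)].
   This is the recursion of the coefficients of [exp (sum_j beta_(n, j) theta ^ j / j)], and expanding
   the product of the series of [exp (beta_(n, j) theta ^ j / j)] gives [s_(n, k)]. *)

Set Implicit Arguments.
Unset Strict Implicit.
Unset Printing Implicit Defensive.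

Import Order.TTheory GRing.Theory Num.Theory.
Import numFieldNormedType.Exports.

Local Open Scope classical_set_scope.
Local Open Scope ring_scope.

(** The area is given only as a mean-square limit, so its moments are reached through Riemann sums,
    and two obstacles arise. The moments with y-exponent 0 are not a closed system, because x dy da
    and y dx da mix the coordinates; hence all exponents (i, j, q) are treated together, by
    induction on the degree i + j + 2 q, which the generator lowers. The solution can be guessed
    because the area is invariant under rotations: a mixed moment is a product of Gaussian moments
    in x and in y and of a factor that depends on i + j and q only. Secondly, mean-square
    convergence does not control higher powers: truncation first extracts the finiteness of all
    moments of A from uniform bounds on those of the Riemann sums, and only then is the limit taken.
    On the analytic side every identity is one between Taylor coefficients at 0 of smooth functions,
    so that convergence matters only for exp and (e^x - 1) / x. The absolute values in beta are
    resolved by the alternating signs of the coefficients of tanh, a consequence of tanh' = 1 -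
    tanh^2. *)

Section independence_of_sigma_algebras.
Context {d : measure_display} {T : measurableType d} {R : realType}.
Variable P : probability T R.

(** For E fixed, the restriction of P to E and the multiple of P by P E are finite measures in A
    that agree on the pi-system G, hence on the sigma-algebra that it generates. *)
Lemma product_rule_generated (G : set (set T)) (E : set T) :
  measurable E -> G `<=` measurable -> setI_closed G ->
  (forall A, G A -> P (A `&` E) = (P A * P E)%E) ->
  forall A, <<s G >> A -> P (A `&` E) = (P A * P E)%E.
Proof.
move=> mE Gm GI GE.
(* Uniqueness of measures needs the space covered by sets of the pi-system on which the measures are
   finite, hence the adjunction of [setT]. *)
pose G' := [set A | G A \/ A = setT].
have G'm : G' `<=` measurable by move=> A [/Gm//|->]; exact: measurableT.
have G'I : setI_closed G'.
  move=> A B [GA|->] [GB|->]; rewrite ?setTI ?setIT; [left; exact: GI|by left|by left|by right].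
have PE : (P E = (fine (P E))%:E)%E by rewrite fineK// fin_num_measure.
have PE0 : 0 <= fine (P E) by rewrite fine_ge0.
pose r := NngNum PE0.
have G'E A : G' A -> mrestr P mE A = mscale r P A.
  rewrite /mrestr /mscale/=; move=> [GA|->]; first by rewrite GE// -PE muleC.
  by rewrite setTI -PE probability_setT mule1.
move=> A GA; have /= := @g_sigma_algebra_measure_unique _ _ _ G' G'm (fun=> setT) _ _ (mrestr P mE) (mscale r P) G'I G'E _ A.
rewrite /mrestr /mscale/= -PE => ->; first by rewrite muleC.
- by move=> _; right.
- by rewrite bigcup_const//; exists 0%N.
- by move=> _; rewrite setTI (le_lt_trans (probability_le1 _ _))// ltry.
- apply: GA; split; [exact: smallest_sigma_algebra|by move=> B GB; apply: sub_gen_smallest; left].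
Qed.

End independence_of_sigma_algebras.

(** * Expectations: the product rule and integrability classes *)

Section expectation_of_products.
Context {d : measure_display} {T : measurableType d} {R : realType}.
Variable P : probability T R.

Definition intble (f : T -> R) : Prop := P.-integrable setT (EFin \o f).
(** Real-valued, so that ring and order tactics apply to expectations; the value carries information
    only for integrable functions, whence the [intble] hypotheses below. *)
Definition E (f : T -> R) : R := \int[P]_w f w.

Lemma E_EFin f : intble f -> (\int[P]_w (f w)%:E = (E f)%:E)%E.
Proof. by move=> fi; rewrite /E /Rintegral fineK//; exact: integrable_fin_num. Qed.

Section product_rule.
Variables U V : T -> R.
Hypotheses (mU : measurable_fun setT U) (mV : measurable_fun setT V).
Hypothesis UV : forall A B, measurable A -> measurable B ->
  P (U @^-1` A `&` V @^-1` B) = (P (U @^-1` A) * P (V @^-1` B))%E.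

Let X : T -> R * R := fun w => (U w, V w).

Let mX : measurable_fun setT X.
Proof. exact: measurable_fun_pair. Qed.

#[local] HB.instance Definition _ := isMeasurableFun.Build _ _ _ _ U mU.
#[local] HB.instance Definition _ := isMeasurableFun.Build _ _ _ _ V mV.
#[local] HB.instance Definition _ := isMeasurableFun.Build _ _ _ _ X mX.

(** The joint law and the product of the marginal laws agree on rectangles by [UV]. *)
Let mulUV_law (h : R * R -> \bar R) :
  (\int[distribution P (X : {mfun T >-> _})]_z h z =
   \int[distribution P (U : {mfun T >-> R}) \x distribution P (V : {mfun T >-> R})]_z h z)%E.
Proof.
apply: eq_measure_integral => A mA _.
by apply/esym/product_measure_unique => // B C mB mC; rewrite -?UV.
Qed.

Let mmul : measurable_fun setT ((fun z => (z.1 * z.2)%:E) : R * R -> \bar R).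
Proof.
apply/measurable_EFinP; apply: measurable_funM; [exact: measurable_fst|exact: measurable_snd].
Qed.

Let mabs : measurable_fun setT ((fun z => `|(z.1 * z.2)%:E|%E) : R * R -> \bar R).
Proof. exact: (measurableT_comp (@abse_measurable R setT) mmul). Qed.

Let mabs1 : measurable_fun setT ((fun z => `|z|%:E) : R -> \bar R).
Proof. by apply/measurable_EFinP; exact: normr_measurable. Qed.

(** Tonelli for the product law gives E |U V| = E |U| E |V|. Independence takes the place of square
    integrability, which matters when U is itself only the square of a coefficient. *)
Lemma intble_mul_indep : intble U -> intble V -> intble (fun w => U w * V w).
Proof.
move=> iU iV; apply/integrableP; split.
  by apply/measurable_EFinP; exact: measurable_funM.
have -> : (\int[P]_x `|(EFin \o (fun w => (U w * V w)%R)) x| =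
   \int[P]_x ((fun z : R * R => `|(z.1 * z.2)%R%:E|) \o (X : {mfun T >-> _})) x)%E by [].
rewrite -ge0_integral_distribution//.
rewrite mulUV_law fubini_tonelli1//=.
rewrite /fubini_F/=.
under eq_integral => x _.
  under eq_integral do rewrite normrM EFinM.
  rewrite ge0_integralZl//.
  over.
rewrite /= ge0_integralZr//; last exact: integral_ge0.
rewrite !ge0_integral_distribution//.
have ge0 (f : T -> R) : (0 <= \int[P]_x `|f x|%:E)%E by apply: integral_ge0 => x _; rewrite lee_fin.
apply: lte_mul_pinfty; [exact: ge0| |by case/integrableP: iV].
by rewrite ge0_fin_numE; [case/integrableP: iU|exact: ge0].
Qed.

Lemma E_mul_indep : intble U -> intble V -> E (fun w => U w * V w) = E U * E V.
Proof.
move=> iU iV; have iUV := intble_mul_indep iU iV.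
apply: EFin_inj; rewrite -E_EFin//.
have -> : (\int[P]_x (U x * V x)%R%:E =
   \int[P]_x ((fun z : R * R => (z.1 * z.2)%R%:E) \o (X : {mfun T >-> _})) x)%E by [].
rewrite -integral_distribution//.
have im : (distribution P (U : {mfun T >-> R}) \x distribution P (V : {mfun T >-> R}))%E.-integrable
   setT (fun z : R * R => (z.1 * z.2)%:E).
  apply/integrableP; split => //.
  rewrite -mulUV_law ge0_integral_distribution//.
  by case/integrableP: iUV.
rewrite mulUV_law -integral12_prod_meas1// /fubini_F/=.
have EV : (\int[distribution P (V : {mfun T >-> R})]_y y%:E = (E V)%:E)%E.
  by rewrite integral_distribution//= E_EFin.
have iV' : (distribution P (V : {mfun T >-> R})).-integrable setT (EFin : R -> \bar R).
  apply/integrableP; split => //.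
  rewrite ge0_integral_distribution//.
  by case/integrableP: iV.
have iU' : (distribution P (U : {mfun T >-> R})).-integrable setT (EFin : R -> \bar R).
  apply/integrableP; split => //.
  rewrite ge0_integral_distribution//.
  by case/integrableP: iU.
under eq_integral => x _.
  under eq_integral do rewrite EFinM.
  rewrite integralZl// EV.
  over.
rewrite /= integralZr// integral_distribution//=.
by rewrite E_EFin.
Qed.

End product_rule.

End expectation_of_products.

Section expectation_calculus.
Context {d : measure_display} {T : measurableType d} {R : realType}.
Variable P : probability T R.
Local Notation intble := (intble P).
Local Notation E := (E P).
Implicit Types f g : T -> R.

Lemma intble_measurable f : intble f -> measurable_fun setT f.
Proof. by move=> /integrableP[/measurable_EFinP]. Qed.

Lemma intble_cst (c : R) : intble (fun=> c).
Proof.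
exact: finite_measure_integrable_cst.
Qed.

Lemma intbleD f g : intble f -> intble g -> intble (fun w => f w + g w).
Proof. by move=> fi gi; have := integrableD measurableT fi gi; apply: eq_integrable. Qed.

Lemma intbleZ c f : intble f -> intble (fun w => c * f w).
Proof. by move=> fi; have := integrableZl measurableT c fi; apply: eq_integrable. Qed.

Lemma intbleB f g : intble f -> intble g -> intble (fun w => f w - g w).
Proof. by move=> fi gi; have := integrableB measurableT fi gi; apply: eq_integrable. Qed.

Lemma intble_sum (I : Type) (s : seq I) (Q : pred I) (F : I -> T -> R) :
  (forall i, Q i -> intble (F i)) -> intble (fun w => \sum_(i <- s | Q i) F i w).
Proof.
move=> Fi; elim: s => [|i s IH].
  by rewrite (_ : (fun _ => _) = fun=> 0) ?funeqE => [|w]; [exact: intble_cst|rewrite big_nil].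
rewrite (_ : (fun _ => _) = fun w => (if Q i then F i w else 0) + \sum_(j <- s | Q j) F j w).
  apply: intbleD => //; case Qi: (Q i); [exact: Fi|exact: intble_cst].
by apply/funext => w; rewrite big_cons; case: ifP; rewrite ?add0r.
Qed.

Lemma intble_le f g : measurable_fun setT f -> (forall w, `|f w| <= g w) ->
  intble g -> intble f.
Proof.
move=> mf fg gi; apply: (le_integrable measurableT _ _ gi); first exact/measurable_EFinP.
by move=> w _ /=; rewrite lee_fin; exact: le_trans (fg w) (ler_norm _).
Qed.

Lemma ED f g : intble f -> intble g -> E (fun w => f w + g w) = E f + E g.
Proof. by move=> fi gi; exact: RintegralD. Qed.

Lemma EB f g : intble f -> intble g -> E (fun w => f w - g w) = E f - E g.
Proof. by move=> fi gi; exact: RintegralB. Qed.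

Lemma EZ c f : intble f -> E (fun w => c * f w) = c * E f.
Proof. by move=> fi; exact: RintegralZl. Qed.

Lemma E_cst c : E (fun=> c) = c.
Proof. by rewrite /E Rintegral_cst//= probability_setT mulr1. Qed.

Lemma E_sum (I : Type) (s : seq I) (Q : pred I) (F : I -> T -> R) :
  (forall i, Q i -> intble (F i)) ->
  E (fun w => \sum_(i <- s | Q i) F i w) = \sum_(i <- s | Q i) E (F i).
Proof.
move=> Fi; elim: s => [|i s IH].
  rewrite big_nil (_ : (fun _ => _) = fun=> 0) ?E_cst// funeqE => w.
  by rewrite big_nil.
rewrite big_cons (_ : (fun _ => _) = fun w => (if Q i then F i w else 0) + \sum_(j <- s | Q j) F j w).
  rewrite ED; last exact: intble_sum.
    by case Qi: (Q i); rewrite ?E_cst ?add0r IH.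
  by case Qi: (Q i); [exact: Fi|exact: intble_cst].
by apply/funext => w; rewrite big_cons; case: ifP; rewrite ?add0r.
Qed.

Lemma le_E f g : intble f -> intble g -> (forall w, f w <= g w) -> E f <= E g.
Proof. by move=> fi gi fg; exact: le_Rintegral. Qed.

Lemma E_ge0 f : (forall w, 0 <= f w) -> 0 <= E f.
Proof. by move=> f0; exact: Rintegral_ge0. Qed.

Lemma le_normE f g : measurable_fun setT f -> (forall w, `|f w| <= g w) ->
  intble g -> `|E f| <= E g.
Proof.
move=> mf fg gi; have fi := intble_le mf fg gi.
apply: (le_trans (le_normr_Rintegral measurableT fi)).
apply: le_E => //; apply: intble_le gi; first exact: measurableT_comp.
by move=> w; rewrite normr_id.
Qed.

Definition sqint f : Prop := measurable_fun setT f /\ intble (fun w => f w ^+ 2).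

Lemma sqint_mul f g : sqint f -> sqint g -> intble (fun w => f w * g w).
Proof.
move=> [mf fi] [mg gi]; apply: (intble_le _ _ (intbleD fi gi)).
  exact: measurable_funM.
move=> w; rewrite normrM -(real_normK (num_real (f w))) -(real_normK (num_real (g w))).
by nra.
Qed.

Lemma sqint_cst c : sqint (fun=> c).
Proof. by split; [exact: measurable_cst|exact: intble_cst]. Qed.

Lemma sqintD f g : sqint f -> sqint g -> sqint (fun w => f w + g w).
Proof.
move=> fi gi; split; first by apply: measurable_funD; [case: fi|case: gi].
rewrite (_ : (fun w => _) = fun w => (f w ^+ 2 + g w ^+ 2) + 2 * (f w * g w)).
  by apply: intbleD; [apply: intbleD; [case: fi|case: gi]|exact/intbleZ/sqint_mul].
by apply/funext => w; ring.
Qed.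

Lemma sqintZ c f : sqint f -> sqint (fun w => c * f w).
Proof.
move=> [mf fi]; split; first exact: measurable_funM.
rewrite (_ : (fun w => _) = fun w => c ^+ 2 * f w ^+ 2); first exact: intbleZ.
by apply/funext => w; rewrite exprMn.
Qed.

Lemma sqintB f g : sqint f -> sqint g -> sqint (fun w => f w - g w).
Proof.
move=> fi gi; rewrite (_ : (fun w => _) = fun w => f w + -1 * g w).
  by apply: sqintD => //; exact: sqintZ.
by apply/funext => w; rewrite mulN1r.
Qed.

Lemma sqint_sum (I : Type) (s : seq I) (F : I -> T -> R) :
  (forall i, sqint (F i)) -> sqint (fun w => \sum_(i <- s) F i w).
Proof.
move=> Fi; elim: s => [|i s IH].
  by rewrite (_ : (fun _ => _) = fun=> 0) ?funeqE => [|w]; [exact: sqint_cst|rewrite big_nil].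
rewrite (_ : (fun _ => _) = fun w => F i w + \sum_(j <- s) F j w); first exact: sqintD.
by apply/funext => w; rewrite big_cons.
Qed.

(** Unlike [sqint], this class is closed under products, so it contains every polynomial in the
    increments. *)
Definition all_moments f : Prop :=
  measurable_fun setT f /\ forall p, intble (fun w => `|f w| ^+ p).

Lemma all_moments_cst c : all_moments (fun=> c).
Proof. by split=> [|p]; [exact: measurable_cst|exact: intble_cst]. Qed.

Lemma all_momentsM f g : all_moments f -> all_moments g -> all_moments (fun w => f w * g w).
Proof.
move=> [mf fi] [mg gi]; split; first exact: measurable_funM.
(* The bound is x y <= x^2 + y^2 for the p-th powers x and y, hence the moments of order 2 p. *)
move=> p; apply: (intble_le _ _ (intbleD (fi (p * 2)%N) (gi (p * 2)%N))).
  by apply/measurable_funX/measurableT_comp => //; exact: measurable_funM.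
move=> w; rewrite normrX normr_id normrM exprMn !exprM.
set x := _ ^+ p; set y := _ ^+ p.
have : 0 <= x by exact: exprn_ge0.
have : 0 <= y by exact: exprn_ge0.
by nra.
Qed.

Lemma exprDn_le (x y : R) p : 0 <= x -> 0 <= y -> (x + y) ^+ p <= 2 ^+ p * (x ^+ p + y ^+ p).
Proof.
move=> x0 y0; wlog xy : x y x0 y0 / x <= y.
  move=> H; have [xy|/ltW yx] := leP x y; first exact: H.
  by rewrite (addrC x) (addrC (x ^+ p)); exact: H.
apply: (@le_trans _ _ ((2 * y) ^+ p)).
  by rewrite lerXn2r ?nnegrE ?addr_ge0// ?mulr_ge0//; lra.
by rewrite exprMn ler_wpM2l ?exprn_ge0// lerDr exprn_ge0.
Qed.

Lemma all_momentsD f g : all_moments f -> all_moments g -> all_moments (fun w => f w + g w).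
Proof.
move=> [mf fi] [mg gi]; split; first exact: measurable_funD.
move=> p; apply: (intble_le _ _ (intbleZ (2 ^+ p) (intbleD (fi p) (gi p)))).
  by apply/measurable_funX/measurableT_comp => //; exact: measurable_funD.
move=> w; rewrite normrX normr_id.
apply: le_trans (exprDn_le p (normr_ge0 _) (normr_ge0 _)).
by rewrite lerXn2r ?nnegrE ?addr_ge0// ler_normD.
Qed.

Lemma all_momentsB f g : all_moments f -> all_moments g -> all_moments (fun w => f w - g w).
Proof.
move=> fi gi; rewrite (_ : (fun w => _) = fun w => f w + -1 * g w).
  by apply: all_momentsD => //; apply: all_momentsM => //; exact: all_moments_cst.
by apply/funext => w; rewrite mulN1r.
Qed.

Lemma all_momentsX f n : all_moments f -> all_moments (fun w => f w ^+ n).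
Proof.
move=> fi; elim: n => [|n IH]; first exact: all_moments_cst.
by under eq_fun do rewrite exprS; exact: all_momentsM.
Qed.

Lemma all_moments_sum (I : Type) (s : seq I) (F : I -> T -> R) :
  (forall i, all_moments (F i)) -> all_moments (fun w => \sum_(i <- s) F i w).
Proof.
move=> Fi; elim: s => [|i s IH].
  by rewrite (_ : (fun _ => _) = fun=> 0) ?funeqE => [|w]; [exact: all_moments_cst|rewrite big_nil].
rewrite (_ : (fun _ => _) = fun w => F i w + \sum_(j <- s) F j w); first exact: all_momentsD.
by apply/funext => w; rewrite big_cons.
Qed.

Lemma all_moments_intble f : all_moments f -> intble f.
Proof. by move=> [mf /(_ 1%N)]; apply: intble_le. Qed.

Lemma all_moments_sqint f : all_moments f -> sqint f.
Proof.
move=> [mf fi]; split => //; have := fi 2%N; congr (intble _).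
by apply/funext => w; rewrite real_normK// num_real.
Qed.

End expectation_calculus.

(** * Adaptedness and independence from a sigma-algebra *)

Section adapted.
Context {d : measure_display} {T : measurableType d} {R : realType}.
Variable P : probability T R.
Implicit Types (G H : set (set T)) (f g : T -> R).

Definition adapted G f : Prop := forall B, measurable B -> G (f @^-1` B).

Lemma adapted_sub G H f : G `<=` H -> adapted G f -> adapted H f.
Proof. by move=> GH Gf B mB; exact/GH/Gf. Qed.

Lemma adapted_measurable G f : G `<=` measurable -> adapted G f -> measurable_fun setT f.
Proof. by move=> Gm Gf _ B mB; rewrite setTI; exact/Gm/Gf. Qed.

(** On the space equipped with [<<s H >>], adaptedness is plain measurability and inherits its
    closure properties. *)
Lemma adaptedP H f :
  adapted <<s H >> f <-> measurable_fun setT (f : g_sigma_algebraType H -> R).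
Proof.
split=> [Hf _ B mB|mf B mB]; first by rewrite setTI; exact: Hf.
by have := mf measurableT B mB; rewrite setTI.
Qed.

Lemma adapted_cst H c : adapted <<s H >> (fun=> c : R).
Proof. by apply/adaptedP; exact: measurable_cst. Qed.

Lemma adaptedD H f g : adapted <<s H >> f -> adapted <<s H >> g ->
  adapted <<s H >> (fun w => f w + g w).
Proof. by move=> /adaptedP Hf /adaptedP Hg; apply/adaptedP; exact: measurable_funD. Qed.

Lemma adaptedB H f g : adapted <<s H >> f -> adapted <<s H >> g ->
  adapted <<s H >> (fun w => f w - g w).
Proof. by move=> /adaptedP Hf /adaptedP Hg; apply/adaptedP; exact: measurable_funB. Qed.

Lemma adaptedM H f g : adapted <<s H >> f -> adapted <<s H >> g ->
  adapted <<s H >> (fun w => f w * g w).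
Proof. by move=> /adaptedP Hf /adaptedP Hg; apply/adaptedP; exact: measurable_funM. Qed.

Lemma adaptedX H f n : adapted <<s H >> f -> adapted <<s H >> (fun w => f w ^+ n).
Proof. by move=> /adaptedP Hf; apply/adaptedP; exact: measurable_funX. Qed.

Lemma adapted_sum H (I : Type) (s : seq I) (F : I -> T -> R) :
  (forall i, adapted <<s H >> (F i)) -> adapted <<s H >> (fun w => \sum_(i <- s) F i w).
Proof. by move=> HF; apply/adaptedP; apply: measurable_sum => i; exact/adaptedP. Qed.

Lemma sub_g_sigma_algebra G H : G `<=` <<s H >> -> <<s G >> `<=` <<s H >>.
Proof. by move=> GH; apply: smallest_sub => //; exact: smallest_sigma_algebra. Qed.

Definition indep_from G f : Prop :=
  forall A B, G A -> measurable B -> P (A `&` f @^-1` B) = (P A * P (f @^-1` B))%E.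

Lemma indep_from_product_rule G U V : adapted G U -> indep_from G V ->
  forall A B, measurable A -> measurable B ->
  P (U @^-1` A `&` V @^-1` B) = (P (U @^-1` A) * P (V @^-1` B))%E.
Proof. by move=> GU GV A B mA mB; apply: GV => //; exact: GU. Qed.

Lemma indep_from_comp G f (h : R -> R) : measurable_fun setT h ->
  indep_from G f -> indep_from G (h \o f).
Proof.
move=> mh Gf A B GA mB; rewrite comp_preimage; apply: Gf => //.
by have := mh measurableT B mB; rewrite setTI.
Qed.

End adapted.

(** * Independence of Wiener increments from the past *)

Section wiener_past.
Context {d : measure_display} {T : measurableType d} {R : realType}.
Variable P : probability T R.
Variable W : R -> {RV P >-> R}.
Hypothesis hW : is_wiener W.

Definition past (s : R) : set (set T) :=
  <<s \bigcup_(r in `[0, s]) preimage_set_system setT (W r) measurable >>.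

Lemma preimage_RV_measurable r : preimage_set_system setT (W r) measurable `<=` measurable.
Proof. by move=> _ [B mB <-]; exact: measurable_funP. Qed.

Lemma past_measurable s : past s `<=` measurable.
Proof.
apply: smallest_sub; first exact: sigma_algebra_measurable.
by move=> A [r _]; exact: preimage_RV_measurable.
Qed.

Section fixed_times.
Variables (m : nat) (tau : nat -> R).
Hypotheses (tau0 : tau 0%N = 0) (tau_le : forall i, (i < m.+1)%N -> tau i <= tau i.+1).
Let D i w : R := W (tau i.+1) w - W (tau i) w.

Let mD i B : measurable B -> measurable (D i @^-1` B).
Proof.
move=> mB; rewrite -[X in measurable X]setTI; apply: measurable_funB => //.
Qed.

(** A pi-system for the values of W at the times tau. The coordinate [W 0] is kept apart: increments
    determine values only up to [W 0], which vanishes almost surely but perhaps not everywhere. *)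
Let boxes : set (set T) := [set A | exists B0 (B : nat -> set R),
  [/\ measurable B0, forall i, measurable (B i) &
      A = W 0 @^-1` B0 `&` \bigcap_(i in `I_m) (D i @^-1` B i)]].

Let mboxes : boxes `<=` measurable.
Proof.
move=> _ [B0 [B [mB0 mB ->]]]; apply: measurableI.
  by rewrite -[X in measurable X]setTI; exact: measurable_funP.
by apply: fin_bigcap_measurable => [|i _]; [exact: finite_II|exact: mD].
Qed.

Let setI_boxes : setI_closed boxes.
Proof.
move=> _ _ [B0 [B [mB0 mB ->]]] [C0 [C [mC0 mC ->]]].
exists (B0 `&` C0), (fun i => B i `&` C i); split.
- exact: measurableI.
- by move=> i; exact: measurableI.
- rewrite preimage_setI setIACA; congr (_ `&` _).
  by rewrite -bigcapI; apply: eq_bigcapr => i _; rewrite preimage_setI.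
Qed.

Let mRV r B : measurable B -> measurable (W r @^-1` B).
Proof. by move=> mB; rewrite -[X in measurable X]setTI; exact: measurable_funP. Qed.

Let start_sure A : measurable A -> P A = P (W 0 @^-1` [set 0] `&` A).
Proof.
move=> mA; have m0 : measurable (W 0 @^-1` [set 0]) by exact: mRV.
have n0 : P (~` (W 0 @^-1` [set 0])) = 0%E.
  by apply/negligibleP; [exact: measurableC|exact: (wiener_start hW)].
rewrite -[in LHS](setTI A) -(setUv (W 0 @^-1` [set 0])) setIUl.
rewrite measureU0//; [exact: measurableI|apply: measurableI => //; exact: measurableC|].
apply: subset_measure0 n0 => //; last by apply: measurableC.
by apply: measurableI => //; exact: measurableC.
Qed.

(** As [W 0] is 0 almost surely, a constraint on it is either void or satisfied on a null set
    only. *)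
Let prob_start B0 A : measurable A -> measurable B0 ->
  P (W 0 @^-1` B0 `&` A) = if 0 \in B0 then P A else 0%E.
Proof.
move=> mA mB0; rewrite start_sure; last by apply: measurableI => //; exact: mRV.
case: ifPn => [/set_mem B00|/negP B00].
- rewrite [RHS]start_sure//; congr (P _); apply/seteqP; split=> w /=.
    by move=> [-> [_ ?]].
  by move=> [W0 Aw]; rewrite W0.
- rewrite (_ : _ `&` _ = set0) ?measure0//; apply/seteqP; split=> w //= [W0 []].
  by rewrite W0 => B0w; case: B00; exact/mem_set.
Qed.

Let last_increment (B : nat -> set R) C : (forall i, measurable (B i)) -> measurable C ->
  P (\bigcap_(i in `I_m) (D i @^-1` B i) `&` D m @^-1` C) =
  (P (\bigcap_(i in `I_m) (D i @^-1` B i)) * P (D m @^-1` C))%E.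
Proof.
move=> mB mC.
have rule C' : measurable C' -> P (\bigcap_(i in `I_m) (D i @^-1` B i) `&` D m @^-1` C') =
   (\prod_(i < m) P (D i @^-1` B i) * P (D m @^-1` C'))%E.
  move=> mC'; pose B' (i : 'I_m.+1) := if (i < m)%N then B i else C'.
  have := @wiener_independent_increments _ _ _ _ _ hW m.+1 tau _ tau_le B'.
  have BmE : B' ord_max = C' by rewrite /B'/= ltnn.
  rewrite tau0 lexx big_ord_recr/= BmE => /(_ isT) rule.
  transitivity (P (\bigcap_(i in [set: 'I_m.+1]) (D i @^-1` B' i))).
    congr (P _); apply/seteqP; split=> w /=.
    + move=> [H Cw] i _ /=; rewrite /B'; case: ltnP => im; first exact: H.
      have -> : i = m :> nat by apply/eqP; rewrite eqn_leq im -ltnS ltn_ord.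
      exact: Cw.
    + move=> H; split=> [i im|].
        have := H (Ordinal (leq_trans im (leqnSn m))) I; rewrite /B' /=.
        by rewrite im.
      by have := H ord_max I; rewrite /B'/= ltnn.
  rewrite rule; last by move=> i; rewrite /B'; case: ifP.
  congr (_ * _)%E; apply: eq_bigr => i _.
  by rewrite /B' /= ltn_ord.
rewrite rule//; congr (_ * _)%E.
(* With no constraint on the last increment, the rule identifies the product of the first m factors
   with the probability of their intersection. *)
have := rule setT measurableT; rewrite preimage_setT setIT probability_setT mule1 => ->//.
Qed.

(** The value at [tau j] is [W 0] plus a sum of increments, hence measurable for the sigma-algebra
    of the boxes, and [product_rule_generated] reduces the claim to boxes. *)
Lemma values_indep_last_increment (l : seq R) :
  (forall u, u \in l -> exists2 j, (j <= m)%N & u = tau j) ->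
  indep_from P <<s \bigcup_(u in [set` l]) preimage_set_system setT (W u) measurable >>
    (fun w => W (tau m.+1) w - W (tau m) w).
Proof.
move=> ltau A C lA mC.
have W0box : adapted <<s boxes >> (W 0).
  move=> B mB; apply: sub_gen_smallest; exists B, (fun=> setT); split=> //.
  by rewrite bigcapT ?setIT// => i _; rewrite preimage_setT.
have Dbox i : (i < m)%N -> adapted <<s boxes >> (D i).
  move=> im B mB; apply: sub_gen_smallest.
  exists setT, (fun j => if j == i then B else setT); split=> //.
    by move=> j; case: ifP.
  rewrite preimage_setT setTI; apply/seteqP; split=> w /=.
    by move=> Bw j jm /=; case: eqP => [->|].
  by move=> /(_ i im)/=; rewrite eqxx.
have Wbox j : (j <= m)%N -> adapted <<s boxes >> (W (tau j)).
  elim: j => [_|j IH jm]; first by rewrite tau0.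
  rewrite (_ : (W (tau j.+1) : T -> R) = fun w => W (tau j) w + D j w); last first.
    by apply/funext => w; rewrite /D addrC subrK.
  by apply: adaptedD; [exact: IH (ltnW jm)|exact: Dbox].
have {}lA : <<s boxes >> A.
  move: A lA; apply: sub_g_sigma_algebra => A [u /ltau[j jm ->]] [B mB <-].
  by rewrite setTI; exact: Wbox.
move: A lA; apply: product_rule_generated => //; first exact: mD.
move=> _ [B0 [B [mB0 mB ->]]]; rewrite -setIA.
have mcap : measurable (\bigcap_(i in `I_m) (D i @^-1` B i)).
  by apply: fin_bigcap_measurable => [|i _]; [exact: finite_II|exact: mD].
rewrite !prob_start//; last by apply: measurableI => //; exact: (mD m).
by case: ifP => _; [exact: last_increment|rewrite mul0e].
Qed.

End fixed_times.

(** The events that depend on finitely many times in [0, s] form a pi-system that generates the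
    past, and each of them falls under [values_indep_last_increment] for a suitable subdivision. *)
Lemma past_indep_increment (s r : R) : 0 <= s -> s <= r ->
  indep_from P (past s) (fun w => W r w - W s w).
Proof.
move=> s0 sr A C sA mC.
pose fin_past := [set A | exists2 l : seq R, (forall u, u \in l -> 0 <= u <= s) &
  <<s \bigcup_(u in [set` l]) preimage_set_system setT (W u) measurable >> A].
have fin_past_sub (l : seq R) : (forall u, u \in l -> 0 <= u <= s) ->
   <<s \bigcup_(u in [set` l]) preimage_set_system setT (W u) measurable >> `<=` past s.
  move=> ls; apply: sub_g_sigma_algebra => B [u /= /ls us] uB.
  by apply: sub_gen_smallest; exists u.
have {}sA : <<s fin_past >> A.
  move: A sA; apply: sub_g_sigma_algebra => A [u /= us uA].
  apply: sub_gen_smallest; exists [:: u] => [v|]; first by rewrite inE => /eqP ->.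
  by apply: sub_gen_smallest; exists u => //=; rewrite inE.
have mW : measurable_fun setT (fun w => W r w - W s w) by exact: measurable_funB.
move: A sA; apply: product_rule_generated.
- by rewrite -[X in measurable X]setTI; exact: mW.
- by move=> A [l ls /(fin_past_sub _ ls)]; exact: past_measurable.
- move=> A B [l ls lA] [l' ls' lB]; exists (l ++ l').
    by move=> u; rewrite mem_cat => /orP[/ls|/ls'].
  apply: (@measurableI _ (g_sigma_algebraType (\bigcup_(u in [set` l ++ l']) preimage_set_system setT (W u) measurable))).
    move: A lA; apply: sub_g_sigma_algebra => A [u /= ul uA].
    by apply: sub_gen_smallest; exists u => //=; rewrite mem_cat ul.
  move: B lB; apply: sub_g_sigma_algebra => B [u /= ul uB].
  by apply: sub_gen_smallest; exists u => //=; rewrite mem_cat ul orbT.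
- move=> A [l ls lA].
  (* The sorted times are framed by 0 and by s, r: the subdivision starts at 0, and its last
     increment is the one over [s, r]. *)
  pose t := 0 :: sort <=%O l ++ [:: s; r].
  have st : sorted <=%O t.
    rewrite /t /= cat_path; apply/andP; split.
      rewrite path_sortedE; last exact: le_trans.
      rewrite sort_le_sorted andbT; apply/allP => u; rewrite mem_sort.
      by move=> /ls /andP[].
    rewrite /= sr !andbT; have := mem_last 0 (sort <=%O l).
    by rewrite inE mem_sort => /orP[/eqP ->//|/ls /andP[]].
  pose tau := nth r t.
  have szt : size t = (size l).+3 by rewrite /t /= size_cat size_sort addn2.
  have tau_le i : (i < (size l).+2)%N -> tau i <= tau i.+1.
    move=> il; apply: le_sorted_leq_nth => //; rewrite inE szt.
    - exact: ltnW.
    - by [].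
  have := @values_indep_last_increment (size l).+1 tau erefl tau_le l _ A C lA mC.
  have -> : tau (size l).+2 = r.
    by rewrite /tau /t /= nth_cat size_sort ltnNge leqnSn/= subSnn.
  have -> : tau (size l).+1 = s.
    by rewrite /tau /t /= nth_cat size_sort ltnn subnn.
  apply=> u; rewrite -(mem_sort <=%O) => ul; exists (index u (sort <=%O l)).+1.
    by rewrite ltnS -(size_sort <=%O) index_size.
  by rewrite /tau /t /= nth_cat index_mem ul nth_index.
Qed.

End wiener_past.

Section joint_past.
Context {d : measure_display} {T : measurableType d} {R : realType}.
Variable P : probability T R.
Implicit Types V W : R -> {RV P >-> R}.

(** The two processes are observed up to different times, so that the increment of W over a step can
    be split off when V is already known up to the end of that step. *)
Definition joint_past V W (s r : R) : set (set T) := <<s past V s `|` past W r >>.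

Lemma past_process_sigma W (s : R) : past W s `<=` process_sigma W.
Proof.
apply: sub_g_sigma_algebra => A [u /= us uA]; apply: sub_gen_smallest; exists u => //=.
by move: us; rewrite !in_itv/= andbT => /andP[].
Qed.

Lemma adapted_process_sigma W (u : R) : 0 <= u -> adapted (process_sigma W) (W u).
Proof.
move=> u0 B mB; apply: sub_gen_smallest; exists u; first by rewrite /= in_itv/= u0.
by exists B => //; rewrite setTI.
Qed.

Lemma adapted_past W (s u : R) : 0 <= u <= s -> adapted (past W s) (W u).
Proof.
by move=> us B mB; apply: sub_gen_smallest; exists u => //; exists B => //; rewrite setTI.
Qed.

Lemma adapted_joint_past_l V W (s r u : R) : 0 <= u <= s -> adapted (joint_past V W s r) (V u).
Proof. by move=> us B mB; apply: sub_gen_smallest; left; exact: adapted_past. Qed.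

Lemma adapted_joint_past_r V W (s r u : R) : 0 <= u <= r -> adapted (joint_past V W s r) (W u).
Proof. by move=> us B mB; apply: sub_gen_smallest; right; exact: adapted_past. Qed.

Lemma joint_past_measurable V W (s r : R) : joint_past V W s r `<=` measurable.
Proof.
apply: smallest_sub; first exact: sigma_algebra_measurable.
by move=> A [|]; exact: past_measurable.
Qed.

Lemma past_le W (s s' : R) : s <= s' -> past W s `<=` past W s'.
Proof.
move=> ss'; apply: sub_g_sigma_algebra => A [u /= us uA]; apply: sub_gen_smallest; exists u => //=.
by move: us; rewrite !in_itv/= => /andP[-> us]; exact: le_trans us ss'.
Qed.

Lemma joint_past_le V W (s r s' r' : R) : s <= s' -> r <= r' ->
  joint_past V W s r `<=` joint_past V W s' r'.
Proof.
move=> ss' rr'; apply: sub_g_sigma_algebra => A [sA|rA]; apply: sub_gen_smallest.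
- by left; exact: past_le sA.
- by right; exact: past_le rA.
Qed.

Lemma joint_pastC V W (s r : R) : joint_past V W s r = joint_past W V r s.
Proof. by rewrite /joint_past setUC. Qed.

Lemma natural_filtration_joint_past V W (s : R) :
  natural_filtration V W s `<=` joint_past V W s s.
Proof.
apply: sub_g_sigma_algebra => A [u /= us [] [B mB <-]]; rewrite setTI.
- exact: adapted_joint_past_l.
- exact: adapted_joint_past_r.
Qed.

Lemma joint_past_natural_filtration V W (s : R) :
  joint_past V W s s `<=` natural_filtration V W s.
Proof.
apply: sub_g_sigma_algebra => A [] sA; apply: sub_g_sigma_algebra sA.
- by move=> B [u us uB]; apply: sub_gen_smallest; exists u => //; left.
- by move=> B [u us uB]; apply: sub_gen_smallest; exists u => //; right.
Qed.

(** It suffices to treat intersections of a V-event with a W-event. The W-event and the increment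
    together lie in the sigma-algebra of W, so independence of the processes splits off the V-event,
    whatever the time s, and the rest is [past_indep_increment]. *)
Lemma joint_past_indep_increment V W (s r r' : R) : is_wiener W -> independent_processes V W ->
  0 <= r -> r <= r' -> indep_from P (joint_past V W s r) (fun w => W r' w - W r w).
Proof.
move=> hW VW r0 rr' A C sA mC.
pose pi := [set A | exists A1 A2, [/\ past V s A1, past W r A2 & A = A1 `&` A2]].
have {}sA : <<s pi >> A.
  move: A sA; apply: sub_g_sigma_algebra => A [sA|rA]; apply: sub_gen_smallest.
  - exists A, setT; split; rewrite ?setIT//.
    exact: (@measurableT _ (g_sigma_algebraType (\bigcup_(u in `[0, r]) preimage_set_system setT (W u) measurable))).
  - exists setT, A; split; rewrite ?setTI//.
    exact: (@measurableT _ (g_sigma_algebraType (\bigcup_(u in `[0, s]) preimage_set_system setT (V u) measurable))).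
have mD : measurable_fun setT (fun w => W r' w - W r w) by exact: measurable_funB.
have WD : adapted (process_sigma W) (fun w => W r' w - W r w).
  by apply: adaptedB; apply: adapted_process_sigma; rewrite ?(le_trans r0).
move: A sA; apply: product_rule_generated.
- by rewrite -[X in measurable X]setTI; exact: mD.
- move=> _ [A1 [A2 [VA1 WA2 ->]]].
  by apply: measurableI; [exact: past_measurable VA1|exact: past_measurable WA2].
- move=> _ _ [A1 [A2 [VA1 WA2 ->]]] [B1 [B2 [VB1 WB2 ->]]].
  exists (A1 `&` B1), (A2 `&` B2); split; last by rewrite setIACA.
  + exact: (@measurableI _ (g_sigma_algebraType (\bigcup_(u in `[0, s]) preimage_set_system setT (V u) measurable))).
  + exact: (@measurableI _ (g_sigma_algebraType (\bigcup_(u in `[0, r]) preimage_set_system setT (W u) measurable))).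
- move=> _ [A1 [A2 [VA1 WA2 ->]]]; rewrite -setIA.
  have pVA1 := past_process_sigma VA1.
  have pWA2 := past_process_sigma WA2.
  rewrite (VW _ _ pVA1 pWA2) -muleA -(past_indep_increment hW r0 rr')//.
  apply: VW => //.
  apply: (@measurableI _ (g_sigma_algebraType (\bigcup_(u in `[0, +oo[) preimage_set_system setT (W u) measurable))) => //.
  exact: WD.
Qed.

End joint_past.

(** * Gaussian moments by way of the moment generating function *)

Section normal_moments.
Context {R : realType}.
Local Notation mu := (@lebesgue_measure R).

(** The Radon-Nikodym density is almost everywhere the Gaussian density because both have the same
    integral over every measurable set. *)
Lemma ge0_integral_normal_prob (m s : R) (f : R -> \bar R) :
  measurable_fun setT f -> (forall x, 0 <= f x)%E ->
  (\int[normal_prob m s]_x f x = \int[mu]_x (f x * (normal_pdf m s x)%:E))%E.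
Proof.
move=> mf f0.
have dom := @normal_prob_dominates R m s.
rewrite -(Radon_Nikodym_SigmaFinite.change_of_variables dom)//.
apply: ae_eq_integral => //.
- apply: emeasurable_funM => //; apply: (measurable_int mu).
  exact: Radon_Nikodym_SigmaFinite.f_integrable.
- by apply: emeasurable_funM => //; apply/measurable_EFinP; exact: measurable_normal_pdf.
- apply: ae_eqe_mul2l => /=; apply: integral_ae_eq => //=.
  + exact: Radon_Nikodym_SigmaFinite.f_integrable.
  + by apply/measurable_EFinP; exact: measurable_normal_pdf.
  + by move=> E _ mE; rewrite -Radon_Nikodym_SigmaFinite.f_integral.
Qed.

Lemma normal_mgf (s a : R) : s != 0 ->
  (\int[normal_prob 0 s]_x (expR (a * x))%:E = (expR (a ^+ 2 * s ^+ 2 / 2))%:E)%E.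
Proof.
move=> s0; rewrite ge0_integral_normal_prob; last 2 first.
- by apply/measurable_EFinP; apply: measurableT_comp => //; exact: measurable_funM.
- by move=> x; rewrite lee_fin expR_ge0.
under eq_integral => x _.
  (* Completing the square: tilting the centred density moves its mean to a s^2. *)
  rewrite -EFinM (_ : expR (a * x) * normal_pdf 0 s x = expR (a ^+ 2 * s ^+ 2 / 2) * normal_pdf (a * s ^+ 2) s x).
    rewrite EFinM; over.
  rewrite !normal_pdfE//= mulrCA [RHS]mulrCA; congr (_ * _).
  rewrite /normal_fun -!expRD; congr expR.
  by field.
rewrite ge0_integralZl//=.
- by rewrite integral_normal_pdf mule1.
- by apply/measurable_EFinP; exact: measurable_normal_pdf.
- by move=> x _; rewrite lee_fin normal_pdf_ge0.
Qed.

End normal_moments.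

Section exponential_taylor.
Context {R : realType}.

Lemma exp_partial_sum_le (y : R) n : 0 <= y -> \sum_(k < n) y ^+ k / k`!%:R <= expR y.
Proof.
move=> y0; have := @nondecreasing_cvgn_le R (series (exp_coeff y)) _ (is_cvg_series_exp_coeff y) n.
rewrite /series/= big_mkord; apply.
by apply/nondecreasing_seqP => k; rewrite /series/= big_nat_recr//= lerDl divr_ge0// exprn_ge0.
Qed.

(** Since (n + k)! >= k!, the tail is termwise at most |y|^n times the series of exp |y|. *)
Lemma exp_taylor (y : R) n :
  `|expR y - \sum_(k < n) y ^+ k / k`!%:R| <= `|y| ^+ n * expR `|y|.
Proof.
have cv : (series (exp_coeff y) N - \sum_(k < n) y ^+ k / k`!%:R) @[N --> \oo] -->
    expR y - \sum_(k < n) y ^+ k / k`!%:R.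
  by apply: cvgB; [exact: is_cvg_series_exp_coeff|exact: cvg_cst].
move/cvg_norm : cv => cv; apply: (cvgr_to_le cv); near=> N.
have nN : (n <= N)%N by near: N; exact: nbhs_infty_ge.
rewrite /series/= -(subnKC nN) big_mkord big_split_ord/= addrAC subrr add0r.
apply: (le_trans (ler_norm_sum _ _ _)).
apply: (@le_trans _ _ (\sum_(k < N - n) `|y| ^+ n * (`|y| ^+ k / k`!%:R))); last first.
  by rewrite -mulr_sumr ler_wpM2l ?exprn_ge0// exp_partial_sum_le.
apply: ler_sum => k _; rewrite /exp_coeff/= normrM normrX exprD -mulrA ler_wpM2l ?exprn_ge0//.
rewrite ler_wpM2l ?exprn_ge0// normfV normr_nat lef_pV2 ?posrE ?ltr0n ?fact_gt0//.
rewrite ler_nat addnC; have fact_le p q : (p`! <= (p + q)`!)%N.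
  elim: q => [|q IH]; first by rewrite addn0.
  by rewrite addnS factS (leq_trans IH)// leq_pmull.
exact: fact_le.
Unshelve. all: by end_near. Qed.

Lemma powr_le_exp (y : R) n : `|y| ^+ n <= n`!%:R * expR `|y|.
Proof.
rewrite mulrC -ler_pdivrMr ?ltr0n ?fact_gt0//.
have := exp_partial_sum_le n.+1 (normr_ge0 y); rewrite big_ord_recr/=; apply: le_trans.
by rewrite lerDr sumr_ge0// => i _; rewrite divr_ge0// exprn_ge0.
Qed.

Lemma exp_norm_le (y : R) : expR `|y| <= expR y + expR (- y).
Proof.
have [y0|y0] := leP 0 y; first by rewrite ger0_norm// lerDl expR_ge0.
by rewrite ltr0_norm// lerDr expR_ge0.
Qed.

Lemma le_all_small_eq0 (b K : R) : (forall a, 0 < a -> a <= 1 -> `|b| <= K * a) -> b = 0.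
Proof.
move=> H; apply/eqP; rewrite -normr_le0 leNgt; apply/negP => b0.
have bK : `|b| <= K by have := H 1 ltr01 (lexx _); rewrite mulr1.
have K0 : 0 < K by exact: lt_le_trans bK.
have := H (`|b| / (2 * K)); rewrite divr_gt0 ?mulr_gt0// => /(_ isT).
rewrite ler_pdivrMr ?mulr_gt0// mul1r => /(_ _)/wrap[]; first by lra.
rewrite (_ : K * _ = `|b| / 2); first by lra.
by field; rewrite gt_eqF.
Qed.

(** Repeated division by a. This reads moments of order 1 to 3 off the moment generating function
    without differentiating under the integral sign. *)
Lemma cubic_small_eq0 (b c e K : R) :
  (forall a, 0 < a -> a <= 1 -> `|a * b + a ^+ 2 * c + a ^+ 3 * e| <= K * a ^+ 4) ->
  [/\ b = 0, c = 0 & e = 0].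
Proof.
move=> H.
have K0 : 0 <= K by have /(le_trans (normr_ge0 _)) := H 1 ltr01 (lexx _); rewrite !expr1n mulr1.
have div_a (u v : R) a n : 0 < a -> `|a * u + a * v| <= K * a ^+ n.+1 -> `|u| <= K * a ^+ n + `|v|.
  move=> a0; rewrite -mulrDr normrM gtr0_norm// exprS mulrCA ler_pM2l// => uv.
  rewrite -lerBlDr; apply: le_trans uv.
  by rewrite -(normrN v) (le_trans (lerB_dist _ _))// opprK.
have small (a x : R) n : 0 < a -> a <= 1 -> `|a ^+ n.+1 * x| <= `|x| * a.
  move=> a0 a1; rewrite normrM normrX gtr0_norm// mulrC ler_wpM2l// exprS ler_piMr//; first exact: ltW.
  by rewrite exprn_ile1// ltW.
have Ksmall a n : 0 < a -> a <= 1 -> K * a ^+ n.+1 <= K * a.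
  by move=> a0 a1; have := small a K n a0 a1; rewrite (ger0_norm K0) mulrC ger0_norm// mulr_ge0// exprn_ge0// ltW.
have b0 : b = 0.
  apply: (@le_all_small_eq0 b (K + (`|c| + `|e|))) => a a0 a1.
  have := @div_a b (a * c + a ^+ 2 * e) a 3 a0.
  rewrite (_ : a * b + _ = a * b + a ^+ 2 * c + a ^+ 3 * e); last by ring.
  move=> /(_ (H a a0 a1))/le_trans; apply.
  rewrite mulrDl mulrDl lerD// ?Ksmall//; apply: (le_trans (ler_normD _ _)).
  by rewrite lerD// ?small// -[in leLHS](expr1 a) small.
have c0 : c = 0.
  apply: (@le_all_small_eq0 c (K + `|e|)) => a a0 a1.
  have := @div_a c (a * e) a 2 a0.
  rewrite -(ler_pM2l a0) (_ : a * `|_| = `|a * b + a ^+ 2 * c + a ^+ 3 * e|); last first.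
    by rewrite -[X in X * _](gtr0_norm a0) -normrM; congr `|_|; rewrite b0; ring.
  rewrite mulrCA -exprS => /(_ (H a a0 a1))/le_trans; apply.
  by rewrite mulrDl lerD// ?Ksmall// -[in leLHS](expr1 a) small.
have e0 : e = 0.
  apply: (@le_all_small_eq0 e K) => a a0 a1.
  have := H a a0 a1; rewrite b0 c0 !mulr0 !add0r normrM gtr0_norm ?exprn_gt0//.
  by rewrite [a ^+ 4]exprS mulrA mulrC ler_pM2r ?exprn_gt0.
by [].
Qed.

End exponential_taylor.

Section gaussian.
Context {d : measure_display} {T : measurableType d} {R : realType}.
Variable P : probability T R.
Local Notation intble := (intble P).
Local Notation E := (E P).
Variables (h : R) (D : T -> R).
Hypotheses (h0 : 0 < h) (mD : measurable_fun setT D).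
Hypothesis D_law : forall B, measurable B -> P (D @^-1` B) = normal_prob 0 (Num.sqrt h) B.

(* [normal_prob] lives on [measurableTypeR R], whose display differs from that of [R]. *)
Let D' : T -> measurableTypeR R := D.
#[local] HB.instance Definition _ := @isMeasurableFun.Build _ _ T (measurableTypeR R) D' mD.

Lemma gaussian_mgfe a : (\int[P]_w (expR (a * D w))%:E = (expR (a ^+ 2 * h / 2))%:E)%E.
Proof.
have mexp : measurable_fun setT (fun x : R => (expR (a * x))%:E).
  by apply/measurable_EFinP; apply: measurableT_comp => //; exact: measurable_funM.
have -> : a ^+ 2 * h / 2 = a ^+ 2 * Num.sqrt h ^+ 2 / 2 by rewrite sqr_sqrtr// ltW.
rewrite -normal_mgf ?gt_eqF ?sqrtr_gt0//.
transitivity (\int[distribution P (D' : {mfun T >-> measurableTypeR R})]_x (expR (a * x))%:E)%E.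
  by rewrite ge0_integral_distribution// => x; rewrite lee_fin expR_ge0.
by apply: eq_measure_integral => A mA _; exact: D_law.
Qed.

Lemma measurable_exp_gaussian a : measurable_fun setT (fun w => expR (a * D w)).
Proof. by apply: measurableT_comp => //; exact: measurable_funM. Qed.

Lemma intble_exp_gaussian a : intble (fun w => expR (a * D w)).
Proof.
apply/integrableP; split; first by apply/measurable_EFinP; exact: measurable_exp_gaussian.
under eq_integral => w _ do rewrite /= ger0_norm ?expR_ge0//.
by rewrite gaussian_mgfe ltry.
Qed.

Lemma gaussian_mgf a : E (fun w => expR (a * D w)) = expR (a ^+ 2 * h / 2).
Proof. by rewrite /E /Rintegral gaussian_mgfe. Qed.

(** From |y|^n <= n! e^|y| at y = c D. The scale c is 1 when only integrability matters, and 1 /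
    sqrt h when the order in h does. *)
Lemma gaussian_pow_le (c : R) n w : 0 < c ->
  `|D w| ^+ n <= c ^- n * n`!%:R * (expR (c * D w) + expR (- c * D w)).
Proof.
move=> c0; rewrite -mulrA ler_pdivlMl ?exprn_gt0//.
have <- : `|c * D w| ^+ n = c ^+ n * `|D w| ^+ n by rewrite normrM exprMn gtr0_norm.
apply: le_trans (powr_le_exp _ _) _; rewrite ler_wpM2l// mulNr; exact: exp_norm_le.
Qed.

Lemma all_moments_gaussian : all_moments P D.
Proof.
split=> // n; apply: (intble_le (g := fun w => 1 ^- n * n`!%:R * (expR (1 * D w) + expR (- 1 * D w)))).
- by apply/measurable_funX/measurableT_comp.
- by move=> w; rewrite normrX normr_id; apply: gaussian_pow_le.
- by apply: intbleZ; apply: intbleD; exact: intble_exp_gaussian.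
Qed.

Lemma gaussian_abs_moment n : `|E (fun w => D w ^+ n)| <= 2 * expR (2^-1) * n`!%:R * Num.sqrt h ^+ n.
Proof.
(* At this scale both exponentials have mean e^(1/2), which explains the constant 2 e^(1/2). *)
pose c := (Num.sqrt h)^-1; have c0 : 0 < c by rewrite invr_gt0 sqrtr_gt0.
have := @le_normE _ _ _ P (fun w => D w ^+ n)
  (fun w => c ^- n * n`!%:R * (expR (c * D w) + expR (- c * D w))).
have c2 : c ^+ 2 * h / 2 = 2^-1.
  by rewrite /c exprVn sqr_sqrtr ?ltW// mulVf ?gt_eqF// mul1r.
rewrite EZ; last by apply: intbleD; exact: intble_exp_gaussian.
rewrite ED; [|exact: intble_exp_gaussian..].
rewrite !gaussian_mgf sqrrN c2 -exprVn invrK => H.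
apply: le_trans (H _ _ _) _.
- exact: measurable_funX.
- by move=> w; rewrite normrX; have := gaussian_pow_le n w c0; rewrite -exprVn invrK.
- by apply: intbleZ; apply: intbleD; exact: intble_exp_gaussian.
- by rewrite le_eqVlt; apply/orP; left; apply/eqP; ring.
Qed.

(** The mean of e^(a D) is expanded to order 3 in a under the expectation and also through its
    closed form; both remainders are O(a^4) for 0 < a <= 1, so [cubic_small_eq0] equates the
    coefficients. *)
Lemma gaussian_first_moments :
  [/\ E D = 0, E (fun w => D w ^+ 2) = h & E (fun w => D w ^+ 3) = 0].
Proof.
have iD n : intble (fun w => D w ^+ n) by exact/all_moments_intble/all_momentsX/all_moments_gaussian.
(* Dominates |D|^4 e^|D| <= 4! e^(2 |D|), hence the Taylor remainder of e^(a D) divided by a^4,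
   uniformly in 0 < a <= 1. *)
pose bnd w := 4`!%:R * (expR (2 * D w) + expR (- 2 * D w) + 2).
have ibnd : intble bnd.
  apply: intbleZ; apply: intbleD; last exact: intble_cst.
  by apply: intbleD; exact: intble_exp_gaussian.
have [b0 c0 e0] : [/\ E D = 0, (E (fun w => D w ^+ 2) - h) / 2 = 0 &
    E (fun w => D w ^+ 3) / 6 = 0].
  apply: (@cubic_small_eq0 R _ _ _ (E bnd + h ^+ 2 * expR h)) => a a0 a1.
  pose p w := (1 + a * D w) + (a ^+ 2 / 2 * D w ^+ 2 + a ^+ 3 / 6 * D w ^+ 3).
  have i1 : intble (fun w => a * D w) by apply: intbleZ; exact: (iD 1%N).
  have i2 : intble (fun w => a ^+ 2 / 2 * D w ^+ 2) by apply: intbleZ.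
  have i3 : intble (fun w => a ^+ 3 / 6 * D w ^+ 3) by apply: intbleZ.
  have i01 : intble (fun w => 1 + a * D w) by apply: intbleD => //; exact: intble_cst.
  have i23 := intbleD i2 i3.
  have ip : intble p by exact: intbleD.
  have Ep : E p = 1 + a * E D + (a ^+ 2 / 2 * E (fun w => D w ^+ 2) + a ^+ 3 / 6 * E (fun w => D w ^+ 3)).
    by rewrite (ED i01 i23) (ED (intble_cst P 1) i1) (ED i2 i3) E_cst !EZ//; exact: (iD 1%N).
  have tail1 : `|E (fun w => expR (a * D w)) - E p| <= E bnd * a ^+ 4.
    rewrite -EB//; last exact: intble_exp_gaussian.
    rewrite mulrC -EZ//; apply: le_normE.
    - apply: measurable_funB; first exact: measurable_exp_gaussian.
      exact: intble_measurable ip.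
    - move=> w; have := exp_taylor (a * D w) 4.
      rewrite !big_ord_recl big_ord0/= (_ : 1 / _ + _ = p w); last first.
        by rewrite /p /bump/= !factS fact0; field.
      move=> /le_trans; apply.
      rewrite normrM (gtr0_norm a0) exprMn -mulrA ler_wpM2l ?exprn_ge0 ?(ltW a0)//.
      rewrite /bnd; have aD : a * `|D w| <= `|D w| by rewrite ler_piMl.
      have e1 : expR (a * `|D w|) <= expR `|D w| by rewrite ler_expR.
      have e2 : expR `|D w| * expR `|D w| = expR `|2 * D w|.
        by rewrite -expRD normrM gtr0_norm//; congr expR; ring.
      have := exp_norm_le (2 * D w); rewrite -e2 -mulNr => e3.
      have := powr_le_exp (D w) 4; have := expR_gt0 `|D w|.
      set X := expR `|D w| in e1 e2 e3 *; set Y := expR (a * _) in e1 *.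
      move=> X0 DX; apply: (@le_trans _ _ (4`!%:R * X * X)).
        by apply: ler_pM => //; rewrite ?exprn_ge0// expR_ge0.
      rewrite -mulrA ler_wpM2l//; lra.
    - exact: intbleZ.
  have tail2 : `|expR (a ^+ 2 * h / 2) - (1 + a ^+ 2 * h / 2)| <= h ^+ 2 * expR h * a ^+ 4.
    have := exp_taylor (a ^+ 2 * h / 2) 2.
    rewrite !big_ord_recl big_ord0/= expr0 expr1 !divr1 addr0 => /le_trans; apply.
    have y0 : 0 <= a ^+ 2 * h / 2 by rewrite divr_ge0// mulr_ge0// ?exprn_ge0 ?(ltW a0) ?(ltW h0).
    rewrite ger0_norm// [leRHS]mulrAC; apply: ler_pM; rewrite ?expR_ge0 ?exprn_ge0//.
      rewrite (_ : (a ^+ 2 * h / 2) ^+ 2 = h ^+ 2 * a ^+ 4 / 4); last by field.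
      by rewrite ler_pdivrMr// ler_peMr ?mulr_ge0 ?exprn_ge0 ?(ltW a0) ?(ltW h0)// ler1n.
    rewrite ler_expR ler_pdivrMr//; apply: (@le_trans _ _ (1 * h)); last by rewrite mul1r ler_peMr ?ler1n// ltW.
    by rewrite ler_wpM2r ?exprn_ile1 ?(ltW a0) ?(ltW h0).
  rewrite gaussian_mgf in tail1.
  have -> : a * E D + a ^+ 2 * ((E (fun w => D w ^+ 2) - h) / 2) + a ^+ 3 * (E (fun w => D w ^+ 3) / 6) =
      (expR (a ^+ 2 * h / 2) - (1 + a ^+ 2 * h / 2)) - (expR (a ^+ 2 * h / 2) - E p).
    by rewrite Ep; field.
  by rewrite mulrDl; apply: (le_trans (ler_normB _ _)); rewrite [leLHS]addrC lerD.
split=> //; lra.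
Qed.

End gaussian.

Section wiener_increments.
Context {d : measure_display} {T : measurableType d} {R : realType}.
Variable P : probability T R.
Local Notation intble := (intble P).
Local Notation E := (E P).
Variable W : R -> {RV P >-> R}.
Hypothesis hW : is_wiener W.

Lemma increment_all_moments (s r : R) : 0 <= s -> s <= r ->
  all_moments P (fun w => W r w - W s w).
Proof.
move=> s0; rewrite le_eqVlt => /predU1P[<-|sr].
  by under eq_fun do rewrite subrr; exact: all_moments_cst.
apply: (@all_moments_gaussian _ _ _ _ (r - s)); rewrite ?subr_gt0//.
  exact: measurable_funB.
by move=> B; exact: wiener_gaussian_increments.
Qed.

Lemma increment_moments (s r : R) : 0 <= s -> s <= r ->
  [/\ E (fun w => W r w - W s w) = 0, E (fun w => (W r w - W s w) ^+ 2) = r - s &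
      E (fun w => (W r w - W s w) ^+ 3) = 0].
Proof.
move=> s0; rewrite le_eqVlt => /predU1P[<-|sr].
  have z n : (fun w => (W s w - W s w) ^+ n.+1) = fun=> 0.
    by apply/funext => w; rewrite subrr expr0n.
  by rewrite (z 0%N) (z 1%N) (z 2%N) E_cst subrr.
apply: (@gaussian_first_moments _ _ _ _ (r - s)); rewrite ?subr_gt0//.
  exact: measurable_funB.
by move=> B; exact: wiener_gaussian_increments.
Qed.

Lemma increment_abs_moment (s r : R) n : 0 <= s -> s <= r ->
  `|E (fun w => (W r w - W s w) ^+ n)| <= 2 * expR (2^-1) * n`!%:R * Num.sqrt (r - s) ^+ n.
Proof.
move=> s0; rewrite le_eqVlt => /predU1P[<-|sr].
  under eq_fun do rewrite subrr; rewrite E_cst subrr sqrtr0.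
  case: n => [|n]; last by rewrite !expr0n/= normr0 mulr0.
  rewrite !expr0 normr1 fact0 !mulr1; have := expR_ge1Dx (2^-1 : R); lra.
apply: (@gaussian_abs_moment _ _ _ _ (r - s)); rewrite ?subr_gt0//.
  exact: measurable_funB.
by move=> B; exact: wiener_gaussian_increments.
Qed.

End wiener_increments.

(** * The Ito isometry for step processes *)

Section isometry.
Context {d : measure_display} {T : measurableType d} {R : realType}.
Variable P : probability T R.
Local Notation intble := (intble P).
Local Notation E := (E P).
Variables V W : R -> {RV P >-> R}.
Hypotheses (hW : is_wiener W) (VW : independent_processes V W).
Let Fil s := joint_past V W s s.
Local Notation inc a b := (fun w => W b w - W a w).

Lemma adapted_indep_mul (s r : R) (U : T -> R) n : 0 <= s -> s <= r ->
  adapted (Fil s) U -> intble U ->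
  intble (fun w => U w * (W r w - W s w) ^+ n) /\
  E (fun w => U w * (W r w - W s w) ^+ n) = E U * E (fun w => (W r w - W s w) ^+ n).
Proof.
move=> s0 sr sU iU.
have ii : intble (fun w => (W r w - W s w) ^+ n).
  exact/all_moments_intble/all_momentsX/increment_all_moments.
have mU : measurable_fun setT U := intble_measurable iU.
have mI : measurable_fun setT (fun w => (W r w - W s w) ^+ n) := intble_measurable ii.
have ind : indep_from P (Fil s) (fun w => (W r w - W s w) ^+ n).
  apply: (@indep_from_comp _ _ _ _ _ (inc s r) (fun x => x ^+ n)).
    exact: exprn_measurable.
  exact: joint_past_indep_increment.
have pr := indep_from_product_rule sU ind.
by split; [exact: intble_mul_indep|exact: E_mul_indep].
Qed.

Lemma increment_sqint_mul (s r : R) (c : T -> R) : 0 <= s -> s <= r ->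
  adapted (Fil s) c -> sqint P c -> sqint P (fun w => c w * (W r w - W s w)).
Proof.
move=> s0 sr sc [mc ic]; split.
  by apply: measurable_funM => //; exact: measurable_funB.
under eq_fun do rewrite exprMn.
by have [] := @adapted_indep_mul s r (fun w => c w ^+ 2) 2 s0 sr (adaptedX _ sc) ic.
Qed.

Lemma increment_mean0 (s r : R) (U : T -> R) : 0 <= s -> s <= r ->
  adapted (Fil s) U -> intble U ->
  intble (fun w => U w * (W r w - W s w)) /\ E (fun w => U w * (W r w - W s w)) = 0.
Proof.
move=> s0 sr sU iU; have [ii ->] := @adapted_indep_mul s r U 1 s0 sr sU iU; split => //.
by have [-> _ _] := increment_moments hW s0 sr; rewrite mulr0.
Qed.

(** The length of the common part of the two intervals: at once the covariance of the two increments
    and the integral of the product of the two indicators. *)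
Definition overlap (a b a' b' : R) := Num.max 0 (Num.min b b' - Num.max a a').

Lemma adapted_Fil_inc (a b s : R) : 0 <= a -> a <= b -> b <= s -> adapted (Fil s) (inc a b).
Proof.
move=> a0 ab bs; apply: adaptedB; apply: adapted_joint_past_r.
  by rewrite bs (le_trans a0).
by rewrite a0 (le_trans ab).
Qed.

Lemma adapted_Fil_le (s r : R) (c : T -> R) : s <= r -> adapted (Fil s) c -> adapted (Fil r) c.
Proof. by move=> sr; apply: adapted_sub; exact: joint_past_le. Qed.

(** If the first interval ends before the second begins, the later increment is independent of
    everything else and has mean 0. Otherwise the time axis is cut at a', m = min b b' and M = max b
    b': the products that involve [a, a'] or [m, M] have mean 0 for the same reason, and the square
    of the increment over [a', m] gives its length. *)
Let cross_ordered (a b a' b' : R) (c c' : T -> R) : 0 <= a -> a <= b -> a' <= b' ->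
  adapted (Fil a) c -> adapted (Fil a') c' -> sqint P c -> sqint P c' -> a <= a' ->
  E (fun w => (c w * (W b w - W a w)) * (c' w * (W b' w - W a' w))) =
  E (fun w => c w * c' w) * overlap a b a' b'.
Proof.
move=> a0 ab ab' sc sc' ic ic' aa'.
have a'0 : 0 <= a' := le_trans a0 aa'.
have b0 : 0 <= b := le_trans a0 ab.
have b'0 : 0 <= b' := le_trans a'0 ab'.
have sc_ : adapted (Fil a') c := adapted_Fil_le aa' sc.
rewrite /overlap (max_idPr aa').
have [ba'|a'b] := leP b a'.
  have [_ E1] := @increment_mean0 a' b' (fun w => c w * (W b w - W a w) * c' w) a'0 ab'
    (adaptedM (adaptedM sc_ (adapted_Fil_inc a0 ab ba')) sc')
    (sqint_mul (increment_sqint_mul a0 ab sc ic) ic').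
  under eq_fun do rewrite mulrA.
  by rewrite E1 (max_idPl _) ?mulr0// subr_le0 ge_min ba'.
pose m := Num.min b b'; pose M := Num.max b b'.
have a'm : a' <= m by rewrite le_min ab' ltW.
have m0 : 0 <= m := le_trans a'0 a'm.
have mM : m <= M by rewrite ge_min le_max lexx.
have [i1 E1] := @increment_mean0 a' b' (fun w => c w * (W a' w - W a w) * c' w) a'0 ab'
  (adaptedM (adaptedM sc_ (adapted_Fil_inc a0 aa' (lexx _))) sc')
  (sqint_mul (increment_sqint_mul a0 aa' sc ic) ic').
have [i2 E2] := @adapted_indep_mul a' m (fun w => c w * c' w) 2 a'0 a'm
  (adaptedM sc_ sc') (sqint_mul ic ic').
have [i3 E3] := @increment_mean0 m M (fun w => c w * (c' w * (W m w - W a' w))) m0 mM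
  (adaptedM (adapted_Fil_le (le_trans aa' a'm) sc)
     (adaptedM (adapted_Fil_le a'm sc') (adapted_Fil_inc a'0 a'm (lexx _))))
  (sqint_mul ic (increment_sqint_mul a'0 a'm sc' ic')).
rewrite -/m (max_idPr _) ?subr_ge0//.
have [_ <- _] := increment_moments hW a'0 a'm; rewrite -E2.
rewrite (_ : (fun w => _) = fun w => (c w * (W a' w - W a w) * c' w * (W b' w - W a' w) +
   c w * c' w * (W m w - W a' w) ^+ 2) +
   c w * (c' w * (W m w - W a' w)) * (W M w - W m w)).
  by rewrite (ED (intbleD i1 i2) i3) (ED i1 i2) E1 E3 add0r addr0.
apply/funext => w; rewrite /m /M; case: (leP b b') => _; ring.
Qed.

Lemma overlapC (a b a' b' : R) : overlap a b a' b' = overlap a' b' a b.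
Proof. by rewrite /overlap (minC b) (maxC a). Qed.

Lemma increment_cross (a b a' b' : R) (c c' : T -> R) : 0 <= a -> a <= b -> 0 <= a' -> a' <= b' ->
  adapted (Fil a) c -> adapted (Fil a') c' -> sqint P c -> sqint P c' ->
  E (fun w => (c w * (W b w - W a w)) * (c' w * (W b' w - W a' w))) =
  E (fun w => c w * c' w) * overlap a b a' b'.
Proof.
move=> a0 ab a'0 ab' sc sc' ic ic'; have [aa'|/ltW a'a] := leP a a'.
  exact: cross_ordered.
under eq_fun do rewrite mulrC; rewrite cross_ordered// overlapC; congr (E _ * _).
by apply/funext => w; rewrite mulrC.
Qed.

Lemma setI_itv_co (a b a' b' : R) :
  (`[a, b[ `&` `[a', b'[ = `[Num.max a a', Num.min b b'[)%classic.
Proof.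
apply/seteqP; split=> x /=; rewrite !in_itv/= ge_max lt_min.
  by move=> [/andP[-> ->] /andP[-> ->]].
by move=> /andP[/andP[-> ->] /andP[-> ->]].
Qed.

Let mu := @lebesgue_measure R.

Lemma integral_square_step (I : finType) (a0 b0 : R) (x a b : I -> R) :
  (forall i, a0 <= a i) -> (forall i, b i <= b0) ->
  (\int[mu]_(s in `[a0, b0]) (((\sum_i x i * \1_(`[a i, b i[%classic) s) ^+ 2)%:E)
   = (\sum_i \sum_j x i * x j * overlap (a i) (b i) (a j) (b j))%:E)%E.
Proof.
move=> a0a bb0.
pose A (p : I * I) := (`[a p.1, b p.1[ `&` `[a p.2, b p.2[)%classic.
pose f (p : I * I) (s : R) := ((x p.1 * x p.2)%:E * (\1_(A p) s)%:E)%E.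
have mA p : measurable (A p) by apply: measurableI.
have A0 p : A p `<=` `[a0, b0]%classic.
  move=> s [/=]; rewrite !in_itv/= => /andP[s1 s2] _.
  by rewrite (le_trans (a0a _) s1) (ltW (lt_le_trans s2 (bb0 _))).
have muA p : mu (A p) = (overlap (a p.1) (b p.1) (a p.2) (b p.2))%:E.
  rewrite /A setI_itv_co /mu lebesgue_measure_itv/= /overlap.
  rewrite lte_fin; case: (ltP (Num.max _ _)) => h.
    by have /max_idPr -> : 0 <= Num.min (b p.1) (b p.2) - Num.max (a p.1) (a p.2)
      by rewrite subr_ge0 ltW.
  by have /max_idPl -> : Num.min (b p.1) (b p.2) - Num.max (a p.1) (a p.2) <= 0
    by rewrite subr_le0.
have imu p : (\int[mu]_(s in `[a0, b0]) (\1_(A p) s)%:E = (overlap (a p.1) (b p.1) (a p.2) (b p.2))%:E)%E.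
  rewrite integral_indic//; last exact: mA.
  rewrite setIidl; [exact: muA|exact: A0].
have i1 p : mu.-integrable `[a0, b0] (fun s => (\1_(A p) s)%:E).
  apply/integrableP; split; first by apply/measurable_EFinP; apply: measurable_indic; exact: mA.
  under eq_integral => s _ do rewrite /= ger0_norm//.
  by rewrite imu ltry.
rewrite pair_bigA/=.
transitivity (\int[mu]_(s in `[a0, b0]) (\sum_(p : I * I) f p s)%E)%E.
  apply: eq_integral => s _; rewrite expr2 big_distrl/=.
  under eq_bigr do rewrite big_distrr/=.
  rewrite pair_bigA/= -sumEFin; apply: eq_bigr => p _.
  by rewrite /f /A indicI -EFinM; congr EFin; rewrite mulrACA.
rewrite integral_sum//; last by move=> p; exact: integrableZl.
rewrite -sumEFin; apply: eq_bigr => p _.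
by rewrite /f integralZl// imu.
Qed.

(** The intervals may overlap, so the difference of step processes on different partitions is
    covered without a common refinement. Both sides expand into the same double sum of E (c_i c_j)
    times overlaps. *)
Lemma ito_isometry (I : finType) (a0 b0 : R) (c : I -> T -> R) (a b : I -> R) :
  0 <= a0 -> (forall i, [/\ a0 <= a i, a i <= b i & b i <= b0]) ->
  (forall i, adapted (Fil (a i)) (c i)) -> (forall i, sqint P (c i)) ->
  (\int[P]_w \int[mu]_(s in `[a0, b0])
      (((\sum_i c i w * \1_(`[a i, b i[%classic) s) ^+ 2)%:E) =
   (E (fun w => (\sum_i c i w * (W (b i) w - W (a i) w)) ^+ 2))%:E)%E.
Proof.
move=> a00 ab sc ic.
under eq_integral => w _.
  rewrite integral_square_step; [over|by move=> i; case: (ab i)|by move=> i; case: (ab i)].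
have ia i : 0 <= a i by apply: le_trans a00 _; case: (ab i).
have iab i : a i <= b i by case: (ab i).
have icc i j : intble (fun w => c i w * c j w) by exact: sqint_mul.
have icc' i j : intble (fun w => c i w * c j w * overlap (a i) (b i) (a j) (b j)).
  by under eq_fun do rewrite mulrC; exact: intbleZ.
have isd i : sqint P (fun w => c i w * (W (b i) w - W (a i) w)) by exact: increment_sqint_mul.
rewrite E_EFin; last by apply: intble_sum => i _; apply: intble_sum.
congr EFin; rewrite E_sum; last by move=> i _; exact: intble_sum.
transitivity (E (fun w => \sum_i \sum_j (c i w * (W (b i) w - W (a i) w)) *
    (c j w * (W (b j) w - W (a j) w)))).
  rewrite E_sum; last by move=> i _; apply: intble_sum => j _; exact: sqint_mul.
  apply: eq_bigr => i _; rewrite !E_sum//; last by move=> j _; exact: sqint_mul.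
  apply: eq_bigr => j _; rewrite increment_cross//.
  by under eq_fun do rewrite mulrC; rewrite EZ// mulrC.
congr E; apply/funext => w; rewrite expr2 big_distrl/=.
by apply: eq_bigr => i _; rewrite big_distrr.
Qed.

End isometry.

Section expectation_notation.
Context {d : measure_display} {T : measurableType d} {R : realType}.
Variable P : probability T R.

Lemma expectation_E (f : T -> R) : intble P f -> ('E_P[f] = (E P f)%:E)%E.
Proof. by move=> fi; rewrite unlock E_EFin. Qed.

Lemma expectation_lty_intble (f : T -> R) : measurable_fun setT f -> (forall w, 0 <= f w) ->
  ('E_P[f] < +oo)%E -> intble P f.
Proof.
move=> mf f0; rewrite unlock => fy; apply/integrableP; split; first exact/measurable_EFinP.
by under eq_integral => w _ do rewrite /= ger0_norm//.
Qed.

End expectation_notation.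

(** * From Ito integrals to Riemann sums *)

Section mean_square_distance.
Context {d : measure_display} {T : measurableType d} {R : realType}.
Variable P : probability T R.
Variables a b : R.
Let mu := @lebesgue_measure R.
Let M : set (measurableTypeR R * T) := (`[a, b]%classic `*` [set: T]).

Let mM : measurable M.
Proof. by apply: measurableX => //; exact: measurable_itv. Qed.

Definition mean_square (f : R -> T -> R) : \bar R :=
  (\int[P]_w \int[mu]_(s in `[a, b]) ((f s w ^+ 2)%:E))%E.

(** Extension by zero outside [a, b], so that Tonelli applies on the whole product space. *)
Let sq_ext (f : R -> T -> R) (p : measurableTypeR R * T) : \bar R :=
  ((((fun q : measurableTypeR R * T => f q.1 q.2) \_ M) p) ^+ 2)%:E.

Let jointly (f : R -> T -> R) := measurable_fun M (fun p : measurableTypeR R * T => f p.1 p.2).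

Let msq_ext f : jointly f -> measurable_fun setT (sq_ext f).
Proof.
move=> mf; apply/measurable_EFinP/measurable_funX.
exact: (measurable_restrictT (fun q : measurableTypeR R * T => f q.1 q.2) mM).1 mf.
Qed.

Let sq_ext_ge0 f p : (0 <= sq_ext f p)%E.
Proof. by rewrite lee_fin sqr_ge0. Qed.

Let inner_ext f w : (\int[mu]_(s in `[a, b]) ((f s w ^+ 2)%:E) = \int[mu]_s sq_ext f (s, w))%E.
Proof.
rewrite integral_mkcond; apply: eq_integral => s _.
rewrite /sq_ext !patchE; case: ifPn => sab; case: ifPn => //.
- by move=> /negP []; apply/mem_set; split=> //; exact: set_mem.
- by move=> /set_mem [/mem_set]; rewrite (negbTE sab).
- by rewrite expr0n.
Qed.

Lemma mean_square_ext f : mean_square f = (\int[P]_w \int[mu]_s sq_ext f (s, w))%E.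
Proof. by apply: eq_integral => w _; exact: inner_ext. Qed.

Lemma mean_square_triangle f g h : jointly f -> jointly g -> jointly h ->
  (mean_square (fun s w => (f s w - g s w)%R) <=
   2%:E * mean_square (fun s w => (h s w - f s w)%R) +
   2%:E * mean_square (fun s w => (h s w - g s w)%R))%E.
Proof.
move=> mf mg mh.
have mB u v : jointly u -> jointly v -> jointly (fun s w => u s w - v s w).
  by move=> mu_ mv; exact: measurable_funB.
have mG u : jointly u -> measurable_fun setT (fun w => \int[mu]_s sq_ext u (s, w))%E.
  by move=> mu_; exact: (@measurable_fun_fubini_tonelli_G _ _ _ _ R mu _ (msq_ext mu_) (sq_ext_ge0 u)).
have msec u w : jointly u -> measurable_fun setT (fun s => sq_ext u (s, w)).
  by move=> mu_; exact: measurableT_comp (msq_ext mu_) (pair2_measurable _).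
have G0 u w : (0 <= \int[mu]_s sq_ext u (s, w))%E by apply: integral_ge0 => s _.
(* Used twice: for the outer integral over T, and for the inner time integral at each fixed w. *)
have comb dd (S : measurableType dd) (m : {measure set S -> \bar R}) (u v w : S -> \bar R) :
    measurable_fun setT u -> measurable_fun setT v -> measurable_fun setT w ->
    (forall x, 0 <= u x)%E -> (forall x, 0 <= v x)%E -> (forall x, 0 <= w x)%E ->
    (forall x, u x <= 2%:E * v x + 2%:E * w x)%E ->
    (\int[m]_x u x <= 2%:E * \int[m]_x v x + 2%:E * \int[m]_x w x)%E.
  move=> mu_ mv mw u0 v0 w0 uvw.
  have m2v := measurable_funeM 2%:E mv; have m2w := measurable_funeM 2%:E mw.
  have v20 x : (0 <= 2%:E * v x)%E by rewrite mule_ge0.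
  have w20 x : (0 <= 2%:E * w x)%E by rewrite mule_ge0.
  rewrite -!ge0_integralZl// -ge0_integralD//; apply: ge0_le_integral => //.
  exact: emeasurable_funD.
have mhf := mB _ _ mh mf; have mhg := mB _ _ mh mg; have mfg := mB _ _ mf mg.
rewrite !mean_square_ext; apply: (@comb) => //; [exact: mG..|].
move=> w; apply: (@comb) => //; [exact: msec..|].
move=> s; rewrite /sq_ext !patchE; case: ifP => _; last by rewrite !expr0n/= !mule0 adde0.
rewrite -!EFinM -EFinD lee_fin/=.
have := sqr_ge0 ((h s w - f s w) + (h s w - g s w)); nra.
Qed.

Let outer_ext f s : (\int[P]_w sq_ext f (s, w) =
  ((fun s => \int[P]_w ((f s w ^+ 2)%:E)) \_ `[a, b]) s)%E.
Proof.
rewrite patchE; case: ifPn => sab.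
- apply: eq_integral => w _; rewrite /sq_ext patchE ifT//.
  by apply/mem_set; split => //; exact: set_mem.
- rewrite integral0_eq// => w _; rewrite /sq_ext patchE ifF ?expr0n//.
  by apply/negP => /set_mem [/mem_set]; rewrite (negbTE sab).
Qed.

(** Tonelli puts the time integral outside, where the bound is integrated. The endpoint b is
    excluded from the hypothesis because step processes are 0 there; it is a null set. *)
Lemma mean_square_le f (delta : R) : a <= b -> 0 <= delta -> jointly f ->
  (forall s, a <= s < b -> (\int[P]_w ((f s w ^+ 2)%:E) <= delta%:E)%E) ->
  (mean_square f <= ((b - a) * delta)%:E)%E.
Proof.
move=> ab d0 mf fd.
rewrite mean_square_ext -(@fubini_tonelli _ _ _ _ R mu P _ (msq_ext mf) (sq_ext_ge0 f)).
have -> : (((b - a) * delta)%:E = \int[mu]_s (delta%:E * (\1_(`[a, b]%classic) s)%:E))%E.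
  rewrite integralZl//; last first.
    exact: (@integrable_indic_itv R a b true false).
  rewrite integral_indic//= setIT lebesgue_measure_itv/= lte_fin.
  case: ltP => [_|ba]; first by rewrite -EFinM mulrC.
  by rewrite (le_anti (introT andP (conj ab ba))) subrr mul0r mule0.
apply: ae_ge0_le_integral => //.
- by move=> s _; apply: integral_ge0.
- exact: (@measurable_fun_fubini_tonelli_F _ _ _ _ R P _ (msq_ext mf) (sq_ext_ge0 f)).
- by move=> s _; rewrite mule_ge0// lee_fin.
- apply: measurable_funeM; apply/measurable_EFinP; exact: measurable_indic.
exists [set b]; split; [exact: measurable_set1|exact: lebesgue_measure_set1|].
move=> s /= /not_implyP[_]; apply: contra_notP => sb.
rewrite outer_ext indicE patchE; case: ifPn => sab; last by rewrite mule0.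
rewrite mule1; apply: fd; move: sab; rewrite inE/= in_itv/= => /andP[-> /=].
by rewrite le_eqVlt => /predU1P[|//].
Qed.

End mean_square_distance.

Section step_processes.
Context {d : measure_display} {T : measurableType d} {R : realType}.
Variable P : probability T R.
Local Notation intble := (intble P).
Local Notation E := (E P).
Variables V W : R -> {RV P >-> R}.
Hypotheses (hW : is_wiener W) (VW : independent_processes V W).
Variable F : R -> set (set T).
Hypothesis F_past : forall s, F s `<=` joint_past V W s s.
Let mu := @lebesgue_measure R.
Implicit Types S : @step_process _ T R.

Lemma step_time_le a b S i j : is_step_process P F a b S -> (i <= j <= step_size S)%N ->
  step_time S i <= step_time S j.
Proof.
move=> [_ _ HS] /andP[ij]; elim: j ij => [|j IH]; first by rewrite leqn0 => /eqP ->.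
rewrite leq_eqVlt => /predU1P[-> //|ij] jS; apply: (le_trans (IH ij (ltnW jS))).
by have [] := HS j jS.
Qed.

Lemma step_times a b S i : is_step_process P F a b S -> (i < step_size S)%N ->
  [/\ a <= step_time S i, step_time S i <= step_time S i.+1 & step_time S i.+1 <= b].
Proof.
move=> HS iS; have [S0 Sn _] := HS; split.
- by rewrite -S0; apply: (step_time_le HS); rewrite leq0n (ltnW iS).
- by apply: (step_time_le HS); rewrite leqnSn iS.
- by rewrite -Sn; apply: (step_time_le HS); rewrite iS leqnn.
Qed.

Lemma step_coef_adapted a b S i : is_step_process P F a b S -> (i < step_size S)%N ->
  adapted (joint_past V W (step_time S i) (step_time S i)) (step_coef S i).
Proof.
move=> HS iS B mB; have [_ _ {}HS] := HS; have [_ cF _] := HS i iS; apply: F_past; apply: cF.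
by exists B => //; rewrite setTI.
Qed.

Lemma step_coef_sqint a b S i : is_step_process P F a b S -> (i < step_size S)%N ->
  sqint P (step_coef S i).
Proof.
move=> HS iS; have mc := adapted_measurable (@joint_past_measurable _ _ _ _ _ _ _ _)
  (step_coef_adapted HS iS).
have [_ _ /(_ i iS) [_ _ cy]] := HS; split=> //; apply: expectation_lty_intble => //.
- exact: measurable_funX.
- by move=> w; exact: sqr_ge0.
Qed.

Lemma step_integral_sqint a b S : 0 <= a -> is_step_process P F a b S ->
  sqint P (step_integral W S).
Proof.
move=> a0 HS; apply: sqint_sum => i.
have [ai ii _] := step_times HS (ltn_ord i).
apply: (increment_sqint_mul hW VW) => //; first exact: le_trans a0 ai.
- exact: (step_coef_adapted HS).
- exact: (step_coef_sqint HS).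
Qed.

Lemma step_isometry a b S S' : 0 <= a -> is_step_process P F a b S -> is_step_process P F a b S' ->
  mean_square P a b (fun s w => step_value S s w - step_value S' s w) =
  (E (fun w => (step_integral W S w - step_integral W S' w) ^+ 2))%:E.
Proof.
move=> a0 HS HS'.
(* The difference is one family of weighted intervals, indexed by the disjoint union, with the sign
   of the second half reversed. *)
pose I : finType := ('I_(step_size S) + 'I_(step_size S'))%type.
pose c (i : I) := match i with inl i => step_coef S i | inr j => fun w => -1 * step_coef S' j w end.
pose l (i : I) := match i with inl i => step_time S i | inr j => step_time S' j end.
pose r (i : I) := match i with inl i => step_time S i.+1 | inr j => step_time S' j.+1 end.
have := @ito_isometry _ _ _ P V W hW VW I a b c l r a0.
move=> /(_ _ _ _)/wrap[| | |H].
- by move=> [i|i]; [exact: (step_times HS)|exact: (step_times HS')].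
- move=> [i|i]; first exact: (step_coef_adapted HS).
  by apply: adaptedM; [exact: adapted_cst|exact: (step_coef_adapted HS')].
- move=> [i|i]; first exact: (step_coef_sqint HS).
  by apply: sqintZ; exact: (step_coef_sqint HS').
transitivity (E (fun w => (\sum_i c i w * (W (r i) w - W (l i) w)) ^+ 2))%:E.
  rewrite -H; apply: eq_integral => w _; apply: eq_integral => s _.
  rewrite /step_value big_sumType/=; congr (_ ^+ 2)%:E; congr (_ + _).
  by rewrite -sumrN; apply: eq_bigr => i _; rewrite -!mulrA mulN1r.
congr (E _)%:E; apply/funext => w; congr (_ ^+ 2).
rewrite /step_integral big_sumType/=; congr (_ + _).
by rewrite -sumrN; apply: eq_bigr => i _; rewrite -!mulrA mulN1r.
Qed.

Lemma step_value_jointly_measurable a b S : is_step_process P F a b S ->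
  measurable_fun (`[a, b]%classic `*` [set: T]) (fun p : R * T => step_value S p.1 p.2).
Proof.
move=> HS; apply: measurable_funTS; apply: measurable_sum => i.
apply: measurable_funM.
- by apply: measurableT_comp measurable_snd; have [] := step_coef_sqint HS (ltn_ord i).
- by apply: measurableT_comp measurable_fst; apply: measurable_indic.
Qed.

Lemma sqr_triangle (x y z : R) : (x - z) ^+ 2 <= 2 * (x - y) ^+ 2 + 2 * (y - z) ^+ 2.
Proof. by have := sqr_ge0 ((x - y) - (y - z)); nra. Qed.

(** The definition only provides some approximating sequence S j. Here I is compared with any chosen
    step process S' through S j: the isometry turns the distance between their integrals into one
    between integrands, which goes through H. The two triangle inequalities, each with factor 2,
    produce the 4. *)
Lemma ito_step_distance a b H (I : {RV P >-> R}) S' (delta : R) : 0 <= a ->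
  is_ito_integral F W a b H I -> is_step_process P F a b S' ->
  (mean_square P a b (fun s w => (H s w - step_value S' s w)%R) <= delta%:E)%E ->
  sqint P I /\ E (fun w => (I w - step_integral W S' w) ^+ 2) <= 4 * delta.
Proof.
move=> a0 [mH [S [HS cH cI]]] HS' Hd.
have close e : 0 < e -> exists2 j,
    (mean_square P a b (fun s w => (H s w - step_value (S j) s w)%R) < e%:E)%E &
    ('E_P[fun w => ((I w - step_integral W (S j) w) ^+ 2)%R] < e%:E)%E.
  move=> e0; have lt_near (u : nat -> \bar R) : u j @[j --> \oo] --> 0%E ->
      \forall j \near \oo, (u j < e%:E)%E.
    move=> /fine_cvgP[ufin /cvgr_lt /(_ e e0) ue]; near=> j.
    rewrite -(@fineK _ (u j)); last by near: j.
    by rewrite lte_fin; near: j.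
  have [j [? ?]] := filter_ex (filterI (lt_near _ cH) (lt_near _ cI)).
  by exists j.
have mI j : measurable_fun setT (fun w => I w - step_integral W (S j) w).
  apply: measurable_funB => //; by have [] := step_integral_sqint a0 (HS j).
have iI e j : ('E_P[fun w => ((I w - step_integral W (S j) w) ^+ 2)%R] < e%:E)%E ->
    intble (fun w => (I w - step_integral W (S j) w) ^+ 2).
  move=> Ie; apply: expectation_lty_intble; first exact: measurable_funX.
  - by move=> w; exact: sqr_ge0.
  - by rewrite (lt_trans Ie)// ltry.
have sI : sqint P I.
  have [j _ /iI iIj] := close 1 ltr01.
  rewrite (_ : (I : T -> R) = fun w => (I w - step_integral W (S j) w) + step_integral W (S j) w).
    by apply: sqintD; [split|exact: (step_integral_sqint a0 (HS j))].
  by apply/funext => w; rewrite subrK.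
split=> //; apply/ler_addgt0Pr => e e0.
(* The error enters twice, with weights 2 and 4, hence e / 6. *)
have [j Hj Ij] := close (e / 6) (divr_gt0 e0 (ltr0n _ 6)).
have iIj := iI _ _ Ij; rewrite expectation_E// lte_fin in Ij.
have sj := step_integral_sqint a0 (HS j); have s' := step_integral_sqint a0 HS'.
have [_ iss'] := sqintB sj s'.
have Ejs : E (fun w => (step_integral W (S j) w - step_integral W S' w) ^+ 2) <= 2 * (e / 6) + 2 * delta.
  rewrite -lee_fin -(step_isometry a0 (HS j) HS')//.
  apply: (le_trans (mean_square_triangle P (step_value_jointly_measurable (HS j))
    (step_value_jointly_measurable HS') mH)).
  by rewrite (EFinD (2 * (e / 6))) !(EFinM 2) leeD// lee_pmul2l ?fin_numE//= ltW.
apply: (@le_trans _ _ (2 * (e / 6) + 2 * (2 * (e / 6) + 2 * delta))); last by lra.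
apply: (@le_trans _ _ (E (fun w => 2 * (I w - step_integral W (S j) w) ^+ 2 +
    2 * (step_integral W (S j) w - step_integral W S' w) ^+ 2))).
  apply: le_E => [|| w]; last exact: sqr_triangle.
  - by have [] := sqintB sI s'.
  - by apply: intbleD; exact: intbleZ.
rewrite ED; [|exact: intbleZ..]; rewrite !EZ//.
by rewrite lerD// ler_wpM2l// ltW.
Unshelve. all: by end_near. Qed.

End step_processes.

Section riemann_sums.
Context {d : measure_display} {T : measurableType d} {R : realType}.
Variable P : probability T R.
Local Notation intble := (intble P).
Local Notation E := (E P).
Let mu := @lebesgue_measure R.

(** The one-step process with coefficient 1 equals the integrand on [a, s), so [ito_step_distance]
    applies with distance 0. That F u be a sigma-algebra makes the constant coefficient adapted. *)
Lemma ito_integral_of_one (V W : R -> {RV P >-> R}) (F : R -> set (set T)) (a s : R) (J : {RV P >-> R}) :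
  is_wiener W -> independent_processes V W ->
  (forall u, F u `<=` joint_past V W u u) -> 0 <= a -> a <= s ->
  (forall u, F u = <<s F u >>) ->
  is_ito_integral F W a s (fun _ _ => 1) J ->
  sqint P J /\ E (fun w => (J w - (W s w - W a w)) ^+ 2) = 0.
Proof.
move=> hW VW F_past a0 as_ sF HJ.
pose S := @StepProcess _ T R 1 (fun i => if i is 0%N then a else s) (fun _ _ => 1).
have HS : is_step_process P F a s S.
  split=> // -[|//] _; split=> //=.
  - by move=> A [B mB <-]; rewrite setTI sF; exact: adapted_cst.
  - by rewrite (_ : (fun _ => _) = fun=> 1) ?expectation_cst ?ltry//; apply/funext => w; rewrite expr1n.
have SE : step_integral W S = fun w => W s w - W a w.
  by apply/funext => w; rewrite /step_integral big_ord1 /= mul1r.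
have [] := ito_step_distance hW VW F_past a0 HJ HS (delta := 0).
  apply: le_trans (mean_square_le as_ (lexx 0) _ _) _.
  - apply: measurable_funB; first exact: measurable_cst.
    exact: (step_value_jointly_measurable F_past HS).
  - move=> u /andP[au us]; rewrite integral0_eq// => w _.
    rewrite /step_value big_ord1/= mul1r indicE mem_set ?subrr ?expr0n//.
    by rewrite /= in_itv/= au us.
  - by rewrite mulr0.
rewrite SE mulr0 => sJ J0; split=> //; apply/eqP; rewrite eq_le J0/=.
by apply: E_ge0 => w; exact: sqr_ge0.
Qed.

Section iterated.
Variables V W : R -> {RV P >-> R}.
Hypotheses (hV : is_wiener V) (hW : is_wiener W) (VW : independent_processes V W).
Variable F : R -> set (set T).
Hypothesis FE : forall s, F s = joint_past V W s s.
Variables (a : R) (N : nat).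
Hypotheses (a0 : 0 <= a) (N0 : (0 < N)%N).

Definition grid (i : nat) : R := a + i%:R / N%:R.

Lemma grid0 : grid 0 = a. Proof. by rewrite /grid mul0r addr0. Qed.

Lemma gridN : grid N = a + 1.
Proof. by rewrite /grid divff// pnatr_eq0 -lt0n. Qed.

Lemma gridS i : grid i.+1 - grid i = N%:R^-1.
Proof. by rewrite /grid -natr1; ring. Qed.

Lemma grid_le i j : (i <= j)%N -> grid i <= grid j.
Proof. by move=> ij; rewrite lerD2l ler_wpM2r ?invr_ge0// ler_nat. Qed.

Lemma grid_ge0 i : 0 <= grid i.
Proof. by rewrite addr_ge0// divr_ge0. Qed.

Lemma grid_ge i : a <= grid i.
Proof. by rewrite lerDl divr_ge0. Qed.

Definition riemann_step : step_process :=
  @StepProcess _ T R N grid (fun i w => V (grid i) w - V a w).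

Lemma riemann_step_process : is_step_process P F a (a + 1) riemann_step.
Proof.
split=> /=; [exact: grid0|exact: gridN|move=> i iN; split].
- exact: grid_le.
- move=> A [B mB <-]; rewrite setTI FE; apply: adaptedB => //.
  + by apply: adapted_joint_past_l; rewrite grid_ge0 lexx.
  + by apply: adapted_joint_past_l; rewrite a0 grid_ge.
- have [_ ii] := all_moments_sqint (increment_all_moments hV a0 (grid_ge i)).
  by rewrite expectation_E// ltry.
Qed.

Lemma grid_cell s : a <= s < a + 1 -> exists2 i : 'I_N, grid i <= s < grid i.+1 &
  forall w, step_value riemann_step s w = V (grid i) w - V a w.
Proof.
move=> /andP[as_ sa].
have x0 : 0 <= (s - a) * N%:R by rewrite mulr_ge0// subr_ge0.
have N0' : (0 : R) < N%:R by rewrite ltr0n.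
pose k := Num.truncn ((s - a) * N%:R).
have /andP[k1 k2] := truncn_itv x0.
have kN : (k < N)%N.
  by rewrite -(ltr_nat R) (le_lt_trans k1)// gtr_pMl// ltrBlDl.
have cell i : (grid i <= s < grid i.+1) = (i == k).
  rewrite /grid -!lerBrDl -!ltrBlDl ler_pdivrMr// ltr_pdivlMr//.
  by rewrite (eq_sym i) /k truncn_eq.
exists (Ordinal kN); first by rewrite cell.
move=> w; rewrite /step_value (bigD1 (Ordinal kN))//= big1 ?addr0.
  by rewrite indicE mem_set ?mulr1//= in_itv/= cell.
move=> i ik; rewrite indicE memNset ?mulr0//= in_itv/= cell => /eqP ikk.
by move/negP: ik; apply; apply/eqP/val_inj.
Qed.

(** The integrand J s is V s - V a up to a mean-square null error, and V moves by at most 1 / N in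
    mean square within a cell. Passing through V s - V a doubles this to 2 / N, and
    [ito_step_distance] multiplies it by 4. *)
Lemma iterated_integral_riemann_distance (I : {RV P >-> R}) :
  is_iterated_ito_integral F V W a (a + 1) I ->
  sqint P I /\
  E (fun w => (I w - \sum_(i < N) (V (grid i) w - V a w) * (W (grid i.+1) w - W (grid i) w)) ^+ 2)
    <= 8 / N%:R.
Proof.
move=> [J [HJ HI]].
have F_past s : F s `<=` joint_past V W s s by rewrite FE.
have WV : independent_processes W V by move=> A B WA VB; rewrite setIC muleC; exact: VW.
have F_past' s : F s `<=` joint_past W V s s by rewrite FE joint_pastC.
have sF s : F s = <<s F s >>.
  by rewrite FE sigma_algebra_id//; exact: smallest_sigma_algebra.
have [|sI] := ito_step_distance hW VW F_past a0 HI riemann_step_process (delta := 2 / N%:R);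
  last by rewrite mulrA -natrM.
have [mJ _] := HI.
apply: le_trans (@mean_square_le _ _ _ _ _ _ _ (2 / N%:R) _ _ _ _) _.
- by rewrite lerDl.
- by rewrite divr_ge0.
- by apply: measurable_funB => //; exact: (step_value_jointly_measurable F_past riemann_step_process).
- move=> s sab; have [i /andP[gs sg] stepE] := grid_cell sab.
  have /andP[as_ sa1] := sab.
  have sab' : a <= s <= a + 1 by rewrite as_ ltW.
  have [sJ J0] := ito_integral_of_one hV WV F_past' a0 as_ sF (HJ s sab').
  have gi0 := grid_ge0 i.
  have sV := all_moments_sqint (increment_all_moments hV a0 as_).
  have sVi := all_moments_sqint (increment_all_moments hV a0 (grid_ge i)).
  under eq_integral => w _ do rewrite stepE.
  rewrite E_EFin; last by have [] := sqintB sJ sVi.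
  rewrite lee_fin; apply: (@le_trans _ _ (E (fun w => 2 * (J s w - (V s w - V a w)) ^+ 2 +
     2 * ((V s w - V a w) - (V (grid i) w - V a w)) ^+ 2))).
    apply: le_E => [||w]; last exact: sqr_triangle.
    + by have [] := sqintB sJ sVi.
    + by apply: intbleD; apply: intbleZ; [have [] := sqintB sJ sV|have [] := sqintB sV sVi].
  rewrite ED; [|by apply: intbleZ; have [] := sqintB sJ sV|by apply: intbleZ; have [] := sqintB sV sVi].
  rewrite !EZ; [|by have [] := sqintB sV sVi|by have [] := sqintB sJ sV].
  rewrite J0 mulr0 add0r ler_wpM2l//.
  rewrite (_ : (fun w => _) = fun w => (V s w - V (grid i) w) ^+ 2); last first.
    by apply/funext => w; congr (_ ^+ 2); ring.
  have [_ -> _] := increment_moments hV gi0 gs.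
  by rewrite -(gridS i) lerD2r ltW.
- by rewrite (_ : a + 1 - a = 1) ?mul1r//; ring.
Qed.

End iterated.

End riemann_sums.

(** * One step of the chain: expansion and generator *)

Section peeling.
Context {R : comRingType}.

Lemma sum_weight0 (n n' : nat) (F : nat -> nat -> R) :
  \sum_(v < n.+3) \sum_(r < n'.+3) F v r * (v + r == 0)%N%:R = F 0%N 0%N.
Proof.
rewrite big_ord_recl [X in _ + X]big1 ?addr0 => [|i _].
  rewrite big_ord_recl [X in _ + X]big1 ?addr0 ?mulr1//.
  by move=> i _; rewrite mulr0.
by rewrite big1// => r _; rewrite mulr0.
Qed.

Lemma sum_weight2 (n n' : nat) (F : nat -> nat -> R) :
  \sum_(v < n.+3) \sum_(r < n'.+3) F v r * (v + r == 2)%N%:R = F 0%N 2 + F 1%N 1%N + F 2 0%N.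
Proof.
rewrite !big_ord_recl/=.
do 3 (rewrite big1 ?addr0 => [|i _]; last by rewrite mulr0).
rewrite big1 => [|i _]; last by rewrite big1// => r _; rewrite mulr0.
by rewrite !mulr0 !mulr1 !addr0 !add0r addrA.
Qed.

(** A range longer than the degree only adds vanishing binomials. With at least three indices
    available, the terms of order two in the increments can be extracted by the same formula for
    every exponent. *)
Lemma exprDn_wide (x y : R) n m : (n < m)%N ->
  (x + y) ^+ n = \sum_(k < m) 'C(n, k)%:R * (x ^+ (n - k) * y ^+ k).
Proof.
move=> nm; rewrite exprDn -(subnKC nm) big_split_ord/= [X in _ = _ + X]big1 ?addr0.
  by apply: eq_bigr => k _; rewrite mulr_natl.
by move=> k _; rewrite bin_small ?mul0r// ltnS leq_addr.
Qed.

(** [u] and [v] count the factors xi and eta taken from (x + xi)^i and (y + eta)^j; [r] and [s]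
    count the factors x eta and - y xi taken from the q-th power of the new area. *)
Definition step_coefficient (i j q v r u s : nat) : R :=
  'C(j, v)%:R * 'C(q, r)%:R * ('C(i, u)%:R * 'C(q - r, s)%:R * (-1) ^+ s).

Lemma step_expansion (x y a xi eta : R) i j q :
  (x + xi) ^+ i * (a + (x * eta - y * xi)) ^+ q * (y + eta) ^+ j =
  \sum_(v < j.+3) \sum_(r < q.+3) \sum_(u < i.+3) \sum_(s < q.+3)
    step_coefficient i j q v r u s *
    (x ^+ (i - u + r) * a ^+ (q - r - s) * y ^+ (j - v + s)) *
    (xi ^+ (u + s) * eta ^+ (v + r)).
Proof.
rewrite (exprDn_wide y eta (m := j.+3)); last by rewrite !ltnS ltnW.
rewrite big_distrr/=; apply: eq_bigr => v _.
rewrite (_ : a + _ = (a - y * xi) + x * eta); last by ring.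
rewrite (exprDn_wide _ (x * eta) (m := q.+3)); last by rewrite !ltnS ltnW.
rewrite big_distrr big_distrl/=; apply: eq_bigr => r _.
rewrite (exprDn_wide x xi (m := i.+3)); last by rewrite !ltnS ltnW.
rewrite big_distrl big_distrl/=; apply: eq_bigr => u _.
rewrite (exprDn_wide a (- (y * xi)) (m := q.+3)); last first.
  by rewrite (leq_ltn_trans (leq_subr _ _))// !ltnS ltnW.
rewrite (big_distrl (_ ^+ r)) /= big_distrr/= big_distrr big_distrl/=; apply: eq_bigr => s _.
rewrite /step_coefficient (exprNn (y * xi)) !exprMn !exprD; ring.
Qed.

End peeling.

Section one_step.
Context {R : realType}.
Variable K : nat -> R.
Hypothesis K0 : forall w, 0 <= K w.
Variable h : R.
Hypotheses (h0 : 0 <= h) (h1 : h <= 1).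

(** What the expansion uses of the moments of a centred Gaussian variable of variance h: exact
    values to order 3, and O(h^2) beyond. *)
Definition noise (M : nat -> R) : Prop :=
  [/\ M 0%N = 1, M 1%N = 0, M 2 = h, M 3 = 0 & forall w, (4 <= w)%N -> `|M w| <= K w * h ^+ 2].

(** The product of two moments minus its part of order at most one in h, which is 1 at (0, 0) and h
    at (2, 0) and (0, 2). *)
Definition noise_error (M1 M2 : nat -> R) (p w : nat) : R :=
  M1 p * M2 w - ((p == 0)%N && (w == 0)%N)%:R
  - h * ((p == 2)%N && (w == 0)%N)%:R - h * ((p == 0)%N && (w == 2)%N)%:R.

Lemma noise_error_le M1 M2 p w : noise M1 -> noise M2 ->
  `|noise_error M1 M2 p w| <= (4 <= p + w)%N%:R * ((1 + K p) * (1 + K w) * h ^+ 2).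
Proof.
move=> [a0 a1 a2 a3 a4] [b0 b1 b2 b3 b4]; rewrite /noise_error.
have hh : 0 <= h ^+ 2 by rewrite exprn_ge0.
have hh1 : h ^+ 2 <= 1 by rewrite exprn_ile1.
have bw : `|M2 w| <= 1 + K w.
  have := K0 w; case: w => [|[|[|[|w]]]] Kw; rewrite ?b0 ?b1 ?b2 ?b3 ?normr0 ?normr1 ?lerDl ?addr_ge0//.
    by rewrite ger0_norm// (le_trans h1)// lerDl.
  by apply: (le_trans (b4 w.+4 isT)); apply: (le_trans (ler_piMr Kw hh1)); rewrite lerDr.
have Kp := K0 p; have Kw := K0 w.
have KK : 0 <= (1 + K p) * (1 + K w) by rewrite mulr_ge0// addr_ge0.
have rhs0 : 0 <= (4 <= p + w)%N%:R * ((1 + K p) * (1 + K w) * h ^+ 2).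
  by apply: mulr_ge0 => //; apply: mulr_ge0.
have [p4|p4] := leqP 4 p.
  have [-> ->] : (p == 0)%N = false /\ (p == 2)%N = false by case: p p4 {a4 Kp KK rhs0} => [|[|[|]]].
  rewrite /= !mulr0 !subr0 (leq_trans p4 (leq_addr _ _)) mul1r normrM.
  apply: (@le_trans _ _ ((K p * h ^+ 2) * (1 + K w))); first by apply: ler_pM => //; exact: a4.
  by rewrite mulrAC ler_wpM2r// ler_wpM2r ?addr_ge0// lerDr.
have [w4|w4] := leqP 4 w.
  have [-> ->] : (w == 0)%N = false /\ (w == 2)%N = false by case: w w4 {bw Kw KK rhs0} => [|[|[|]]].
  rewrite !andbF /= !mulr0 !subr0 (leq_trans w4 (leq_addl _ _)) mul1r normrM.
  have M1p : `|M1 p| <= 1.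
    case: p p4 {Kp KK rhs0} => [|[|[|[|//]]]] _; rewrite ?a0 ?a1 ?a2 ?a3 ?normr0 ?normr1//.
    by rewrite ger0_norm.
  apply: (@le_trans _ _ (1 * (K w * h ^+ 2))); first by apply: ler_pM => //; exact: b4.
  rewrite mul1r ler_wpM2r//; apply: (@le_trans _ _ (1 * (1 + K w))).
    by rewrite mul1r lerDr.
  by rewrite ler_wpM2r ?addr_ge0// lerDl.
(* Both orders are now at most 3, and the only non-zero product of total order at least 4 is h * h
   at (2, 2). *)
have [/andP[/eqP p2 /eqP w2]|nn] := boolP ((p == 2) && (w == 2))%N.
  rewrite p2 w2 a2 b2 /= !mulr0 !subr0 mul1r -expr2 ger0_norm// ler_peMl//.
  by rewrite -[leLHS]mulr1 ler_pM// lerDl.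
set x := (X in `|X| <= _); suff -> : x = 0 by rewrite normr0.
rewrite {}/x; case: p p4 nn {Kp KK rhs0} => [|[|[|[|//]]]] _; case: w w4 {bw Kw} => [|[|[|[|//]]]] _ // _;
  rewrite ?a0 ?a1 ?a2 ?a3 ?b0 ?b1 ?b2 ?b3 /=; ring.
Qed.

(** The expectation of [step_expansion] when the two increments are independent of the past and of
    each other. *)
Definition transition (e e' : nat -> nat -> nat -> R) (M1 M2 : nat -> R) : Prop :=
  forall i j q, e' i j q =
  \sum_(v < j.+3) \sum_(r < q.+3) \sum_(u < i.+3) \sum_(s < q.+3)
    step_coefficient i j q v r u s * e (i - u + r)%N (j - v + s)%N (q - r - s)%N *
    (M1 (u + s)%N * M2 (v + r)%N).

(* The generator of the planar Brownian motion together with its area, on monomials. *)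
Definition generator (e : nat -> nat -> nat -> R) (i j q : nat) : R :=
  let G v r u s := step_coefficient i j q v r u s * e (i - u + r)%N (j - v + s)%N (q - r - s)%N in
  (G 0 0 0 2 + G 0 0 1 1 + G 0 0 2 0) + (G 0 2 0 0 + G 1 1 0 0 + G 2 0 0 0).

Lemma transition_error e e' M1 M2 i j q : transition e e' M1 M2 -> noise M1 -> noise M2 ->
  e' i j q = e i j q + h * generator e i j q +
  \sum_(v < j.+3) \sum_(r < q.+3) \sum_(u < i.+3) \sum_(s < q.+3)
    step_coefficient i j q v r u s * e (i - u + r)%N (j - v + s)%N (q - r - s)%N *
    noise_error M1 M2 (u + s) (v + r).
Proof.
move=> -> n1 n2.
pose G v r u s := step_coefficient i j q v r u s * e (i - u + r)%N (j - v + s)%N (q - r - s)%N.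
have S00 : \sum_(v < j.+3) \sum_(r < q.+3) \sum_(u < i.+3) \sum_(s < q.+3)
    G v r u s * (u + s == 0)%N%:R * (v + r == 0)%N%:R = G 0 0 0 0.
  rewrite -(sum_weight0 j q (fun v r => G v r 0 0)); apply: eq_bigr => v _; apply: eq_bigr => r _.
  rewrite -(sum_weight0 i q (G v r)) big_distrl/=; apply: eq_bigr => u _.
  by rewrite big_distrl.
have S20 : \sum_(v < j.+3) \sum_(r < q.+3) \sum_(u < i.+3) \sum_(s < q.+3)
    G v r u s * (u + s == 2)%N%:R * (v + r == 0)%N%:R = G 0 0 0 2 + G 0 0 1 1 + G 0 0 2 0.
  rewrite -(sum_weight0 j q (fun v r => G v r 0 2 + G v r 1 1 + G v r 2 0)).
  apply: eq_bigr => v _; apply: eq_bigr => r _.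
  rewrite -(sum_weight2 i q (G v r)) big_distrl/=; apply: eq_bigr => u _.
  by rewrite big_distrl.
have S02 : \sum_(v < j.+3) \sum_(r < q.+3) \sum_(u < i.+3) \sum_(s < q.+3)
    G v r u s * (u + s == 0)%N%:R * (v + r == 2)%N%:R = G 0 2 0 0 + G 1 1 0 0 + G 2 0 0 0.
  rewrite -(sum_weight2 j q (fun v r => G v r 0 0)); apply: eq_bigr => v _; apply: eq_bigr => r _.
  rewrite -(sum_weight0 i q (G v r)) big_distrl/=; apply: eq_bigr => u _.
  by rewrite big_distrl.
have -> : e i j q = G 0 0 0 0.
  by rewrite /G /step_coefficient !bin0 !subn0 !addn0 expr0 !mul1r.
rewrite /generator -/(G _ _ _ _) -S00 -S20 -S02 mulrDr !big_distrr/= -!big_split/=.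
apply: eq_bigr => v _; rewrite !big_distrr/= -!big_split/=.
apply: eq_bigr => r _; rewrite !big_distrr/= -!big_split/=.
apply: eq_bigr => u _; rewrite !big_distrr/= -!big_split/=.
apply: eq_bigr => s _; rewrite -/(G _ _ _ _) /noise_error -!mulnb !natrM.
ring.
Qed.

End one_step.

(** * The homogeneous solution and convergence of the discrete moments *)

Section limit_moments.
Context {R : realType}.
Variable K : nat -> R.
Hypothesis K0 : forall w, 0 <= K w.

Fixpoint gaussian_moment (n : nat) : R :=
  match n with 0 => 1 | 1 => 0 | (n'.+1 as n1).+1 => n1%:R * gaussian_moment n' end.

Lemma gaussian_momentSS n : gaussian_moment n.+2 = n.+1%:R * gaussian_moment n.
Proof. by []. Qed.

Lemma gaussian_moment_odd n : odd n -> gaussian_moment n = 0.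
Proof.
have [m] := ubnP n; elim: m n => // m IH [|[|n]]//= nm; rewrite negbK => on.
by rewrite IH ?mulr0// ltnW.
Qed.

Lemma gaussian_moment_even n : gaussian_moment (2 * n) = ((2 * n)`!)%:R / (2 ^+ n * (n`!)%:R).
Proof.
elim: n => [|n IH]; first by rewrite muln0 fact0 expr0 mul1r divff.
rewrite mulnS !addSn add0n gaussian_momentSS IH !factS exprS !natrM.
have -> : ((2 * n).+2)%:R = 2 * n.+1%:R :> R by rewrite -natrM mulnS.
have n0 : n.+1%:R != 0 :> R by rewrite pnatr_eq0.
have f0 : (n`!)%:R != 0 :> R by rewrite pnatr_eq0 -lt0n fact_gt0.
have p0 : 2 ^+ n != 0 :> R by rewrite expf_neq0 ?pnatr_eq0.
move: (n.+1%:R) (n`!%:R) (2 ^+ n) ((2 * n)`!%:R) ((2 * n).+1%:R) n0 f0 p0 => x y z u v x0 y0 z0.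
by field; rewrite x0 y0 z0.
Qed.

Variable alpha : nat -> nat -> R.
Hypothesis alpha0 : alpha 0 0 = 1.
Hypothesis alpha_rec0 : forall n, n.+1%:R * alpha n.+1 0 = n.+1%:R * alpha n 0.
Hypothesis alpha_recS : forall n k, (n%:R + (2 * k.+1)%:R) * alpha n k.+1 =
  n%:R * alpha n.-1 k.+1 + n.+1%:R * alpha n.+1 k.

(** Odd powers get 0, since exchanging the two processes reverses the sign of the area. In the end
    [alpha] is [signed_taylor]. *)
Definition area_factor (n q : nat) : R :=
  if odd q then 0 else (q`!)%:R * alpha n q./2.

Lemma area_factor_rec n q : (n%:R + q%:R) * area_factor n q =
  n%:R * area_factor n.-1 q + (q * q.-1)%:R * n.+1%:R * area_factor n.+1 (q - 2).
Proof.
rewrite /area_factor; case: q => [|[|q]].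
- rewrite /= fact0 !mul1r mul0n !mul0r !addr0.
  by case: n => [|n]; rewrite ?mul0r//= alpha_rec0.
- by rewrite /= !mulr0 muln0 !mul0r addr0.
rewrite subn2 /= negbK; case: ifP => oq; first by rewrite !mulr0 addr0.
have q2 : q.+2 = (2 * (q./2).+1)%N.
  by rewrite mulnS -[in LHS](odd_double_half q) oq add0n -mul2n.
rewrite {1}q2 mulrCA alpha_recS factS factS !natrM; ring.
Qed.

(** By rotation invariance the increments have a uniform angle independent of their length and of
    the area; for i + j fixed, the angular means of cos^i sin^j are proportional to products of
    Gaussian moments. The rounding in the half is harmless: an odd sum makes one Gaussian moment
    0. *)
Definition limit_moment (i j q : nat) : R :=
  gaussian_moment i * gaussian_moment j * area_factor (i + j)./2 q.

Lemma generatorE (e : nat -> nat -> nat -> R) i j q : generator e i j q =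
  'C(i, 2)%:R * e (i - 2)%N j q + 'C(j, 2)%:R * e i (j - 2)%N q +
  'C(q, 2)%:R * (e i j.+2 (q - 2)%N + e i.+2 j (q - 2)%N) +
  (j * q)%:R * e i.+1 (j - 1)%N (q - 1)%N - (i * q)%:R * e (i - 1)%N j.+1 (q - 1)%N.
Proof.
rewrite /generator /step_coefficient !bin0 !bin1 !subn0 !addn0 !addn1 !addn2 !natrM.
by ring.
Qed.

Lemma mul2_bin2 n : 2 * 'C(n, 2)%:R = (n * n.-1)%:R :> R.
Proof. by rewrite -natrM mulnC -[2%N]/(2`!) bin_ffact !ffactnS ffactn0 muln1. Qed.

(** Equivalently, these numbers times t^((i + j) / 2 + q) solve the moment equations of the
    generator in the time t, as Brownian scaling suggests. *)
Lemma limit_moment_generator i j q :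
  generator limit_moment i j q = ((i + j)./2 + q)%:R * limit_moment i j q.
Proof.
have two0 : 2 != 0 :> R by rewrite pnatr_eq0.
apply: (mulfI two0); rewrite generatorE.
pose n := (i + j)./2; pose g := gaussian_moment.
have lower k l : 2 * ('C(k, 2)%:R * (g (k - 2)%N * g l * area_factor ((k - 2) + l)./2 q)) =
    k%:R * (g k * g l * area_factor (k + l)./2.-1 q).
  rewrite mulrA mul2_bin2; case: k => [|[|k]]; rewrite ?mul0r ?muln0 ?mul0r ?mul1r//=.
  by rewrite subn2/= ?addSn natrM -/(g k); ring.
(* Since g (i + 1) = i g (i - 1), the contributions of x dy da and y dx da cancel: together they
   form a rotation field. *)
have swap : (j * q)%:R * (g i.+1 * g (j - 1)%N * area_factor (i.+1 + (j - 1))./2 (q - 1)) =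
    (i * q)%:R * (g (i - 1)%N * g j.+1 * area_factor ((i - 1) + j.+1)./2 (q - 1)).
  case: i {n lower} => [|i]; first by rewrite mul0n !mul0r mulr0.
  case: j => [|j]; first by rewrite mul0n mulr0 !mul0r mulr0.
  by rewrite !subn1/= ?addSn ?addnS !natrM -/(g i) -/(g j); ring.
have parity : (i + j)%:R * (g i * g j) = 2 * n%:R * (g i * g j).
  have [oij|eij] := boolP (odd (i + j)).
    rewrite (_ : g i * g j = 0) ?mulr0//; move: oij; rewrite oddD.
    case: (boolP (odd i)) => [oi _|_ /= oj]; first by rewrite /g (gaussian_moment_odd oi) mul0r.
    by rewrite /g (gaussian_moment_odd oj) mulr0.
  by rewrite -natrM mul2n even_halfK.
rewrite /limit_moment -/g -/n swap addrK !mulrDr.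
have e1 := lower i j; rewrite -/n in e1; rewrite e1.
have e2 := lower j i; rewrite (addnC j i) (addnC (j - 2)%N) (mulrC (g (j - 2)%N)) -/n in e2; rewrite e2.
rewrite !addnS !addSn/=.
transitivity ((i + j)%:R * (g i * g j) * (area_factor n.-1 q + (q * q.-1)%:R * area_factor n.+1 (q - 2)) +
    2 * ((q * q.-1)%:R * (g i * g j) * area_factor n.+1 (q - 2))).
  by rewrite -mul2_bin2 natrD -!natr1; ring.
rewrite parity; transitivity (2 * (g i * g j) * ((n%:R + q%:R) * area_factor n q)); last first.
  by rewrite natrD; ring.
by rewrite area_factor_rec -natr1; ring.
Qed.

Lemma exprD_second_order p : exists2 D : R, 0 <= D & forall x y : R,
  0 <= x -> x <= 1 -> 0 <= y -> y <= 1 ->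
  `|(x + y) ^+ p - x ^+ p - p%:R * y * x ^+ p.-1| <= D * y ^+ 2.
Proof.
elim: p => [|p [D D0 IH]].
  by exists 0 => // x y *; rewrite !expr0 subrr mul0r mul0r subr0 normr0 mul0r.
exists (2 * D + p%:R); first by rewrite addr_ge0// mulr_ge0.
move=> x y x0 x1 y0 y1; have {}IH := IH x y x0 x1 y0 y1.
have -> : (x + y) ^+ p.+1 - x ^+ p.+1 - p.+1%:R * y * x ^+ p.+1.-1 =
   (x + y) * ((x + y) ^+ p - x ^+ p - p%:R * y * x ^+ p.-1) + y ^+ 2 * (p%:R * x ^+ p.-1).
  by case: p {IH} => [|p]; rewrite -?natr1 /= !exprS; ring.
rewrite [leRHS]mulrDl; apply: (le_trans (ler_normD _ _)); apply: lerD.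
  rewrite normrM -[leRHS]mulrA; apply: ler_pM => //.
  by rewrite ger0_norm ?addr_ge0// -[2]/(1 + 1) lerD.
rewrite ger0_norm ?mulr_ge0 ?exprn_ge0// mulrC ler_wpM2r ?exprn_ge0//.
by rewrite ler_piMr// exprn_ile1.
Qed.

Lemma step_coefficient_eq0 i j q v r u s :
  ~~ [&& v <= j, r <= q, u <= i & s <= q - r]%N -> step_coefficient i j q v r u s = 0 :> R.
Proof.
by rewrite /step_coefficient !negb_and -!ltnNge => /or4P[] /bin_small ->; rewrite ?mulr0n !(mul0r, mulr0).
Qed.

(** Only the moment array of the chain is retained, so that the asymptotics is a statement about
    recursions alone. *)
Definition discrete_moments (N : nat) (e : nat -> nat -> nat -> nat -> R) : Prop :=
  (forall i j q, e 0 i j q = (i + j + q == 0)%N%:R) /\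
  forall m, (m < N)%N -> exists M1 M2,
    [/\ noise K N%:R^-1 M1, noise K N%:R^-1 M2 & transition (e m) (e m.+1) M1 M2].

(** [index1] to [index6] treat the six terms of [generatorE]: where its coefficient is non-zero, a
    term lowers the degree i + j + 2 q and lowers the time exponent (i + j) / 2 + q by exactly
    one. *)
Let index1 n i j q : (i + j + 2 * q <= n)%N -> (1 < i)%N ->
  (i - 2 + j + 2 * q < n)%N /\ ((i - 2 + j)./2 + q = ((i + j)./2 + q).-1)%N.
Proof. clear; lia. Qed.

Let index2 n i j q : (i + j + 2 * q <= n)%N -> (1 < j)%N ->
  (i + (j - 2) + 2 * q < n)%N /\ ((i + (j - 2))./2 + q = ((i + j)./2 + q).-1)%N.
Proof. clear; lia. Qed.

Let index3 n i j q : (i + j + 2 * q <= n)%N -> (1 < q)%N ->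
  (i + j.+2 + 2 * (q - 2) < n)%N /\ ((i + j.+2)./2 + (q - 2) = ((i + j)./2 + q).-1)%N.
Proof. clear; lia. Qed.

Let index4 n i j q : (i + j + 2 * q <= n)%N -> (1 < q)%N ->
  (i.+2 + j + 2 * (q - 2) < n)%N /\ ((i.+2 + j)./2 + (q - 2) = ((i + j)./2 + q).-1)%N.
Proof. clear; lia. Qed.

Let index5 n i j q : (i + j + 2 * q <= n)%N -> (0 < j)%N && (0 < q)%N ->
  (i.+1 + (j - 1) + 2 * (q - 1) < n)%N /\ ((i.+1 + (j - 1))./2 + (q - 1) = ((i + j)./2 + q).-1)%N.
Proof. clear; lia. Qed.

Let index6 n i j q : (i + j + 2 * q <= n)%N -> (0 < i)%N && (0 < q)%N ->
  (i - 1 + j.+1 + 2 * (q - 1) < n)%N /\ ((i - 1 + j.+1)./2 + (q - 1) = ((i + j)./2 + q).-1)%N.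
Proof. clear; lia. Qed.

(** With h = 1 / N, one step changes the error by O(h^2): by induction the generator is off by O(h),
    noise of order four or more costs h^2, and so does the second-order part of the power of m / N.
    At most N steps add up to O(1 / N), with a constant independent of N. *)
Lemma discrete_moments_asymptotics i j q : exists2 C : R, 0 <= C &
  forall N e, (0 < N)%N -> discrete_moments N e -> forall m, (m <= N)%N ->
  `|e m i j q - limit_moment i j q * (m%:R / N%:R) ^+ ((i + j)./2 + q)| <= C / N%:R.
Proof.
have [n] := ubnP (i + j + 2 * q)%N; elim: n => // n IH in i j q *; rewrite ltnS => deg_n.
pose deg (t : nat * nat * nat) := (t.1.1 + t.1.2 + 2 * t.2)%N.
(* One constant per triple of exponents, so that they can be summed below; from degree n on only
   non-negativity is asked. *)
have /choice[B HB] : forall t, exists C : R, 0 <= C /\ ((deg t < n)%N ->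
   forall N e, (0 < N)%N -> discrete_moments N e -> forall m, (m <= N)%N ->
  `|e m t.1.1 t.1.2 t.2 - limit_moment t.1.1 t.1.2 t.2 * (m%:R / N%:R) ^+ ((t.1.1 + t.1.2)./2 + t.2)| <= C / N%:R).
  move=> [[i' j'] q']; rewrite /deg/=.
  have [lt|_] := boolP (i' + j' + 2 * q' < n)%N; last by exists 0.
  by have [C C0 HC] := IH i' j' q' lt; exists C.
have [D D0 HD] := exprD_second_order ((i + j)./2 + q).
(* Bounds the lower moments themselves at all times m <= N, because both (m / N)^p and 1 / N are at
   most 1. *)
pose Bd t := `|limit_moment t.1.1 t.1.2 t.2| + B t.
pose Lb := 'C(i, 2)%:R * B (i - 2, j, q)%N + 'C(j, 2)%:R * B (i, j - 2, q)%N +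
  'C(q, 2)%:R * (B (i, j.+2, q - 2)%N + B (i.+2, j, q - 2)%N) +
  (j * q)%:R * B (i.+1, j - 1, q - 1)%N + (i * q)%:R * B (i - 1, j.+1, q - 1)%N.
pose Rb := \sum_(v < j.+3) \sum_(r < q.+3) \sum_(u < i.+3) \sum_(s < q.+3)
  `|step_coefficient i j q v r u s| * Bd (i - u + r, j - v + s, q - r - s)%N *
  ((1 + K (u + s)) * (1 + K (v + r))).
pose c := limit_moment i j q.
have B0 t : 0 <= B t by case: (HB t).
have Bd0 t : 0 <= Bd t by rewrite addr_ge0.
have Lb0 : 0 <= Lb by do ?[apply: addr_ge0|apply: mulr_ge0] => //.
have Rb0 : 0 <= Rb.
  do 4 (apply: sumr_ge0 => ? _); do ?[apply: addr_ge0|apply: mulr_ge0] => //; exact: Bd0.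
exists (Lb + Rb + `|c| * D); first by apply: addr_ge0; [exact: addr_ge0|exact: mulr_ge0].
move=> N e N0 He m; pose h : R := N%:R^-1.
have N0' : 0 < N%:R :> R by rewrite ltr0n.
have h0 : 0 <= h by rewrite invr_ge0.
have h1 : h <= 1 by rewrite invf_le1// ler1n.
have tau0 k : 0 <= k%:R / N%:R :> R by rewrite divr_ge0.
have tau1 k : (k <= N)%N -> k%:R / N%:R <= 1 :> R by rewrite ler_pdivrMr// mul1r ler_nat.
have [e0 estep] := He.
have lower k t : (k <= N)%N -> (deg t < n)%N -> `|e k t.1.1 t.1.2 t.2| <= Bd t.
  move=> kN tn; have [_ /(_ tn N e N0 He k kN) HBt] := HB t.
  set X := limit_moment _ _ _ * _ in HBt; set x := e k _ _ _ in HBt *.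
  have tri : `|x| <= `|x - X| + `|X| by rewrite -{1}(subrK X x) ler_normD.
  apply: (le_trans tri); rewrite /Bd [leRHS]addrC; apply: lerD.
    by apply: (le_trans HBt); rewrite ler_piMr.
  by rewrite /X normrM ler_piMr// ger0_norm ?exprn_ge0// exprn_ile1// tau1.
pose p := ((i + j)./2 + q)%N.
pose w k := e k i j q - c * (k%:R / N%:R) ^+ p.
have w_step k : (k < N)%N -> `|w k.+1 - w k| <= (Lb + Rb + `|c| * D) * h ^+ 2.
  move=> kN; have [M1 [M2 [n1 n2 tr]]] := estep k kN.
  pose tau : R := k%:R / N%:R.
  have tauS : k.+1%:R / N%:R = tau + h by rewrite /tau /h -natr1 mulrDl mul1r.
  have close (x : nat) t : ((0 < x)%N -> (deg t < n)%N /\ ((t.1.1 + t.1.2)./2 + t.2 = p.-1)%N) ->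
     `|x%:R * e k t.1.1 t.1.2 t.2 - x%:R * (limit_moment t.1.1 t.1.2 t.2 * tau ^+ p.-1)| <=
     x%:R * B t * h.
    case: x => [_|x /(_ isT) [tn <-]]; first by rewrite !mul0r subrr normr0.
    have [_ /(_ tn N e N0 He k (ltnW kN)) HBt] := HB t.
    by rewrite -mulrBr normrM ger0_norm// -mulrA ler_wpM2l.
  have gen_close : `|generator (e k) i j q - p%:R * c * tau ^+ p.-1| <= Lb * h.
    have p_half : p = ((i + j)./2 + q)%N by [].
    have := close 'C(i, 2) (i - 2, j, q)%N; have := close 'C(j, 2) (i, j - 2, q)%N.
    have := close 'C(q, 2) (i, j.+2, q - 2)%N; have := close 'C(q, 2) (i.+2, j, q - 2)%N.
    have := close (j * q)%N (i.+1, j - 1, q - 1)%N; have := close (i * q)%N (i - 1, j.+1, q - 1)%N.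
    rewrite /deg /= !bin_gt0 !muln_gt0.
    move=> /(_ (index6 deg_n)) l6 /(_ (index5 deg_n)) l5.
    move=> /(_ (index4 deg_n)) l4 /(_ (index3 deg_n)) l3.
    move=> /(_ (index2 deg_n)) l2 /(_ (index1 deg_n)) l1.
    have -> : p%:R * c * tau ^+ p.-1 = generator limit_moment i j q * tau ^+ p.-1.
      by rewrite limit_moment_generator.
    rewrite !generatorE.
    set a1 := e k (i - 2)%N _ _; set a2 := e k i (j - 2)%N _; set a3 := e k i j.+2 _.
    set a4 := e k i.+2 _ _; set a5 := e k i.+1 _ _; set a6 := e k (i - 1)%N _ _.
    set b1 := limit_moment (i - 2)%N _ _; set b2 := limit_moment i (j - 2)%N _; set b3 := limit_moment i j.+2 _.
    set b4 := limit_moment i.+2 _ _; set b5 := limit_moment i.+1 _ _; set b6 := limit_moment (i - 1)%N _ _.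
    set x := tau ^+ p.-1.
    have -> : 'C(i, 2)%:R * a1 + 'C(j, 2)%:R * a2 + 'C(q, 2)%:R * (a3 + a4) +
        (j * q)%:R * a5 - (i * q)%:R * a6 - ('C(i, 2)%:R * b1 + 'C(j, 2)%:R * b2 +
         'C(q, 2)%:R * (b3 + b4) + (j * q)%:R * b5 - (i * q)%:R * b6) * x =
      ('C(i, 2)%:R * a1 - 'C(i, 2)%:R * (b1 * x)) + ('C(j, 2)%:R * a2 - 'C(j, 2)%:R * (b2 * x)) +
      (('C(q, 2)%:R * a3 - 'C(q, 2)%:R * (b3 * x)) + ('C(q, 2)%:R * a4 - 'C(q, 2)%:R * (b4 * x))) +
      ((j * q)%:R * a5 - (j * q)%:R * (b5 * x)) - ((i * q)%:R * a6 - (i * q)%:R * (b6 * x)) by ring.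
    rewrite /Lb !mulrDl mulrDr mulrDl.
    apply: (le_trans (ler_normB _ _)); apply: lerD => //.
    by do 4 (apply: (le_trans (ler_normD _ _)); apply: lerD => //).
  have rem_small : `|\sum_(v < j.+3) \sum_(r < q.+3) \sum_(u < i.+3) \sum_(s < q.+3)
    step_coefficient i j q v r u s * e k (i - u + r)%N (j - v + s)%N (q - r - s)%N *
    noise_error h M1 M2 (u + s) (v + r)| <= Rb * h ^+ 2.
    rewrite big_distrl; apply: (le_trans (ler_norm_sum _ _ _)); apply: ler_sum => v _.
    rewrite big_distrl; apply: (le_trans (ler_norm_sum _ _ _)); apply: ler_sum => r _.
    rewrite big_distrl; apply: (le_trans (ler_norm_sum _ _ _)); apply: ler_sum => u _.
    rewrite big_distrl; apply: (le_trans (ler_norm_sum _ _ _)); apply: ler_sum => s _ /=.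
    have [range|/step_coefficient_eq0 ->] := boolP [&& v <= j, r <= q, u <= i & s <= q - r]%N; last first.
      by rewrite !mul0r normr0 !mul0r.
    have := noise_error_le K0 h0 h1 (u + s) (v + r) n1 n2.
    (* A surviving term carries at least four noise factors, so its degree has dropped by at least 4
       and the induction bounds its moment. *)
    have [d4|d4] := leqP 4 (u + s + (v + r)); last first.
      rewrite mul0r normr_le0 => /eqP ->; rewrite mulr0 normr0.
      by rewrite !mulr_ge0// ?exprn_ge0 ?addr_ge0.
    rewrite mul1r => err; rewrite normrM -[leRHS]mulrA; apply: ler_pM => //.
    rewrite normrM ler_wpM2l//; apply: (lower k (i - u + r, j - v + s, q - r - s)%N (ltnW kN)).
    rewrite /deg/=; move: range d4 deg_n => /and4P[]; clear; lia.
  have -> : w k.+1 - w k = h * (generator (e k) i j q - p%:R * c * tau ^+ p.-1) +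
    (e k.+1 i j q - e k i j q - h * generator (e k) i j q) -
     c * ((tau + h) ^+ p - tau ^+ p - p%:R * h * tau ^+ p.-1).
    by rewrite /w tauS -/tau; ring.
  rewrite (_ : e k.+1 i j q - _ - _ = \sum_(v < j.+3) \sum_(r < q.+3) \sum_(u < i.+3) \sum_(s < q.+3)
    step_coefficient i j q v r u s * e k (i - u + r)%N (j - v + s)%N (q - r - s)%N *
    noise_error h M1 M2 (u + s) (v + r)); last first.
    by rewrite (transition_error i j q tr n1 n2) -addrA -opprD addrC addKr.
  rewrite (mulrDl (Lb + Rb)) (mulrDl Lb); apply: (le_trans (ler_normB _ _)); apply: lerD; last first.
    rewrite normrM -[leRHS]mulrA ler_wpM2l//; by apply: HD => //; [exact: tau0|exact: (tau1 k (ltnW kN))].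
  apply: (le_trans (ler_normD _ _)); apply: lerD => //.
  rewrite normrM (ger0_norm h0) [leRHS](_ : _ = h * (Lb * h)); [by rewrite ler_wpM2l|by ring].
have w0 : w 0 = 0.
  rewrite /w e0 mul0r expr0n.
  have [ijq|ijq] := eqVneq (i + j + q)%N 0%N.
    have [i0 j0 q0] : [/\ i = 0, j = 0 & q = 0]%N by split; move: ijq; clear; lia.
    by rewrite /p /c /limit_moment i0 j0 q0 /= /area_factor /= alpha0 fact0 !mulr1 subrr.
  (* 0 ^+ p is 1 for p = 0, which among the non-constant monomials concerns only x and y; their
     limit moments are 0. *)
  have [p0|] := eqVneq p 0%N; last by rewrite mulr0 subrr.
  rewrite sub0r mulr1 /c /limit_moment.
  have [[-> ->]|[-> ->]] : (i = 1 /\ j = 0 \/ i = 0 /\ j = 1)%N by move: p0 ijq; rewrite /p; clear; lia.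
  - by rewrite /= !mul0r oppr0.
  - by rewrite /= mulr0 mul0r oppr0.
have w_le k : (k <= N)%N -> `|w k| <= k%:R * ((Lb + Rb + `|c| * D) * h ^+ 2).
  elim: k => [_|k IHk kN]; first by rewrite w0 normr0 mul0r.
  rewrite -(subrK (w k) (w k.+1)) -natr1 mulrDl mul1r addrC.
  by apply: (le_trans (ler_normD _ _)); apply: lerD; [exact: IHk (ltnW kN)|exact: w_step].
move=> mN; apply: (le_trans (w_le m mN)); rewrite mulrCA; apply: ler_wpM2l.
  by apply: addr_ge0; [exact: addr_ge0|exact: mulr_ge0].
by rewrite expr2 mulrA ler_piMl// tau1.
Qed.

End limit_moments.

(** * Moments of the Riemann sums *)

Section riemann_sum_moments.
Context {d : measure_display} {T : measurableType d} {R : realType}.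
Variable P : probability T R.
Local Notation intble := (intble P).
Local Notation E := (E P).
Variables W1 W2 : R -> {RV P >-> R}.
Hypotheses (hW1 : is_wiener W1) (hW2 : is_wiener W2) (hW12 : independent_processes W1 W2).
Variables (t : R) (N : nat).
Hypotheses (t0 : 0 <= t) (N0 : (0 < N)%N).
Local Notation g := (grid t N).

(** The increment of W2 is split off first, from the past of W1 up to r and of W2 up to s; the
    increment of W1 is then split off from the common past at s. *)
Lemma two_increment_indep_mul (s r : R) (U : T -> R) p q : 0 <= s -> s <= r ->
  adapted (joint_past W1 W2 s s) U -> all_moments P U ->
  E (fun w => U w * ((W1 r w - W1 s w) ^+ p * (W2 r w - W2 s w) ^+ q)) =
  E U * (E (fun w => (W1 r w - W1 s w) ^+ p) * E (fun w => (W2 r w - W2 s w) ^+ q)).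
Proof.
move=> s0 sr sU mU.
have m1 := all_momentsX p (increment_all_moments hW1 s0 sr).
have m2 := all_momentsX q (increment_all_moments hW2 s0 sr).
have r0 : 0 <= r := le_trans s0 sr.
have hW21 : independent_processes W2 W1 by move=> A B WA VB; rewrite setIC muleC; exact: hW12.
have i1 : indep_from P (joint_past W1 W2 s s) (fun w => (W1 r w - W1 s w) ^+ p).
  apply: (@indep_from_comp _ _ _ _ _ (fun w => W1 r w - W1 s w) (fun x => x ^+ p)).
    exact: exprn_measurable.
  by rewrite joint_pastC; exact: joint_past_indep_increment.
have i2 : indep_from P (joint_past W1 W2 r s) (fun w => (W2 r w - W2 s w) ^+ q).
  apply: (@indep_from_comp _ _ _ _ _ (fun w => W2 r w - W2 s w) (fun x => x ^+ q)).
    exact: exprn_measurable.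
  exact: joint_past_indep_increment.
have sU1 : adapted (joint_past W1 W2 r s) (fun w => U w * (W1 r w - W1 s w) ^+ p).
  apply: adaptedM; first by apply: adapted_sub sU; exact: joint_past_le.
  by apply: adaptedX; apply: adaptedB; apply: adapted_joint_past_l; rewrite ?r0 ?s0 /=.
under eq_fun do rewrite mulrA.
have mU1 := all_momentsM mU m1.
rewrite (E_mul_indep mU1.1 m2.1 (indep_from_product_rule sU1 i2)); [|exact: all_moments_intble..].
rewrite (E_mul_indep mU.1 m1.1 (indep_from_product_rule sU i1)); [|exact: all_moments_intble..].
by rewrite mulrA.
Qed.

Definition position (W : R -> {RV P >-> R}) m (w : T) : R := W (g m) w - W t w.

Definition area_sum m (w : T) : R :=
  \sum_(l < m) (position W1 l w * (W2 (g l.+1) w - W2 (g l) w)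
                - position W2 l w * (W1 (g l.+1) w - W1 (g l) w)).

Definition riemann_moment m i j q : R :=
  E (fun w => position W1 m w ^+ i * area_sum m w ^+ q * position W2 m w ^+ j).

Let g0 m : 0 <= g m. Proof. exact: grid_ge0. Qed.
Let gt m : t <= g m. Proof. exact: grid_ge. Qed.
Let gS m : g m <= g m.+1. Proof. exact: grid_le. Qed.

Lemma all_moments_position (W : R -> {RV P >-> R}) m : is_wiener W -> all_moments P (position W m).
Proof. by move=> hW; exact: increment_all_moments. Qed.

Lemma all_moments_area_sum m : all_moments P (area_sum m).
Proof.
apply: all_moments_sum => l; apply: all_momentsB; apply: all_momentsM.
- exact: all_moments_position.
- exact: increment_all_moments.
- exact: all_moments_position.
- exact: increment_all_moments.
Qed.

Let past_m m := joint_past W1 W2 (g m) (g m).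

Lemma adapted_position1 l m : (l <= m)%N -> adapted (past_m m) (position W1 l).
Proof.
move=> lm; apply: adaptedB; apply: adapted_joint_past_l; rewrite ?g0 ?t0 ?gt//=.
exact: grid_le.
Qed.

Lemma adapted_position2 l m : (l <= m)%N -> adapted (past_m m) (position W2 l).
Proof.
move=> lm; apply: adaptedB; apply: adapted_joint_past_r; rewrite ?g0 ?t0 ?gt//=.
exact: grid_le.
Qed.

Lemma adapted_area_sum m : adapted (past_m m) (area_sum m).
Proof.
apply: adapted_sum => l; have lm := ltn_ord l; apply: adaptedB; apply: adaptedM.
- exact: adapted_position1 (ltnW lm).
- by apply: adaptedB; apply: adapted_joint_past_r; rewrite g0 grid_le// ltnW.
- exact: adapted_position2 (ltnW lm).
- by apply: adaptedB; apply: adapted_joint_past_l; rewrite g0 grid_le// ltnW.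
Qed.

Definition noise_bound (w : nat) : R := 2 * expR (2^-1) * w`!%:R.

Lemma increment_noise (W : R -> {RV P >-> R}) m : is_wiener W ->
  noise noise_bound N%:R^-1 (fun p => E (fun w => (W (g m.+1) w - W (g m) w) ^+ p)).
Proof.
move=> hW; have [m1 m2 m3] := increment_moments hW (g0 m) (gS m).
split; rewrite ?m2 ?gridS//.
- by under eq_fun do rewrite expr0; rewrite E_cst.
- move=> p p4; apply: (le_trans (increment_abs_moment hW p (g0 m) (gS m))).
  rewrite gridS// /noise_bound ler_wpM2l ?mulr_ge0 ?expR_ge0//.
  have h0 : 0 <= N%:R^-1 :> R by rewrite invr_ge0.
  have h1 : N%:R^-1 <= 1 :> R by rewrite invf_le1 ?ltr0n// ler1n.
  (* h^2 is (sqrt h)^4, and sqrt h <= 1 allows the exponent to drop from p to 4. *)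
  rewrite -[in leRHS](sqr_sqrtr h0) -exprM.
  by rewrite ler_wiXn2l ?sqrtr_ge0// -[leRHS](sqrtr1 R) ler_wsqrtr.
Qed.

Lemma riemann_discrete_moments : discrete_moments noise_bound N riemann_moment.
Proof.
split=> [i j q|m mN].
  rewrite /riemann_moment (_ : (fun w => _) = fun=> (i + j + q == 0)%N%:R) ?E_cst//.
  apply/funext => w; rewrite /area_sum big_ord0 /position !grid0 !subrr !expr0n -!natrM !mulnb.
  by rewrite !addn_eq0 -!andbA (andbC (q == 0%N)).
exists (fun p => E (fun w => (W1 (g m.+1) w - W1 (g m) w) ^+ p)).
exists (fun p => E (fun w => (W2 (g m.+1) w - W2 (g m) w) ^+ p)).
split; [exact: increment_noise|exact: increment_noise|].
move=> i j q; rewrite /riemann_moment.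
pose U i j q w := position W1 m w ^+ i * area_sum m w ^+ q * position W2 m w ^+ j.
have mU i' j' q' : all_moments P (U i' j' q').
  apply: all_momentsM; first apply: all_momentsM; apply: all_momentsX.
  - exact: all_moments_position.
  - exact: all_moments_area_sum.
  - exact: all_moments_position.
have aU i' j' q' : adapted (past_m m) (U i' j' q').
  apply: adaptedM; first apply: adaptedM; apply: adaptedX.
  - exact: adapted_position1.
  - exact: adapted_area_sum.
  - exact: adapted_position2.
pose dW (W : R -> {RV P >-> R}) w := W (g m.+1) w - W (g m) w.
have mdW W : is_wiener W -> all_moments P (dW W) by move=> hW; exact: increment_all_moments.
transitivity (E (fun w => \sum_(v < j.+3) \sum_(r < q.+3) \sum_(u < i.+3) \sum_(s < q.+3)
    step_coefficient i j q v r u s *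
    (U (i - u + r)%N (j - v + s)%N (q - r - s)%N w * (dW W1 w ^+ (u + s) * dW W2 w ^+ (v + r))))).
  congr E; apply/funext => w.
  have -> : position W1 m.+1 w = position W1 m w + dW W1 w by rewrite /position /dW; ring.
  have -> : position W2 m.+1 w = position W2 m w + dW W2 w by rewrite /position /dW; ring.
  have -> : area_sum m.+1 w = area_sum m w + (position W1 m w * dW W2 w - position W2 m w * dW W1 w).
    by rewrite /area_sum big_ord_recr.
  rewrite step_expansion; do 4 (apply: eq_bigr => ? _).
  by rewrite [RHS]mulrA.
have it v r u s : intble (fun w => step_coefficient i j q v r u s *
    (U (i - u + r)%N (j - v + s)%N (q - r - s)%N w * (dW W1 w ^+ (u + s) * dW W2 w ^+ (v + r)))).
  apply/intbleZ/all_moments_intble/all_momentsM => //.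
  by apply: all_momentsM; apply: all_momentsX; exact: mdW.
rewrite E_sum => [|v _]; last by do 3 (apply: intble_sum => ? _).
apply: eq_bigr => v _.
rewrite E_sum => [|r _]; last by do 2 (apply: intble_sum => ? _).
apply: eq_bigr => r _.
rewrite E_sum => [|u _]; last by do 1 (apply: intble_sum => ? _).
apply: eq_bigr => u _.
rewrite E_sum => [|s _]; last exact: it.
apply: eq_bigr => s _.
rewrite EZ; last first.
  by apply/all_moments_intble/all_momentsM => //; apply: all_momentsM; apply: all_momentsX; exact: mdW.
by rewrite (two_increment_indep_mul _ _ (g0 m) (gS m) (aU _ _ _) (mU _ _ _)) mulrA.
Qed.

End riemann_sum_moments.

(** * Moments of a mean-square limit *)

Lemma le_of_le_add_inv {R : realType} (x y c : R) :
  (forall N, (0 < N)%N -> x <= y + c / N%:R) -> x <= y.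
Proof.
move=> H; apply/ler_addgt0Pr => e e0.
have c0 : 0 <= `|c| / e by rewrite divr_ge0// ltW.
have /andP[_ lt_c] := truncn_itv c0; set N := (Num.truncn _).+1 in lt_c.
apply: (le_trans (H N isT)); rewrite lerD2l.
have N0 : 0 < N%:R :> R by rewrite ltr0n.
rewrite ler_pdivrMr//; apply: (le_trans (ler_norm c)).
by rewrite mulrC -ler_pdivrMr// ltW.
Qed.

Section mean_square_limit.
Context {d : measure_display} {T : measurableType d} {R : realType}.
Variable P : probability T R.
Local Notation intble := (intble P).
Local Notation E := (E P).
Variables (A : T -> R) (Z : nat -> T -> R) (K : R).
Hypothesis A2 : sqint P A.
Hypothesis Zm : forall N, (0 < N)%N -> all_moments P (Z N).
Hypothesis AZ : forall N, (0 < N)%N -> E (fun w => (A w - Z N w) ^+ 2) <= K / N%:R.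
Hypothesis Z_bounded : forall p, exists B, forall N, (0 < N)%N -> E (fun w => Z N w ^+ (2 * p)) <= B.

Let mA : measurable_fun setT A. Proof. by case: A2. Qed.

(** Cutting at level M makes the power bounded, so its expectation is finite before anything is
    known about higher moments of A. *)
Let trunc p (M : R) (w : T) : R := A w ^+ (2 * p) * \1_[set w | `|A w| <= M] w.

Let even_ge0 (x : R) p : 0 <= x ^+ (2 * p). Proof. by rewrite exprM exprn_ge0// sqr_ge0. Qed.

Let mtrunc p M : measurable_fun setT (trunc p M).
Proof.
apply: measurable_funM; first exact: measurable_funX.
apply: measurable_indic.
rewrite [X in measurable X](_ : _ = (fun w => `|A w|) @^-1` `]-oo, M]%classic); last first.
  by apply/seteqP; split=> w /=; rewrite in_itv.
rewrite -[X in measurable X]setTI; apply: measurableT_comp => //.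
Qed.

Let trunc_ge0 p M w : 0 <= trunc p M w.
Proof. by rewrite mulr_ge0. Qed.

Let trunc_le p M w : 0 <= M -> trunc p M w <= M ^+ (2 * p).
Proof.
move=> M0; rewrite /trunc indicE; case: (boolP (w \in _)) => [|_]; last by rewrite mulr0.
rewrite inE/= mulr1 => AM; rewrite -[A w ^+ _]ger0_norm// normrX.
by rewrite lerXn2r ?nnegrE.
Qed.

Let intble_trunc p M : 0 <= M -> intble (trunc p M).
Proof.
move=> M0; apply: (@intble_le _ _ _ P _ (fun=> M ^+ (2 * p))) => //; last exact: intble_cst.
by move=> w; rewrite ger0_norm// trunc_le.
Qed.

(* Where |A - Z| <= 1 the power of A is controlled by that of Z, elsewhere 1 <= (A - Z)^2. *)
Let trunc_split p M N w : 0 <= M ->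
  trunc p M w <= 2 ^+ (2 * p) * (Z N w ^+ (2 * p) + 1) + M ^+ (2 * p) * (A w - Z N w) ^+ 2.
Proof.
move=> M0; have MM : 0 <= M ^+ (2 * p) by rewrite exprn_ge0.
have [far|near] := ltP 1 `|A w - Z N w|.
  apply: (le_trans (trunc_le p w M0)); rewrite -[leLHS]add0r lerD//.
    by rewrite mulr_ge0// ?exprn_ge0// addr_ge0.
  rewrite ler_peMr// -real_normK ?num_real// -(expr1n R 2).
  by rewrite lerXn2r ?nnegrE// ltW.
rewrite -[leLHS]addr0 lerD//; last by rewrite mulr_ge0// sqr_ge0.
apply: (@le_trans _ _ (A w ^+ (2 * p))).
  by rewrite ler_piMr// indicE; case: (_ \in _).
rewrite -[A w ^+ _]ger0_norm// normrX.
have -> : Z N w ^+ (2 * p) = `|Z N w| ^+ (2 * p) by rewrite -normrX ger0_norm.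
have := exprDn_le (2 * p) (normr_ge0 (Z N w)) ler01; rewrite expr1n; apply: le_trans.
rewrite lerXn2r ?nnegrE ?addr_ge0//.
by rewrite -[in leLHS](subrK (Z N w) (A w)) addrC (le_trans (ler_normD _ _))// lerD2l.
Qed.

(** For M fixed, the term M^(2 p) E (A - Z N)^2 tends to 0 as N grows, which leaves a bound free of
    M. *)
Let E_trunc_le p : exists B, forall M, 0 <= M -> E (trunc p M) <= B.
Proof.
have [B HB] := Z_bounded p; exists (2 ^+ (2 * p) * (B + 1)) => M M0.
apply: (@le_of_le_add_inv _ _ _ (M ^+ (2 * p) * K)) => N N0.
have iAZ : intble (fun w => (A w - Z N w) ^+ 2).
  by have [_] := sqintB A2 (all_moments_sqint (Zm N0)).
have iZ : intble (fun w => Z N w ^+ (2 * p)) by exact/all_moments_intble/all_momentsX/Zm.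
have i1 := intbleD iZ (intble_cst P 1).
apply: le_trans (le_E (intble_trunc p M0) _ (fun w => trunc_split p N w M0)) _.
  by apply: intbleD; exact: intbleZ.
rewrite ED; [|exact: intbleZ..]; rewrite !EZ// ED//; last exact: intble_cst.
rewrite E_cst -mulrA lerD// ler_wpM2l ?exprn_ge0//; last exact: AZ.
by rewrite lerD2r HB.
Qed.

(** Monotone convergence in the truncation level. *)
Lemma limit_even_power_intble p : intble (fun w => A w ^+ (2 * p)).
Proof.
have [B HB] := E_trunc_le p.
have mAp : measurable_fun setT (fun w => A w ^+ (2 * p)) by exact: measurable_funX.
apply/integrableP; split; first exact/measurable_EFinP.
under eq_integral => w _ do rewrite /= ger0_norm//.
pose f (n : nat) w := (trunc p n%:R w)%:E.
have f_lim w : limn (f ^~ w) = (A w ^+ (2 * p))%:E.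
  apply: (@lim_near_cst (\bar R)) => //; near=> n; rewrite /f /trunc indicE mem_set ?mulr1//=.
  by near: n; exact: nbhs_infty_ger.
have f_nd w : {homo f ^~ w : n m / (n <= m)%N >-> (n <= m)%E}.
  move=> n m nm; rewrite /f lee_fin /trunc ler_wpM2l// !indicE ler_nat.
  case: (boolP (w \in [set w | `|A w| <= n%:R])) => //; rewrite inE/= => An.
  rewrite mem_set//=; apply: (le_trans An); by rewrite ler_nat.
under eq_integral => w _ do rewrite -f_lim.
have mf n : measurable_fun setT (f n) by exact/measurable_EFinP/mtrunc.
rewrite (monotone_convergence P measurableT mf)//; last by move=> n w _; rewrite lee_fin.
apply: (@le_lt_trans _ _ B%:E); last exact: ltry.
apply: lime_le.
  apply: ereal_nondecreasing_is_cvgn => n m nm; apply: ge0_le_integral => //.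
  - by move=> w _; rewrite lee_fin.
  - by move=> w _; exact: f_nd.
by near=> n; rewrite /f E_EFin ?lee_fin ?HB//; exact: intble_trunc.
Unshelve. all: by end_near. Qed.

Lemma limit_all_moments : all_moments P A.
Proof.
split=> // p; apply: (@intble_le _ _ _ P _ (fun w => 1 + A w ^+ (2 * p))).
- by apply/measurable_funX/measurableT_comp.
- move=> w; rewrite normrX normr_id -[A w ^+ _]ger0_norm// normrX mulnC exprM.
  have := sqr_ge0 (1 - `|A w| ^+ p); have : 0 <= `|A w| ^+ p by rewrite exprn_ge0.
  nra.
- by apply: intbleD; [exact: intble_cst|exact: limit_even_power_intble].
Qed.

Let power_difference (a b : R) m :
  `|a ^+ m - b ^+ m| <= `|a - b| * (m%:R * (`|a| + `|b| + 1) ^+ m).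
Proof.
set S := `|a| + `|b| + 1.
have S1 : 1 <= S by rewrite lerDr addr_ge0.
have S0 : 0 <= S := le_trans ler01 S1.
elim: m => [|m IH]; first by rewrite !expr0 subrr normr0 mul0r mulr0.
have -> : a ^+ m.+1 - b ^+ m.+1 = a * (a ^+ m - b ^+ m) + (a - b) * b ^+ m by rewrite !exprS; ring.
apply: (le_trans (ler_normD _ _)); rewrite !normrM.
have aS : `|a| <= S by rewrite /S -addrA lerDl addr_ge0.
have bS : `|b| ^+ m <= S ^+ m by rewrite lerXn2r ?nnegrE// /S -addrA addrCA lerDl addr_ge0.
have -> : `|a - b| * (m.+1%:R * S ^+ m.+1) =
  S * (`|a - b| * (m%:R * S ^+ m)) + `|a - b| * S ^+ m.+1 by rewrite exprS -natr1; ring.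
apply: lerD; first exact: ler_pM.
rewrite ler_wpM2l// normrX (le_trans bS)// exprS ler_peMl// exprn_ge0//.
Qed.

(** Young's inequality u v <= l u^2 + v^2 / l with u = |A - Z N| and v = m |X| (|A| + |Z N| + 1)^m;
    then v^2 is bounded by fourth powers, which have bounded means. The free parameter l avoids
    square roots of expectations. *)
Let dominating m (l : R) (X : T -> R) N w :=
  l * (A w - Z N w) ^+ 2 + l^-1 * (m%:R ^+ 2 * (X w ^+ 4 +
    2 ^+ (4 * m) * (2 ^+ (4 * m) * (A w ^+ (4 * m) + Z N w ^+ (4 * m)) + 1))).

Let dominated m (l : R) (X : T -> R) N w : 0 < l ->
  `|X w * A w ^+ m - X w * Z N w ^+ m| <= dominating m l X N w.
Proof.
move=> l0; rewrite -mulrBr normrM.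
set u := `|A w - Z N w|; set S := `|A w| + `|Z N w| + 1; set v := m%:R * (`|X w| * S ^+ m).
have S0 : 0 <= S by rewrite !addr_ge0.
have even4 (x : R) : x ^+ (4 * m) = `|x| ^+ (4 * m).
  by rewrite (_ : 4 * m = 2 * (2 * m))%N ?mulnA// -normrX -mulnA ger0_norm.
apply: (@le_trans _ _ (u * v)).
  rewrite /v mulrCA [leRHS](_ : _ = `|X w| * (u * (m%:R * S ^+ m))); last by ring.
  by rewrite ler_wpM2l// power_difference.
apply: (@le_trans _ _ (l * u ^+ 2 + l^-1 * v ^+ 2)).
  have -> : v = l * (v / l) by rewrite mulrC divfK// gt_eqF.
  set z := v / l; have -> : l^-1 * (l * z) ^+ 2 = l * z ^+ 2 by field; rewrite gt_eqF.
  rewrite mulrCA -mulrDr ler_pM2l//.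
  by have := sqr_ge0 (u - z); have := sqr_ge0 u; have := sqr_ge0 z; nra.
rewrite /dominating /u real_normK ?num_real// lerD2l ler_wpM2l ?invr_ge0 ?(ltW l0)//.
rewrite /v exprMn ler_wpM2l ?exprn_ge0// exprMn real_normK ?num_real//.
have S4 : S ^+ (4 * m) <= 2 ^+ (4 * m) * (2 ^+ (4 * m) * (A w ^+ (4 * m) + Z N w ^+ (4 * m)) + 1).
  have := exprDn_le (4 * m) (addr_ge0 (normr_ge0 (A w)) (normr_ge0 (Z N w))) ler01.
  rewrite expr1n => /le_trans; apply; rewrite ler_wpM2l ?exprn_ge0// lerD2r.
  by rewrite (even4 (A w)) (even4 (Z N w)) exprDn_le.
apply: le_trans (_ : _ <= X w ^+ 4 + S ^+ (4 * m)) _; last by rewrite lerD2l.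
have -> : X w ^+ 4 = (X w ^+ 2) ^+ 2 by rewrite -exprM.
have -> : S ^+ (4 * m) = ((S ^+ m) ^+ 2) ^+ 2 by rewrite -!exprM; congr (_ ^+ _); lia.
have := sqr_ge0 (X w ^+ 2 - (S ^+ m) ^+ 2).
have := sqr_ge0 (X w ^+ 2); have := sqr_ge0 ((S ^+ m) ^+ 2).
set x := X w ^+ 2; set y := (S ^+ m) ^+ 2; nra.
Qed.

Lemma mixed_moment_limit (X : T -> R) m (c C : R) : all_moments P X ->
  (forall N, (0 < N)%N -> `|E (fun w => X w * Z N w ^+ m) - c| <= C / N%:R) ->
  E (fun w => X w * A w ^+ m) = c.
Proof.
move=> mX HC; have Am := limit_all_moments.
have [B HB] := Z_bounded (2 * m).
pose V := m%:R ^+ 2 * (E (fun w => X w ^+ 4) +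
    2 ^+ (4 * m) * (2 ^+ (4 * m) * (E (fun w => A w ^+ (4 * m)) + B) + 1)).
apply/eqP; rewrite -subr_eq0 -normr_le0.
(* The index is N = l * l with l as the Young parameter: l E (A - Z N)^2 <= K / l, the other half is
   at most V / l, and |C| / N <= |C| / l. *)
apply: (@le_of_le_add_inv _ _ _ (K + V + `|C|)) => l l0; rewrite add0r.
have ll0 : (0 < l * l)%N by rewrite muln_gt0 l0.
have l0' : 0 < l%:R :> R by rewrite ltr0n.
have iXA : intble (fun w => X w * A w ^+ m).
  exact/all_moments_intble/all_momentsM/all_momentsX.
have iXZ : intble (fun w => X w * Z (l * l)%N w ^+ m).
  by apply/all_moments_intble/all_momentsM => //; apply/all_momentsX/Zm.
have i1 : intble (fun w => (A w - Z (l * l)%N w) ^+ 2).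
  by apply/all_moments_intble/all_momentsX/all_momentsB => //; exact: Zm.
have i2 : intble (fun w => X w ^+ 4) by exact/all_moments_intble/all_momentsX.
have i3 : intble (fun w => A w ^+ (4 * m)) by exact/all_moments_intble/all_momentsX.
have i4 : intble (fun w => Z (l * l)%N w ^+ (4 * m)) by apply/all_moments_intble/all_momentsX/Zm.
have i34 := intbleD i3 i4.
have i5 := intbleD (intbleZ (2 ^+ (4 * m)) i34) (intble_cst P 1).
have i6 := intbleZ (2 ^+ (4 * m)) i5.
have i7 := intbleD i2 i6.
have i8 := intbleZ (m%:R ^+ 2) i7.
have idom : intble (dominating m l%:R X (l * l)%N).
  by apply: intbleD; apply: intbleZ.
have Edom : E (dominating m l%:R X (l * l)%N) <= (K + V) / l%:R.
  rewrite /dominating ED; [|exact: intbleZ..].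
  rewrite (EZ _ i1) (EZ _ i8) (EZ _ i7) (ED i2 i6) (EZ _ i5) ED; [|exact: intbleZ|exact: intble_cst].
  rewrite (EZ _ i34) (ED i3 i4) E_cst mulrDl; apply: lerD.
    rewrite -ler_pdivlMl// (le_trans (AZ ll0))// natrM invfM.
    by rewrite le_eqVlt; apply/orP; left; apply/eqP; ring.
  rewrite [leLHS]mulrC; apply: ler_wpM2r; first by rewrite invr_ge0 ltW.
  rewrite /V; apply: ler_wpM2l; first exact: exprn_ge0.
  rewrite lerD2l; apply: ler_wpM2l; first exact: exprn_ge0.
  rewrite lerD2r; apply: ler_wpM2l; first exact: exprn_ge0.
  rewrite lerD2l.
  by have := HB _ ll0; rewrite mulnA.
have EXA : `|E (fun w => X w * A w ^+ m) - E (fun w => X w * Z (l * l)%N w ^+ m)| <= (K + V) / l%:R.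
  rewrite -EB//; apply: le_trans Edom; apply: le_normE => //.
    by have := intble_measurable (intbleB iXA iXZ).
  by move=> w; exact: dominated.
rewrite -(subrK (E (fun w => X w * Z (l * l)%N w ^+ m)) (E _)) -addrA.
apply: (le_trans (ler_normD _ _)); rewrite mulrDl; apply: lerD => //.
apply: (le_trans (HC _ ll0)); apply: (@le_trans _ _ (`|C| / (l * l)%:R)).
  by rewrite ler_wpM2r ?invr_ge0// ler_norm.
rewrite ler_wpM2l// lef_pV2 ?posrE ?ltr0n// ler_nat leq_pmulr//.
Qed.

End mean_square_limit.

(** * Moments of the area *)

Section area_moments.
Context {d : measure_display} {T : measurableType d} {R : realType}.
Variable P : probability T R.
Local Notation intble := (intble P).
Local Notation E := (E P).
Variables W1 W2 : R -> {RV P >-> R}.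
Hypotheses (hW1 : is_wiener W1) (hW2 : is_wiener W2) (hW12 : independent_processes W1 W2).
Variable t : R.
Hypothesis t0 : 0 <= t.
Variable A : {RV P >-> R}.
Hypothesis hA : is_area_integral W1 W2 t A.

Lemma natural_filtrationE s : natural_filtration W1 W2 s = joint_past W1 W2 s s.
Proof.
apply/seteqP; split; first exact: natural_filtration_joint_past.
exact: joint_past_natural_filtration.
Qed.

(** Each of the two iterated integrals is within 8 / N of its sum, and the square of a difference
    costs a factor 2: 32 = 2 * 8 + 2 * 8. *)
Lemma area_sum_distance N : (0 < N)%N ->
  sqint P A /\ E (fun w => (A w - area_sum W1 W2 t N N w) ^+ 2) <= 32 / N%:R.
Proof.
move=> N0; have [I12 [I21 [H12 H21 AE]]] := hA.
have hW21 : independent_processes W2 W1 by move=> B C WB WC; rewrite setIC muleC; exact: hW12.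
have F21 s : natural_filtration W1 W2 s = joint_past W2 W1 s s.
  by rewrite natural_filtrationE joint_pastC.
have [s12 d12] := iterated_integral_riemann_distance hW1 hW2 hW12 natural_filtrationE t0 N0 H12.
have [s21 d21] := iterated_integral_riemann_distance hW2 hW1 hW21 F21 t0 N0 H21.
pose Z12 w := \sum_(i < N) (W1 (grid t N i) w - W1 t w) * (W2 (grid t N i.+1) w - W2 (grid t N i) w).
pose Z21 w := \sum_(i < N) (W2 (grid t N i) w - W2 t w) * (W1 (grid t N i.+1) w - W1 (grid t N i) w).
have m12 : all_moments P Z12.
  apply: all_moments_sum => i; apply: all_momentsM; apply: increment_all_moments => //;
    by [exact: grid_ge|exact: grid_ge0|exact: grid_le].
have m21 : all_moments P Z21.
  apply: all_moments_sum => i; apply: all_momentsM; apply: increment_all_moments => //;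
    by [exact: grid_ge|exact: grid_ge0|exact: grid_le].
have [_ i12] := sqintB s12 (all_moments_sqint m12).
have [_ i21] := sqintB s21 (all_moments_sqint m21).
have ZE w : area_sum W1 W2 t N N w = Z12 w - Z21 w.
  by rewrite /area_sum -sumrB.
have sA : sqint P A by rewrite (_ : (A : T -> R) = fun w => I12 w - I21 w); [exact: sqintB|exact/funext].
split=> //.
apply: (@le_trans _ _ (E (fun w => 2 * (I12 w - Z12 w) ^+ 2 + 2 * (I21 w - Z21 w) ^+ 2))).
  apply: le_E.
  - have [_] := sqintB sA (all_moments_sqint (all_momentsB m12 m21)).
    by congr (intble _); apply/funext => w; rewrite ZE.
  - by apply: intbleD; exact: intbleZ.
  - move=> w; rewrite ZE AE.
    have := sqr_ge0 ((I12 w - Z12 w) + (I21 w - Z21 w)); nra.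
rewrite ED; [|exact: intbleZ..]; rewrite !EZ// (_ : 32 / N%:R = 2 * (8 / N%:R) + 2 * (8 / N%:R)); last by ring.
by apply: lerD; rewrite ler_wpM2l.
Qed.

Variable alpha : nat -> nat -> R.
Hypothesis alpha0 : alpha 0 0 = 1.
Hypothesis alpha_rec0 : forall n, n.+1%:R * alpha n.+1 0 = n.+1%:R * alpha n 0.
Hypothesis alpha_recS : forall n k, (n%:R + (2 * k.+1)%:R) * alpha n k.+1 =
  n%:R * alpha n.-1 k.+1 + n.+1%:R * alpha n.+1 k.

Lemma riemann_moment_asymptotics i j q : exists C, forall N, (0 < N)%N ->
  `|riemann_moment W1 W2 t N N i j q - limit_moment alpha i j q| <= C / N%:R.
Proof.
have K0 w : 0 <= noise_bound w :> R by rewrite /noise_bound !mulr_ge0 ?expR_ge0.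
have [C _ HC] := discrete_moments_asymptotics K0 alpha0 alpha_rec0 alpha_recS i j q.
exists C => N N0; have := HC N _ N0 (riemann_discrete_moments hW1 hW2 hW12 t0 N0) N (leqnn N).
by rewrite divff ?expr1n ?mulr1// pnatr_eq0 -lt0n.
Qed.

Lemma area_momentE n k :
  area_moment W1 W2 A t n k 0 = (limit_moment alpha (2 * n) 0 (2 * k))%:E.
Proof.
pose Z N := area_sum W1 W2 t N N.
have Zm N : (0 < N)%N -> all_moments P (Z N) by move=> N0; exact: all_moments_area_sum.
have sA : sqint P A by have [] := area_sum_distance (ltn0Sn 0).
have AZ N : (0 < N)%N -> E (fun w => (A w - Z N w) ^+ 2) <= 32 / N%:R.
  by move=> N0; have [] := area_sum_distance N0.
(* The uniform bounds come from the convergence itself, at the exponents i = j = 0. *)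
have Z_bounded p : exists B, forall N, (0 < N)%N -> E (fun w => Z N w ^+ (2 * p)) <= B.
  have [C HC] := riemann_moment_asymptotics 0 0 (2 * p).
  exists (`|limit_moment alpha 0 0 (2 * p)| + `|C|) => N N0.
  have := HC N N0; rewrite /riemann_moment.
  have -> : (fun w => position t N W1 N w ^+ 0 * Z N w ^+ (2 * p) * position t N W2 N w ^+ 0) =
      (fun w => Z N w ^+ (2 * p)).
    by apply/funext => w; rewrite !expr0 mul1r mulr1.
  set x := E _; set y := limit_moment _ _ _ _ => xy.
  rewrite -(subrK y x) addrC; apply: lerD; first exact: ler_norm.
  apply: (le_trans (ler_norm _)); apply: (le_trans xy).
  apply: (@le_trans _ _ (`|C| / N%:R)); first by rewrite ler_wpM2r ?invr_ge0// ler_norm.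
  by rewrite ler_piMr// invf_le1 ?ltr0n// ler1n.
have mX : all_moments P (fun w => (W1 (t + 1) w - W1 t w) ^+ (2 * n)).
  by apply/all_momentsX/increment_all_moments => //; rewrite lerDl.
have mA := limit_all_moments sA Zm AZ Z_bounded.
have [C HC] := riemann_moment_asymptotics (2 * n) 0 (2 * k).
rewrite /area_moment.
have -> : (fun w => (W1 (t + 1) w - W1 t w) ^+ (2 * n) * A w ^+ (2 * k) *
    (W2 (t + 1) w - W2 t w) ^+ (2 * 0)) =
    fun w => (W1 (t + 1) w - W1 t w) ^+ (2 * n) * A w ^+ (2 * k).
  by apply/funext => w; rewrite muln0 expr0 mulr1.
rewrite expectation_E; last by apply/all_moments_intble/all_momentsM => //; exact: all_momentsX.
congr EFin; apply: (mixed_moment_limit sA Zm AZ Z_bounded mX (C := C)) => N N0.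
have := HC N N0; rewrite /riemann_moment.
congr (`|E _ - _| <= _); apply/funext => w.
by rewrite expr0 mulr1 /position gridN.
Qed.

End area_moments.

(** * Smooth functions and their Taylor coefficients *)

Section smooth_functions.
Context {R : realType}.
Implicit Types f g : R -> R.

Lemma is_derive_derive1 f g : (forall x : R, is_derive x (1 : R) f (g x)) ->
  (forall x : R, derivable f x 1) /\ f^`()%classic = g.
Proof.
move=> fg; split=> [x|]; first by have [] := fg x.
by apply/funext => x; rewrite derive1E; have [_ ->] := fg x.
Qed.

Lemma derivable_is_derive1 f (x : R) : derivable f x 1 -> is_derive x (1 : R) f (f^`()%classic x).
Proof. by move=> fx; rewrite derive1E; exact: derivableP. Qed.

(** Derivatives are total functions that have a value even where a function is not differentiable,
    so differentiability is tracked separately. *)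
Fixpoint times_derivable (n : nat) f : Prop :=
  if n is m.+1 then (forall x : R, derivable f x 1) /\ times_derivable m (f^`()%classic) else True.

Definition smooth f : Prop := forall n, times_derivable n f.

Lemma times_derivableW n f : times_derivable n.+1 f -> times_derivable n f.
Proof.
elim: n f => // n IH f [df [df' Hf]]; split => //.
by apply: IH.
Qed.

Lemma times_derivable_cst n (c : R) : times_derivable n (fun=> c).
Proof.
elim: n c => // n IH c /=.
have [dc ->] := @is_derive_derive1 (fun=> c) (fun=> 0) (fun x => is_derive_cst c x 1).
by split.
Qed.

Lemma derive1D f g : (forall x : R, derivable f x 1) -> (forall x : R, derivable g x 1) ->
  (forall x : R, derivable (fun x => f x + g x) x 1) /\
  (fun x => f x + g x)^`()%classic = fun x => f^`()%classic x + g^`()%classic x.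
Proof.
move=> df dg; apply: is_derive_derive1 => x.
exact: is_deriveD (derivable_is_derive1 (df x)) (derivable_is_derive1 (dg x)).
Qed.

Lemma derive1M f g : (forall x : R, derivable f x 1) -> (forall x : R, derivable g x 1) ->
  (forall x : R, derivable (fun x => f x * g x) x 1) /\
  (fun x => f x * g x)^`()%classic = fun x => f^`()%classic x * g x + f x * g^`()%classic x.
Proof.
move=> df dg; apply: is_derive_derive1 => x.
have := is_deriveM (derivable_is_derive1 (df x)) (derivable_is_derive1 (dg x)).
by move=> H; apply: (is_derive_eq H); rewrite addrC /GRing.scale/= [g x * _]mulrC.
Qed.

Lemma times_derivableD n f g : times_derivable n f -> times_derivable n g ->
  times_derivable n (fun x => f x + g x).
Proof.
elim: n f g => // n IH f g [df Hf] [dg Hg].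
by rewrite /=; have [dfg ->] := derive1D df dg; split => //; exact: IH.
Qed.

Lemma times_derivableM n f g : times_derivable n f -> times_derivable n g ->
  times_derivable n (fun x => f x * g x).
Proof.
elim: n f g => // n IH f g Hf Hg; have [df Hf'] := Hf; have [dg Hg'] := Hg.
rewrite /=; have [dfg ->] := derive1M df dg; split => //.
by apply: times_derivableD; apply: IH => //; exact: times_derivableW.
Qed.

Lemma derive1V f : (forall x, f x != 0) -> (forall x : R, derivable f x 1) ->
  (forall x : R, derivable (fun x => (f x)^-1) x 1) /\
  (fun x => (f x)^-1)^`()%classic = fun x => -1 * (f^`()%classic x * ((f x)^-1 * (f x)^-1)).
Proof.
move=> f0 df; apply: is_derive_derive1 => x.
have := is_deriveV (f0 x) (derivable_is_derive1 (df x)).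
by move=> H; apply: (is_derive_eq H); rewrite /GRing.scale/= expr2 invfM; ring.
Qed.

Lemma times_derivableV n f : (forall x, f x != 0) -> times_derivable n f ->
  times_derivable n (fun x => (f x)^-1).
Proof.
move=> f0; elim: n => // n IH Hf; have [df Hf'] := Hf.
rewrite /=; have [dfV ->] := derive1V f0 df; split => //.
apply: times_derivableM; first exact: times_derivable_cst.
by apply: times_derivableM => //; apply: times_derivableM; exact/IH/times_derivableW.
Qed.

Lemma derive1_scale (c : R) f : (forall x : R, derivable f x 1) ->
  (forall x : R, derivable (fun x => f (c * x)) x 1) /\
  (fun x => f (c * x))^`()%classic = fun x => c * f^`()%classic (c * x).
Proof.
move=> df; apply: is_derive_derive1 => x.
have dc : is_derive x (1 : R) (fun x : R => c * x) c.
  have := @is_deriveZ _ _ _ (@id R) c x 1 1 (is_derive_id x 1).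
  by move=> H; apply: (is_derive_eq H); rewrite /GRing.scale/= mulr1.
have H := @is_derive1_comp R f (fun x : R => c * x) x _ _ (derivable_is_derive1 (df (c * x))) dc.
by apply: (is_derive_eq H); rewrite mulrC.
Qed.

Lemma times_derivable_scale n (c : R) f : times_derivable n f -> times_derivable n (fun x => f (c * x)).
Proof.
elim: n f => // n IH f [df Hf] /=; have [dfc ->] := derive1_scale c df; split => //.
by apply: times_derivableM; [exact: times_derivable_cst|exact: (IH f^`()%classic)].
Qed.

Lemma smooth_cst (c : R) : smooth (fun=> c).
Proof. by move=> n; exact: times_derivable_cst. Qed.

Lemma smoothD f g : smooth f -> smooth g -> smooth (fun x => f x + g x).
Proof. by move=> Hf Hg n; exact: times_derivableD. Qed.

Lemma smoothM f g : smooth f -> smooth g -> smooth (fun x => f x * g x).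
Proof. by move=> Hf Hg n; exact: times_derivableM. Qed.

Lemma smoothV f : (forall x, f x != 0) -> smooth f -> smooth (fun x => (f x)^-1).
Proof. by move=> f0 Hf n; exact: times_derivableV. Qed.

Lemma smooth_scale (c : R) f : smooth f -> smooth (fun x => f (c * x)).
Proof. by move=> Hf n; exact: times_derivable_scale. Qed.

Lemma smoothX f k : smooth f -> smooth (fun x => f x ^+ k).
Proof.
move=> Hf; elim: k => [|k IH]; first exact: smooth_cst.
by under eq_fun do rewrite exprS; exact: smoothM.
Qed.

Lemma smooth_derivable f : smooth f -> forall x : R, derivable f x 1.
Proof. by move=> Hf; case: (Hf 1%N). Qed.

Lemma smooth_derive1 f : smooth f -> smooth (f^`()%classic).
Proof. by move=> Hf n; case: (Hf n.+1). Qed.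

Lemma smooth_sum (I : Type) (s : seq I) (F : I -> R -> R) :
  (forall i, smooth (F i)) -> smooth (fun x => \sum_(i <- s) F i x).
Proof.
move=> HF; elim: s => [|i s IH].
  by rewrite (_ : (fun _ => _) = fun=> 0) ?funeqE => [|x]; [exact: smooth_cst|rewrite big_nil].
rewrite (_ : (fun _ => _) = fun x => F i x + \sum_(j <- s) F j x); first exact: smoothD.
by apply/funext => x; rewrite big_cons.
Qed.

Lemma smooth_id : smooth (fun x => x).
Proof.
case=> // n; have [d1 d2] := @is_derive_derive1 (fun x => x) (fun=> 1) (fun x => is_derive_id x 1).
by split => //; rewrite d2; exact: times_derivable_cst.
Qed.

Lemma derive1_expR : (@expR R)^`()%classic = expR.
Proof. by have [] := @is_derive_derive1 expR expR (fun x => is_derive_expR x). Qed.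

Lemma smooth_expR : smooth expR.
Proof.
elim=> // n IH; have [d1 d2] := @is_derive_derive1 expR expR (fun x => is_derive_expR x).
by split => //; rewrite d2.
Qed.

End smooth_functions.

Section taylor_coefficients.
Context {R : realType}.
Implicit Types f g : R -> R.

(** Turns identities between smooth functions into identities between formal power series, whether
    or not these series converge. *)
Definition taylor f n : R := derive1n n f 0 / n`!%:R.

Lemma taylor0 f : taylor f 0 = f 0.
Proof. by rewrite /taylor derive1n0 fact0 divr1. Qed.

Lemma taylor_derive1 f n : taylor (f^`()%classic) n = n.+1%:R * taylor f n.+1.
Proof.
have n0 : n.+1%:R != 0 :> R by rewrite pnatr_eq0.
have f0 : n`!%:R != 0 :> R by rewrite pnatr_eq0 -lt0n fact_gt0.
rewrite /taylor -derive1Sn factS natrM.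
move: (derive1n _ _ _) n.+1%:R n`!%:R n0 f0 => x y z y0 z0.
by field; rewrite y0 z0.
Qed.

Lemma taylorD f g n : smooth f -> smooth g ->
  taylor (fun x => f x + g x) n = taylor f n + taylor g n.
Proof.
elim: n f g => [|n IH] f g sf sg; first by rewrite !taylor0.
have n0 : n.+1%:R != 0 :> R by rewrite pnatr_eq0.
apply: (mulfI n0); rewrite mulrDr -!taylor_derive1.
have [_ ->] := derive1D (smooth_derivable sf) (smooth_derivable sg).
by rewrite IH//; exact: smooth_derive1.
Qed.

Lemma taylor_cst (c : R) n : taylor (fun=> c) n = if n is 0 then c else 0.
Proof.
elim: n c => [|n IH] c; first by rewrite taylor0.
have n0 : n.+1%:R != 0 :> R by rewrite pnatr_eq0.
apply: (mulfI n0); rewrite -taylor_derive1.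
have [_ ->] := @is_derive_derive1 _ (fun=> c) (fun=> 0) (fun x => is_derive_cst c x 1).
by rewrite IH mulr0; case: n {IH n0}.
Qed.

Lemma taylorM f g n : smooth f -> smooth g ->
  taylor (fun x => f x * g x) n = \sum_(i < n.+1) taylor f i * taylor g (n - i).
Proof.
elim: n f g => [|n IH] f g sf sg; first by rewrite big_ord1 !taylor0.
have n0 : n.+1%:R != 0 :> R by rewrite pnatr_eq0.
apply: (mulfI n0); rewrite -taylor_derive1.
have [_ ->] := derive1M (smooth_derivable sf) (smooth_derivable sg).
have sf' := smooth_derive1 sf; have sg' := smooth_derive1 sg.
rewrite taylorD; [|exact: smoothM|exact: smoothM]; rewrite !IH//.
under eq_bigr => i _ do rewrite taylor_derive1.
under [X in _ + X]eq_bigr => i _ do rewrite taylor_derive1.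
rewrite mulr_sumr.
(* n + 1 is split as i + (n + 1 - i); the two halves come from f' g and f g'. *)
transitivity (\sum_(i < n.+2) (i%:R * taylor f i * taylor g (n.+1 - i) +
   (n.+1 - i)%:R * taylor f i * taylor g (n.+1 - i))); last first.
  apply: eq_bigr => i _; rewrite -!mulrA -mulrDl -natrD subnKC//.
  by rewrite -ltnS ltn_ord.
rewrite big_split/=; congr (_ + _).
  by rewrite [RHS]big_ord_recl/= !mul0r add0r; apply: eq_bigr => i _.
rewrite [RHS]big_ord_recr/= subnn !mul0r addr0; apply: eq_bigr => i _.
by rewrite subSn ?leq_ord// mulrCA mulrA.
Qed.

Lemma taylor_scale (c : R) f n : smooth f -> taylor (fun x => f (c * x)) n = c ^+ n * taylor f n.
Proof.
elim: n f => [|n IH] f sf; first by rewrite !taylor0 mulr0 expr0 mul1r.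
have n0 : n.+1%:R != 0 :> R by rewrite pnatr_eq0.
apply: (mulfI n0); rewrite -taylor_derive1.
have [_ ->] := derive1_scale c (smooth_derivable sf).
have sf' := smooth_derive1 sf.
rewrite taylorM; [|exact: smooth_cst|exact: smooth_scale].
rewrite big_ord_recl big1 ?addr0; last by move=> i _; rewrite taylor_cst mul0r.
by rewrite taylor_cst subn0 IH// taylor_derive1 exprS/=; ring.
Qed.

Lemma taylor_mulC (c : R) f n : smooth f -> taylor (fun x => c * f x) n = c * taylor f n.
Proof.
move=> sf; rewrite taylorM//; last exact: smooth_cst.
rewrite big_ord_recl big1 ?addr0; last by move=> i _; rewrite taylor_cst mul0r.
by rewrite taylor_cst subn0.
Qed.

Lemma taylor_id n : taylor (fun x => x) n = (n == 1)%N%:R.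
Proof.
case: n => [|n]; first by rewrite taylor0.
have n0 : n.+1%:R != 0 :> R by rewrite pnatr_eq0.
apply: (mulfI n0); rewrite -taylor_derive1.
have [_ ->] := @is_derive_derive1 _ (fun x : R => x) (fun=> 1) (fun x => is_derive_id x 1).
by rewrite taylor_cst; case: n {n0} => [|n]; rewrite ?mulr1 ?mulr0.
Qed.

Lemma taylor_mulX f n : smooth f ->
  taylor (fun x => x * f x) n = if n is m.+1 then taylor f m else 0.
Proof.
move=> sf; rewrite taylorM//; last exact: smooth_id.
case: n => [|n]; first by rewrite big_ord1 taylor_id mul0r.
rewrite 2!big_ord_recl/= big1 ?addr0; last by move=> i _; rewrite taylor_id mul0r.
by rewrite !taylor_id/= mul0r add0r mul1r subSS subn0.
Qed.

Lemma taylor_expR n : taylor expR n = (n`!%:R)^-1.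
Proof.
elim: n => [|n IH]; first by rewrite taylor0 expR0 fact0 invr1.
have n0 : n.+1%:R != 0 :> R by rewrite pnatr_eq0.
by apply: (mulfI n0); rewrite -taylor_derive1 derive1_expR IH factS natrM invfM mulVKf.
Qed.

Lemma taylor_even f n : smooth f -> (forall x, f (- x) = f x) -> odd n -> taylor f n = 0.
Proof.
move=> sf fN on; have := taylor_scale (-1) n sf.
rewrite (_ : (fun x => _) = f); last by apply/funext => x; rewrite mulN1r.
rewrite -signr_odd on expr1 mulN1r => /eqP; rewrite -subr_eq0 opprK -mulr2n mulrn_eq0/=.
by move/eqP.
Qed.

End taylor_coefficients.

(** * Entire series and the Bernoulli function *)

Section entire_series.
Context {R : realType}.
Implicit Type c : nat -> R.

(** The bound gives convergence everywhere by comparison with exp, and termwise differentiation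
    preserves it since (n + 1) / (n + 1)! = 1 / n!; smoothness follows by induction. *)
Definition entire_coef c : Prop := forall n, `|c n| <= (n`!%:R)^-1.

Lemma entire_coef_diffs c : entire_coef c -> entire_coef (pseries_diffs c).
Proof.
move=> Hc n; rewrite /pseries_diffs normrM ger0_norm//.
have n0 : 0 < n.+1%:R :> R by rewrite ltr0n.
rewrite -ler_pdivlMl// (le_trans (Hc _))// factS natrM invfM//.
Qed.

Lemma entire_cvg c x : entire_coef c -> cvgn (pseries c x).
Proof.
move=> Hc; apply: normed_cvg.
apply: (@series_le_cvg _ _ (exp_coeff `|x|)) => [n|n|n|]; last exact: is_cvg_series_exp_coeff.
- exact: normr_ge0.
- by rewrite /exp_coeff/= divr_ge0// exprn_ge0.
- by rewrite /exp_coeff/= normrM normrX mulrC ler_wpM2l ?exprn_ge0.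
Qed.

Definition entire c (x : R) : R := limn (pseries c x).

Lemma is_derive_entire c x : entire_coef c ->
  is_derive x (1 : R) (entire c) (entire (pseries_diffs c) x).
Proof.
move=> Hc; have Hc' := entire_coef_diffs Hc; have Hc'' := entire_coef_diffs Hc'.
apply: (@pseries_snd_diffs _ c (`|x| + 1)); try exact: entire_cvg.
by rewrite [ltRHS]ger0_norm ?addr_ge0// ltrDl.
Qed.

Lemma smooth_entire c : entire_coef c -> smooth (entire c).
Proof.
move=> + n; elim: n c => // n IH c Hc /=.
have [dc ->] := is_derive_derive1 (fun x => is_derive_entire x Hc).
by split => //; apply/IH/entire_coef_diffs.
Qed.

End entire_series.

Section bernoulli_function.
Context {R : realType}.

(** (e^x - 1) / x with its singularity removed, so that its reciprocal is smooth at 0 as well. *)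
Definition phi : R -> R := entire (fun n => (n.+1)`!%:R^-1).

Lemma phi_coef : entire_coef (fun n => (n.+1)`!%:R^-1 : R).
Proof.
move=> n; rewrite ger0_norm ?invr_ge0// lef_pV2 ?posrE ?ltr0n ?fact_gt0// ler_nat.
by rewrite factS leq_pmull.
Qed.

Lemma smooth_phi : smooth phi.
Proof. exact/smooth_entire/phi_coef. Qed.

Lemma mulX_phi x : x * phi x = expR x - 1.
Proof.
have c1 : cvgn (pseries (fun n => (n.+1)`!%:R^-1 : R) x) by apply: entire_cvg; exact: phi_coef.
have cl : (x * pseries (fun n => (n.+1)`!%:R^-1) x n @[n --> \oo] --> x * phi x).
  by apply: cvgMr.
have cr : (series (exp_coeff x) n.+1 - 1 @[n --> \oo] --> expR x - 1).
  apply: cvgB; last exact: cvg_cst.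
  have := is_cvg_series_exp_coeff x; rewrite -[X in X -> _]/(series (exp_coeff x) @ \oo --> expR x) -cvg_shiftS.
  by [].
apply: cvg_unique cl _; [exact: norm_hausdorff|].
apply: cvg_trans cr; apply: near_eq_cvg; near=> n.
rewrite /pseries /series /exp_coeff/= big_nat_recl//= expr0 fact0 divr1 addrAC subrr add0r mulr_sumr.
by apply: eq_bigr => i _; rewrite exprS mulrAC -!mulrA.
Unshelve. all: by end_near. Qed.

Lemma phi0 : phi 0 = 1.
Proof.
rewrite /phi /entire; apply: lim_near_cst; first exact: norm_hausdorff.
near=> n; have n0 : (0 < n)%N by near: n; exact: nbhs_infty_gt.
rewrite /pseries /series/= -(prednK n0) big_nat_recl//= expr0 mulr1 factS fact0 muln1 invr1.
by rewrite big1 ?addr0// => i _; rewrite exprS mul0r mulr0.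
Unshelve. all: by end_near. Qed.

Lemma phi_neq0 x : phi x != 0.
Proof.
have [->|x0] := eqVneq x 0; first by rewrite phi0 oner_eq0.
apply/eqP => p0; have := mulX_phi x; rewrite p0 mulr0 => /esym/eqP.
by rewrite subr_eq0 -expR0 => /eqP/expR_inj x0'; rewrite x0' eqxx in x0.
Qed.

Lemma taylor_phi n : taylor phi n = (n.+1)`!%:R^-1.
Proof.
have := taylor_mulX n.+1 smooth_phi => <-.
rewrite (_ : (fun x => _) = fun x => expR x + -1); last by apply/funext => x; exact: mulX_phi.
rewrite taylorD; [|exact: smooth_expR|exact: smooth_cst].
by rewrite taylor_cst addr0 taylor_expR.
Qed.

Definition bernoulli_fun (x : R) : R := (phi x)^-1.

Lemma smooth_bernoulli_fun : smooth bernoulli_fun.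
Proof. exact: smoothV phi_neq0 smooth_phi. Qed.

Lemma bernoulli_fun0 : bernoulli_fun 0 = 1.
Proof. by rewrite /bernoulli_fun phi0 invr1. Qed.

Lemma mul_bernoulli_fun x : (expR x - 1) * bernoulli_fun x = x.
Proof. by rewrite -mulX_phi mulfK// phi_neq0. Qed.

(** The coefficients of [bernoulli_fun] times [phi], which is 1, give the recursion
    [bernoulli_number_rec] divided by (n + 1)!; its top term is determined by the earlier ones. *)
Lemma taylor_bernoulli_fun n :
  taylor bernoulli_fun n = ratr (bernoulli_number n) / n`!%:R.
Proof.
have [m] := ubnP n; elim: m n => // m IH n; rewrite ltnS => nm.
have : taylor (fun x => bernoulli_fun x * phi x) n = (n == 0)%N%:R.
  rewrite (_ : (fun x => _) = fun=> 1); last first.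
    by apply/funext => x; rewrite mulVf// phi_neq0.
  by rewrite taylor_cst; case: n {nm}.
rewrite taylorM; [|exact: smooth_bernoulli_fun|exact: smooth_phi].
have rec : \sum_(i < n.+1) ratr (bernoulli_number i) / i`!%:R * ((n.+1 - i)`!%:R)^-1 = (n == 0)%N%:R :> R.
  have f0 k : k`!%:R != 0 :> R by rewrite pnatr_eq0 -lt0n fact_gt0.
  apply: (mulfI (f0 n.+1)).
  transitivity (ratr (\sum_(i < n.+1) 'C(n.+1, i)%:R * bernoulli_number i) : R).
    rewrite rmorph_sum mulr_sumr; apply: eq_bigr => i _.
    rewrite rmorphM/= ratr_nat -(@bin_fact n.+1 i) ?natrM; last by rewrite ltnW.
    by field; rewrite !f0.
  rewrite bernoulli_number_rec ratr_nat; case: n {nm} => [|n]; rewrite ?mulr0//.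
  by rewrite mulr1 factS fact0.
rewrite -rec !big_ord_recr/= subnn subSnn taylor_phi.
rewrite (eq_bigr (fun i : 'I_n => ratr (bernoulli_number i) / i`!%:R * ((n.+1 - i)`!%:R)^-1)).
  by move/addrI; rewrite (_ : 1`! = 1)%N// invr1 !mulr1.
by move=> i _; rewrite IH ?(leq_trans (ltn_ord i))// taylor_phi subSn// ltnW.
Qed.

End bernoulli_function.

(** * Hyperbolic functions and the differential equations of r_n *)

Section hyperbolic_functions.
Context {R : realType}.

Lemma cosh_gt0 (x : R) : 0 < cosh x.
Proof. by rewrite divr_gt0// addr_gt0 ?expR_gt0. Qed.

Lemma cosh_neq0 (x : R) : cosh x != 0.
Proof. exact/lt0r_neq0/cosh_gt0. Qed.

Lemma expRN_scale : (fun x : R => expR (- x)) = (fun x : R => expR (-1 * x)).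
Proof. by apply/funext => x; rewrite mulN1r. Qed.

Lemma smooth_expRN : smooth (fun x : R => expR (- x)).
Proof. by rewrite expRN_scale; exact/smooth_scale/smooth_expR. Qed.

Lemma is_derive_expRN (x : R) : is_derive x (1 : R) (fun x : R => expR (- x)) (- expR (- x)).
Proof.
have := is_derive1_comp (is_derive_expR (- x)) (is_deriveN (is_derive_id x (1 : R))).
by move=> H; apply: (is_derive_eq H); rewrite mulrN1.
Qed.

Lemma is_derive_cosh (x : R) : is_derive x (1 : R) cosh (sinh x).
Proof.
have := is_deriveM (is_deriveD (is_derive_expR x) (is_derive_expRN x)) (is_derive_cst (2^-1 : R) x 1).
by move=> H; apply: (is_derive_eq H); rewrite /GRing.scale/= mulr0 add0r mulrC.
Qed.

Lemma is_derive_sinh (x : R) : is_derive x (1 : R) sinh (cosh x).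
Proof.
have := is_deriveM (is_deriveB (is_derive_expR x) (is_derive_expRN x)) (is_derive_cst (2^-1 : R) x 1).
by move=> H; apply: (is_derive_eq H); rewrite /GRing.scale/= mulr0 add0r mulrC opprK.
Qed.

Lemma smooth_cosh : smooth (@cosh R).
Proof.
apply: smoothM; last exact: smooth_cst.
by apply: smoothD; [exact: smooth_expR|exact: smooth_expRN].
Qed.

Definition sech (x : R) : R := (cosh x)^-1.

Lemma smooth_sech : smooth sech.
Proof. exact: smoothV cosh_neq0 smooth_cosh. Qed.

Lemma is_derive_sech (x : R) : is_derive x (1 : R) sech (- (tanh x * sech x)).
Proof.
have := is_deriveV (cosh_neq0 x) (is_derive_cosh x).
move=> H; apply: (is_derive_eq H); rewrite /GRing.scale/= /tanh /sech.
by have := cosh_neq0 x; move: (cosh x) (sinh x) => c s c0; field.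
Qed.

Lemma is_derive_tanh (x : R) : is_derive x (1 : R) tanh (1 - tanh x ^+ 2).
Proof.
have := is_deriveM (is_derive_sinh x) (is_derive_sech x).
move=> H; apply: (is_derive_eq H); rewrite /GRing.scale/= /tanh /sech.
by have := cosh_neq0 x; move: (cosh x) (sinh x) => c s c0; field.
Qed.

Lemma cosh0 : cosh (0 : R) = 1.
Proof. by rewrite /cosh oppr0 expR0; field. Qed.

Lemma tanh0 : tanh (0 : R) = 0.
Proof. by rewrite /tanh /sinh oppr0 subrr !mul0r. Qed.

Lemma coshN (x : R) : cosh (- x) = cosh x.
Proof. by rewrite /cosh opprK addrC. Qed.

Lemma tanhN (x : R) : tanh (- x) = - tanh x.
Proof. by rewrite /tanh coshN /sinh opprK -opprB !mulNr. Qed.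

Lemma tanhE (x : R) : tanh x = (expR (2 * x) - 1) / (expR (2 * x) + 1).
Proof.
have e := expR_gt0 x; rewrite /tanh /sinh /cosh expRN mulr_natl mulr2n expRD.
move: (expR x) e => a a0; field.
have a2 : 0 < a * a by rewrite mulr_gt0.
by rewrite !lt0r_neq0 ?addr_gt0// .
Qed.

(** tanh x / x extended smoothly to 0, from sinh x = e^(- x) (e^(2 x) - 1) / 2. *)
Definition tanhc (x : R) : R := expR (- x) * phi (2 * x) * sech x.

Lemma smooth_tanhc : smooth tanhc.
Proof.
apply: smoothM; last exact: smooth_sech.
apply: smoothM; first exact: smooth_expRN.
exact/smooth_scale/smooth_phi.
Qed.

Lemma mulX_tanhc x : x * tanhc x = tanh x.
Proof.
rewrite /tanhc /tanh mulrA; congr (_ / _).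
rewrite mulrCA (_ : x * phi (2 * x) = (expR (2 * x) - 1) / 2); last first.
  by rewrite -mulX_phi; field.
rewrite /sinh mulrA mulrBr mulr1 -expRD; congr ((expR _ - _) / _); ring.
Qed.

Lemma tanhc0 : tanhc 0 = 1.
Proof. by rewrite /tanhc /sech oppr0 mulr0 expR0 phi0 cosh0 invr1 !mulr1. Qed.

Lemma r_funE n : r_fun n = fun x => tanhc x ^+ n * sech x.
Proof.
apply/funext => x; rewrite /r_fun; case: eqVneq => [->|x0].
  by rewrite tanhc0 /sech cosh0 expr1n invr1 mulr1.
by rewrite -mulX_tanhc [x * _]mulrC mulfK.
Qed.

Lemma r_fun0 n : r_fun n (0 : R) = 1.
Proof. by rewrite /r_fun eqxx. Qed.

Lemma smooth_r_fun n : smooth (r_fun n : R -> R).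
Proof. by rewrite r_funE; apply: smoothM smooth_sech; exact/smoothX/smooth_tanhc. Qed.

Lemma mulX_derive1_tanhc x : x * tanhc^`()%classic x = 1 - tanh x ^+ 2 - tanhc x.
Proof.
have d1 := derivable_is_derive1 (@smooth_derivable _ tanhc smooth_tanhc x).
have d2 := is_deriveM (is_derive_id x (1 : R)) d1.
have d3 := is_derive_tanh x.
have [_ <-] := d3.
rewrite (_ : tanh = id \* tanhc); last by apply/funext => y; rewrite /= mulX_tanhc.
by have [_ ->] := d2; rewrite /GRing.scale/= mulr1 addrK.
Qed.

Lemma mulX_derive1_r_fun n (x : R) : x * (r_fun n)^`()%classic x =
  n%:R * tanhc x ^+ n.-1 * sech x * (1 - tanh x ^+ 2 - tanhc x) - x * tanh x * r_fun n x.
Proof.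
have d1 := derivable_is_derive1 (@smooth_derivable _ tanhc smooth_tanhc x).
have d2 := is_deriveM (is_deriveX n d1) (is_derive_sech x).
rewrite derive1E r_funE.
rewrite (_ : (fun x => _) = tanhc ^+ n * sech); last by apply/funext => y; rewrite fctE exprfctE.
have [_ ->] := d2; rewrite exprfctE.
rewrite /GRing.scale/= -mulX_derive1_tanhc; ring.
Qed.

(** With tanh x = x [tanhc] x both sides are polynomials in x, [tanhc] and [sech]; for n = 0 the
    truncated predecessor is multiplied by 0. *)
Lemma r_fun_ode n (x : R) : n%:R * r_fun n x + x * (r_fun n)^`()%classic x =
  n%:R * r_fun n.-1 x - n.+1%:R * (x * (x * r_fun n.+1 x)).
Proof.
rewrite mulX_derive1_r_fun -mulX_tanhc !r_funE.
by case: n => [|n]/=; rewrite -1?natr1 ?exprS; ring.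
Qed.

Lemma expR_sub1_neq0 (y : R) : y != 0 -> expR y - 1 != 0.
Proof. by rewrite subr_eq0 -expR0; apply: contra_neq => /expR_inj. Qed.

Lemma bernoulli_funN (y : R) : bernoulli_fun (- y) = bernoulli_fun y + y.
Proof.
have [->|y0] := eqVneq y 0; first by rewrite oppr0 addr0.
have e0 : expR (- y) - 1 != 0 by apply: expR_sub1_neq0; rewrite oppr_eq0.
apply: (mulfI e0); rewrite mul_bernoulli_fun.
have := mul_bernoulli_fun y; have := expRxMexpNx_1 y.
move: (bernoulli_fun y) (expR y) (expR (- y)) => b a a' aa ab.
have h : a' * y + a' * b = b.
  by rewrite -mulrDr -ab mulrBl mul1r subrK mulrA [a' * a]mulrC aa mul1r.
have -> : (a' - 1) * (b + y) = a' * y + a' * b - b - y by ring.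
by rewrite h subrr sub0r.
Qed.

Lemma bernoulli_fun_double (x : R) :
  (expR (2 * x) + 1) * bernoulli_fun (4 * x) = 2 * bernoulli_fun (2 * x).
Proof.
have [->|x0] := eqVneq x 0; first by rewrite !mulr0 expR0 bernoulli_fun0.
have e0 : expR (2 * x) - 1 != 0 by apply: expR_sub1_neq0; rewrite mulf_neq0.
apply: (mulfI e0); rewrite mulrA.
have -> : (expR (2 * x) - 1) * (expR (2 * x) + 1) = expR (4 * x) - 1.
  have -> : 4 * x = 2 * x + 2 * x by ring.
  by rewrite expRD; ring.
by rewrite mul_bernoulli_fun mulrCA mul_bernoulli_fun; ring.
Qed.

(** The left side is x times the logarithmic derivative of [cosh]. The identity serves a second time
    to relate Bernoulli numbers to the coefficients of tanh. *)
Lemma mulX_tanhE (x : R) : x * tanh x = x - bernoulli_fun (2 * x) + bernoulli_fun (4 * x).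
Proof.
have [->|x0] := eqVneq x 0; first by rewrite !mulr0 bernoulli_fun0 mul0r; ring.
have d := bernoulli_fun_double x; have m := mul_bernoulli_fun (2 * x).
have e1 : expR (2 * x) + 1 != 0 by rewrite lt0r_neq0// addr_gt0 ?expR_gt0.
rewrite tanhE; apply: (mulfI e1).
rewrite mulrDr d mulrCA [_ * (_ / _)]mulrCA mulfV// mulr1.
have -> : (expR (2 * x) + 1) * (x - bernoulli_fun (2 * x)) + 2 * bernoulli_fun (2 * x) =
  (expR (2 * x) + 1) * x - (expR (2 * x) - 1) * bernoulli_fun (2 * x) by ring.
by rewrite m; ring.
Qed.

(** By [mulX_derive1_tanhc], this says that x times the logarithmic derivative of [tanhc] is 2 b (2
    x) - b (4 x) - 1. *)
Lemma mul_tanhc_log_derive (x : R) :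
  (2 * bernoulli_fun (2 * x) - bernoulli_fun (4 * x)) * tanhc x = 1 - tanh x ^+ 2.
Proof.
have [->|x0] := eqVneq x 0.
  by rewrite !mulr0 !bernoulli_fun0 tanh0 tanhc0 expr0n/=; ring.
have d := bernoulli_fun_double x; have m := mul_bernoulli_fun (2 * x).
have e1 : expR (2 * x) + 1 != 0 by rewrite lt0r_neq0// addr_gt0 ?expR_gt0.
apply: (mulfI x0); rewrite mulrCA mulX_tanhc -d.
have -> : (expR (2 * x) + 1) * bernoulli_fun (4 * x) - bernoulli_fun (4 * x) =
  expR (2 * x) * bernoulli_fun (4 * x) by ring.
rewrite tanhE; move: d m e1.
move: (expR (2 * x)) (bernoulli_fun (2 * x)) (bernoulli_fun (4 * x)) => e b b' d m e1.
have -> : e * b' * ((e - 1) / (e + 1)) = e * ((e - 1) * (2 * b)) / (e + 1) ^+ 2.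
  by rewrite -d; field.
by rewrite [(e - 1) * _]mulrCA m; field.
Qed.

Lemma mulX_derive1_r_funE n (x : R) : x * (r_fun n)^`()%classic x =
  (n%:R * (2 * bernoulli_fun (2 * x) - bernoulli_fun (4 * x) - 1)
   - (x - bernoulli_fun (2 * x) + bernoulli_fun (4 * x))) * r_fun n x.
Proof.
rewrite mulX_derive1_r_fun -mul_tanhc_log_derive mulX_tanhE r_funE.
by case: n => [|n]/=; rewrite ?exprS; ring.
Qed.

End hyperbolic_functions.

(** * Taylor coefficients of r_n and signs of the Bernoulli numbers *)

Section taylor_coefficients_of_r_fun.
Context {R : realType}.

Lemma taylor_mulX_derive1 (f : R -> R) m : smooth f ->
  taylor (fun x => x * f^`()%classic x) m = m%:R * taylor f m.
Proof.
move=> sf; rewrite taylor_mulX; last exact: smooth_derive1.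
by case: m => [|m]; rewrite ?mul0r// taylor_derive1.
Qed.

Lemma taylor_odd (f : R -> R) n : smooth f -> (forall x, f (- x) = - f x) -> ~~ odd n ->
  taylor f n = 0.
Proof.
move=> sf fN on; have := taylor_scale (-1) n sf.
rewrite (_ : (fun x => _) = fun x => -1 * f x); last by apply/funext => x; rewrite !mulN1r.
rewrite -signr_odd (negbTE on) expr0 mul1r taylor_mulC// mulN1r => /esym/eqP.
by rewrite -subr_eq0 opprK -mulr2n mulrn_eq0/= => /eqP.
Qed.

Definition signed_taylor (n k : nat) : R := (-1) ^+ k * taylor (r_fun n) (2 * k).

Lemma signed_taylor0 n : signed_taylor n 0 = 1.
Proof. by rewrite /signed_taylor mul1r taylor0 r_fun0. Qed.

Lemma taylor_r_fun_ode n m : n%:R * taylor (r_fun n) m.+2 + m.+2%:R * taylor (r_fun n) m.+2 =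
  n%:R * taylor (r_fun n.-1) m.+2 - n.+1%:R * taylor (r_fun n.+1) m :> R.
Proof.
have s k := @smooth_r_fun R k; have sx k := smoothM (@smooth_id R) (s k).
have sxx := smoothM (@smooth_id R) (sx n.+1).
have sc c f : smooth f -> smooth (fun x => c * f x : R).
  by move=> sf; apply: smoothM sf; exact: smooth_cst.
have sd := smoothM (@smooth_id R) (smooth_derive1 (s n)).
have e : (fun x : R => n%:R * r_fun n x + x * (r_fun n)^`()%classic x) =
    (fun x : R => n%:R * r_fun n.-1 x + (- n.+1%:R) * (x * (x * r_fun n.+1 x))).
  by apply/funext => x; rewrite r_fun_ode mulNr.
have := congr1 (fun f => taylor f m.+2) e; cbv beta.
rewrite (taylorD _ (sc _ _ (s n)) sd) (taylor_mulC _ _ (s n)) (taylor_mulX_derive1 _ (s n)).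
rewrite (taylorD _ (sc _ _ (s n.-1)) (sc _ _ sxx)) (taylor_mulC _ _ (s n.-1)).
by rewrite (taylor_mulC _ _ sxx) (taylor_mulX _ (sx n.+1)) (taylor_mulX _ (s n.+1)) mulNr.
Qed.

Lemma signed_taylor_rec n k : (n%:R + (2 * k.+1)%:R) * signed_taylor n k.+1 =
  n%:R * signed_taylor n.-1 k.+1 + n.+1%:R * signed_taylor n.+1 k.
Proof.
have e : (2 * k.+1 = (2 * k).+2)%N by rewrite mulnS.
have := taylor_r_fun_ode n (2 * k).
rewrite /signed_taylor e.
move: (taylor (r_fun n) _) (taylor (r_fun n.-1) _) (taylor (r_fun n.+1) _) => a b c.
by rewrite -mulrDl mulrCA => ->; rewrite exprS; ring.
Qed.

Lemma smooth_tanh : smooth (@tanh R).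
Proof.
rewrite (_ : tanh = fun x => x * tanhc x); last by apply/funext => x; rewrite mulX_tanhc.
exact: smoothM smooth_id smooth_tanhc.
Qed.

Lemma taylor_tanh_even k : taylor (@tanh R) (2 * k) = 0.
Proof. by apply: taylor_odd => [|x|]; [exact: smooth_tanh|exact: tanhN|rewrite oddM]. Qed.

Lemma taylor_tanh_rec m : m.+1%:R * taylor (@tanh R) m.+1 =
  (m == 0)%N%:R - \sum_(i < m.+1) taylor (@tanh R) i * taylor (@tanh R) (m - i).
Proof.
have [_ d] := is_derive_derive1 (@is_derive_tanh R).
rewrite -taylor_derive1 d.
have st := smooth_tanh.
rewrite (_ : (fun x => _) = fun x => 1 + -1 * (tanh x * tanh x)); last first.
  by apply/funext => x; rewrite expr2 mulN1r.
have stt := smoothM st st.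
rewrite taylorD//; [|exact: smooth_cst|by apply: smoothM => //; exact: smooth_cst].
by rewrite taylor_mulC// taylorM// taylor_cst mulN1r; case: m.
Qed.

(** By tanh' = 1 - tanh^2, each odd coefficient after the first is a negative multiple of a
    convolution of earlier odd ones, so the signs alternate. *)
Lemma taylor_tanh_sign j : 0 <= (-1) ^+ j * taylor (@tanh R) (2 * j).+1.
Proof.
have [m] := ubnP j; elim: m j => // m IH j; rewrite ltnS => jm.
have j0 : 0 < (2 * j).+1%:R :> R by rewrite ltr0n.
rewrite -(pmulr_rge0 _ j0) mulrCA taylor_tanh_rec mulrBr addr_ge0//.
  by case: j {jm j0} => [|j]; rewrite ?mul1r// mulr0.
rewrite -mulrN -sumrN mulr_sumr sumr_ge0// => i _.
have [oi|oi] := boolP (odd i); last first.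
  have ei : nat_of_ord i = (2 * i./2)%N by rewrite -[LHS](even_halfK oi) -muln2 mulnC.
  by rewrite ei taylor_tanh_even mul0r oppr0 mulr0.
have [a ia] : exists a, nat_of_ord i = (2 * a).+1.
  by exists i./2; rewrite -[LHS]odd_double_half oi -muln2 mulnC.
have ij := ltn_ord i.
have aj : (a < j)%N by move: ia ij; clear; lia.
have ji : (2 * j - i = (2 * (j - a.+1)).+1)%N by move: ia aj; clear; lia.
rewrite ji ia.
(* The indices 2 a + 1 and 2 (j - a - 1) + 1 add up to 2 j, so the two signs have total exponent j -
   1; the missing sign cancels the minus of the recursion. *)
have -> : (-1) ^+ j = - ((-1) ^+ a * (-1) ^+ (j - a.+1)) :> R.
  by rewrite -exprD -[RHS]mulN1r -exprS; congr (_ ^+ _); move: aj; clear; lia.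
have h1 := IH a (leq_trans aj jm).
have h2 : 0 <= (-1) ^+ (j - a.+1) * taylor (@tanh R) (2 * (j - a.+1)).+1.
  by apply: IH; move: aj jm; clear; lia.
have := mulr_ge0 h1 h2; move: (taylor _ _) (taylor _ _) => x y.
by congr (_ <= _); ring.
Qed.

Lemma taylor_bernoulli_scale (c : R) n :
  taylor (fun x => bernoulli_fun (c * x)) n = c ^+ n * (ratr (bernoulli_number n) / n`!%:R).
Proof. by rewrite taylor_scale ?taylor_bernoulli_fun//; exact: smooth_bernoulli_fun. Qed.

Let sb (c : R) : smooth (fun x => bernoulli_fun (c * x)).
Proof. exact/smooth_scale/smooth_bernoulli_fun. Qed.

Lemma taylor_tanh_bernoulli j : (0 < j)%N ->
  taylor (@tanh R) (2 * j).-1 = (4 ^+ (2 * j) - 2 ^+ (2 * j)) * (ratr (bernoulli_number (2 * j)) / (2 * j)`!%:R).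
Proof.
move=> j0; have : taylor (fun x : R => x * tanh x) (2 * j) = taylor (@tanh R) (2 * j).-1.
  by rewrite taylor_mulX; [case: j j0|exact: smooth_tanh].
move=> <-; rewrite (_ : (fun x => _) = fun x => x + (-1 * bernoulli_fun (2 * x) + bernoulli_fun (4 * x))); last first.
  by apply/funext => x; rewrite mulX_tanhE mulN1r addrA.
have sNb : smooth (fun x => -1 * bernoulli_fun (2 * x) : R) by apply: smoothM => //; exact: smooth_cst.
rewrite taylorD//; [|exact: smooth_id|exact: smoothD].
rewrite taylorD// taylor_mulC// !taylor_bernoulli_scale taylor_id.
by rewrite (_ : (2 * j == 1)%N = false) ?add0r ?mulN1r ?mulrBl 1?addrC//; move: j0; clear; lia.
Qed.

(** The factor 4^(2 j) - 2^(2 j) in [taylor_tanh_bernoulli] is positive, so the Bernoulli number has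
    the sign of the coefficient of tanh of order 2 j - 1. *)
Lemma bernoulli_sign j : (0 < j)%N ->
  `|ratr (bernoulli_number (2 * j)) : R| = (-1) ^+ j.+1 * ratr (bernoulli_number (2 * j)).
Proof.
case: j => // j _; rewrite !exprS mulrA mulrNN !mul1r.
have h := taylor_tanh_sign j; have := @taylor_tanh_bernoulli j.+1 isT.
rewrite (_ : (2 * j.+1).-1 = (2 * j).+1)%N ?mulnS// => e.
move: h; rewrite e mulrCA pmulr_rge0; last first.
  by rewrite subr_gt0 ltrXn2r ?ler0n// ltr_nat.
rewrite mulrA pmulr_lge0 ?invr_gt0 ?ltr0n ?fact_gt0// => h.
by rewrite -[RHS]ger0_norm// normrMsign.
Qed.

End taylor_coefficients_of_r_fun.

Section r_fun_recurrence.
Context {R : realType}.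

(** x r_n' / r_n, grouped by Bernoulli function. Since b (- y) = b y + y, the linear term - x is
    exactly what makes it even. *)
Definition log_derive (n : nat) (x : R) : R :=
  (n%:R * 2 + 1) * bernoulli_fun (2 * x) + (- n.+1%:R * bernoulli_fun (4 * x) + (-1 * x + - n%:R)).

Lemma mulX_derive1_r_fun_log n (x : R) : x * (r_fun n)^`()%classic x = log_derive n x * r_fun n x.
Proof. by rewrite mulX_derive1_r_funE /log_derive -[in RHS]natr1; congr (_ * _); ring. Qed.

Let smooth_term (c a : R) : smooth (fun x => c * bernoulli_fun (a * x)).
Proof. by apply: smoothM; [exact: smooth_cst|exact/smooth_scale/smooth_bernoulli_fun]. Qed.

Let smooth_linear (c b : R) : smooth (fun x => c * x + b).
Proof. by apply: smoothD; [apply: smoothM; [exact: smooth_cst|exact: smooth_id]|exact: smooth_cst]. Qed.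

Lemma smooth_log_derive n : smooth (log_derive n).
Proof. by apply: smoothD (smoothD _ _). Qed.

Lemma log_deriveN n x : log_derive n (- x) = log_derive n x.
Proof. by rewrite /log_derive !mulrN !bernoulli_funN -[n.+1%:R]natr1; ring. Qed.

Lemma log_derive0 n : log_derive n 0 = 0.
Proof. by rewrite /log_derive !mulr0 !bernoulli_fun0 -natr1; ring. Qed.

(** Here beta arises: (2 n + 1) 2^(2 j) - (n + 1) 4^(2 j) = - 2^(2 j) ((2^(2 j) - 1) (n + 1) - n),
    and [bernoulli_sign] converts the sign of the Bernoulli number. *)
Lemma taylor_log_derive n j : (0 < j)%N ->
  taylor (log_derive n) (2 * j) = 2 * (-1) ^+ j * beta_coef n j.
Proof.
move=> j0.
have -> : taylor (log_derive n) (2 * j) =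
   (n%:R * 2 + 1) * taylor (fun x : R => bernoulli_fun (2 * x)) (2 * j)
    - n.+1%:R * taylor (fun x : R => bernoulli_fun (4 * x)) (2 * j).
  have sb c := smooth_scale c (@smooth_bernoulli_fun R).
  rewrite (taylorD _ (smooth_term _ _) (smoothD (smooth_term _ _) (smooth_linear _ _))).
  rewrite (taylorD _ (smooth_term _ _) (smooth_linear _ _)) (taylor_mulC _ _ (sb 2)) (taylor_mulC _ _ (sb 4)).
  rewrite (taylorD _ (smoothM (smooth_cst _) (@smooth_id R)) (smooth_cst _)).
  rewrite (taylor_mulC _ _ (@smooth_id R)) taylor_id taylor_cst.
  have -> : (2 * j == 1)%N = false by move: j0; clear; lia.
  by case: j j0 => // j _; rewrite mulr0 !addr0 mulNr.
rewrite !taylor_bernoulli_scale /beta_coef bernoulli_sign//.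
have -> : 2 ^+ (2 * j - 1) = 2 ^+ (2 * j) / 2 :> R.
  by rewrite -{2}(@subnK 1 (2 * j)) ?muln_gt0// addn1 exprS mulrAC mulfV ?mul1r.
have -> : 4 ^+ (2 * j) = 2 ^+ (2 * j) * 2 ^+ (2 * j) :> R by rewrite -exprMn; congr (_ ^+ _); ring.
have e : (-1) ^+ j * (-1) ^+ j.+1 = -1 :> R by rewrite exprS mulrCA -expr2 sqrr_sign mulr1.
move: (2 ^+ (2 * j) : R) (ratr _ : R) (_`!%:R^-1 : R) e => p b f.
rewrite -[n.+1%:R]natr1; move: ((-1) ^+ j : R) ((-1) ^+ j.+1 : R) (n%:R : R) => s s' m e.
have -> : 2 * s * (p / 2 * (s' * b) * ((p - 1) * (m + 1) - m) * f) =
   (s * s') * (p * b * ((p - 1) * (m + 1) - m) * f) by field.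
by rewrite e; ring.
Qed.

Lemma signed_taylor_beta n k : k%:R * signed_taylor n k =
  \sum_(1 <= j < k.+1) beta_coef n j * signed_taylor n (k - j) :> R.
Proof.
have sr := @smooth_r_fun R n.
have -> : k%:R * signed_taylor n k = (-1) ^+ k / 2 * ((2 * k)%:R * taylor (r_fun n) (2 * k)) :> R.
  rewrite /signed_taylor natrM; move: (taylor _ _) => x; by field.
rewrite -taylor_mulX_derive1//.
rewrite (_ : (fun x => _) = fun x => log_derive n x * r_fun n x); last first.
  by apply/funext => x; exact: mulX_derive1_r_fun_log.
rewrite (taylorM _ (smooth_log_derive n) sr).
rewrite -(big_mkord xpredT (fun i => taylor (log_derive n) i * taylor (r_fun n) (2 * k - i))).
have -> : (2 * k).+1 = (2 * k + 1)%N by rewrite addn1.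
(* [log_derive] is even and vanishes at 0, so only positive even indices contribute; the induction
   on m peels off an odd and an even index at a time. *)
have H m : \sum_(0 <= i < 2 * m + 1) taylor (log_derive n) i * taylor (r_fun n) (2 * k - i) =
   \sum_(1 <= j < m.+1) taylor (log_derive n) (2 * j) * taylor (r_fun n) (2 * k - 2 * j) :> R.
  elim: m => [|m IH].
    by rewrite big_nat1 taylor0 log_derive0 mul0r big_geq.
  rewrite [RHS]big_nat_recr//= -IH (_ : (2 * m.+1 + 1 = (2 * m + 1).+2)%N); last by clear; lia.
  have -> F : \sum_(0 <= i < (2 * m + 1).+2) F i =
      \sum_(0 <= i < 2 * m + 1) F i + F (2 * m + 1)%N + F (2 * m + 1).+1 :> R.
    by rewrite !big_nat_recr.
  rewrite (_ : (2 * m.+1 = (2 * m + 1).+1)%N); last by clear; lia.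
  rewrite [X in _ + X * _ + _]taylor_even ?mul0r ?addr0//; first exact: smooth_log_derive.
    by move=> x; exact: log_deriveN.
  by rewrite addn1 /= oddM.
rewrite H mulr_sumr; apply: eq_big_nat => j /andP[j1 jk].
rewrite taylor_log_derive// /signed_taylor -mulnBr.
have -> : (-1) ^+ (k - j) = (-1) ^+ k * (-1) ^+ j :> R.
  rewrite -[in RHS](@subnK j k)// exprD -mulrA -expr2 sqrr_sign mulr1//.
move: (taylor _ _) (beta_coef n j : R) => x y; by field.
Qed.

End r_fun_recurrence.

(** * Exponential generating functions: the coefficients of M and s *)

Section exponential_generating_functions.
Context {R : realType}.
Implicit Type f : R -> R.

Lemma derive1_expR_comp f : smooth f ->
  (forall x : R, derivable (fun x => expR (f x)) x 1) /\
  (fun x => expR (f x))^`()%classic = fun x => f^`()%classic x * expR (f x).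
Proof.
move=> sf; apply: is_derive_derive1 => x.
have := is_derive1_comp (is_derive_expR (f x)) (derivable_is_derive1 (@smooth_derivable _ f sf x)).
by move=> H; apply: (is_derive_eq H); rewrite mulrC.
Qed.

Lemma smooth_expR_comp f : smooth f -> smooth (fun x => expR (f x)).
Proof.
move=> sf; elim=> // n IH /=; have [df ->] := derive1_expR_comp sf; split => //.
exact: times_derivableM (smooth_derive1 sf n) IH.
Qed.

(** Coefficients of x (e^f)' = (x f') e^f. For the exponent of [M_fun] this is the recursion of
    [signed_taylor_beta]. *)
Lemma taylor_expR_comp f m : smooth f -> m%:R * taylor (fun x => expR (f x)) m =
  \sum_(i < m.+1) i%:R * taylor f i * taylor (fun x => expR (f x)) (m - i).
Proof.
move=> sf; have se := smooth_expR_comp sf.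
have sx := smoothM (@smooth_id R) (smooth_derive1 sf).
rewrite -(taylor_mulX_derive1 _ se); have [_ ->] := derive1_expR_comp sf.
rewrite (_ : (fun x => _) = fun x => x * f^`()%classic x * expR (f x)); last first.
  by apply/funext => x; rewrite mulrA.
by rewrite (taylorM _ sx se); apply: eq_bigr => i _; rewrite (taylor_mulX_derive1 _ sf).
Qed.

Lemma smooth_exprn j : smooth (fun x : R => x ^+ j).
Proof. exact/smoothX/smooth_id. Qed.

Lemma taylor_exprn j m : taylor (fun x : R => x ^+ j) m = (m == j)%:R.
Proof.
elim: j m => [|j IH] m; first by rewrite taylor_cst; case: m.
under eq_fun do rewrite exprS.
by rewrite (taylor_mulX _ (smooth_exprn j)); case: m => // m; rewrite IH eqSS.
Qed.

Lemma smooth_monomial (c : R) j : smooth (fun x : R => c * x ^+ j).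
Proof. exact: smoothM (smooth_cst c) (smooth_exprn j). Qed.

Lemma taylor_monomial (c : R) j m : taylor (fun x : R => c * x ^+ j) m = c * (m == j)%:R.
Proof. by rewrite (taylor_mulC _ _ (smooth_exprn j)) taylor_exprn. Qed.

Lemma taylor_sum (I : Type) (s : seq I) (F : I -> R -> R) m : (forall i, smooth (F i)) ->
  taylor (fun x => \sum_(i <- s) F i x) m = \sum_(i <- s) taylor (F i) m.
Proof.
move=> sF; elim: s => [|i s IH].
  rewrite big_nil (_ : (fun x => _) = fun=> 0); last by apply/funext => x; rewrite big_nil.
  by rewrite taylor_cst; case: m.
rewrite big_cons -IH (_ : (fun x => _) = fun x => F i x + \sum_(j <- s) F j x).
  exact: taylorD (sF i) (smooth_sum s sF).
by apply/funext => x; rewrite big_cons.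
Qed.

Lemma taylor_expR_monomial (c : R) j m : (0 < j)%N ->
  taylor (fun x : R => expR (c * x ^+ j)) m =
  if (j %| m)%N then c ^+ (m %/ j) / (m %/ j)`!%:R else 0.
Proof.
move=> j0; have [N] := ubnP m; elim: N m => // N IH [|m]; rewrite ltnS => mN.
  by rewrite taylor0 expr0n eqn0Ngt j0 mulr0 expR0 dvdn0 div0n fact0 divr1.
have n0 : m.+1%:R != 0 :> R by rewrite pnatr_eq0.
apply: (mulfI n0); rewrite (taylor_expR_comp _ (smooth_monomial c j)).
have [mj|jm] := ltnP m.+1 j.
  rewrite big1; first by rewrite gtnNdvd ?mulr0.
  move=> i _; rewrite taylor_monomial (_ : (nat_of_ord i == j) = false) ?mulr0 ?mul0r//.
  by rewrite ltn_eqF// (leq_trans (ltn_ord i)).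
rewrite (bigD1 (Ordinal (n:=m.+2) (m:=j) jm))//= big1 ?addr0; last first.
  move=> i ij; rewrite taylor_monomial (_ : (nat_of_ord i == j) = false) ?mulr0 ?mul0r//.
  by apply: contraNF ij => /eqP ij; apply/eqP/val_inj.
rewrite taylor_monomial eqxx mulr1 IH; last by move: jm mN j0; clear; lia.
set d := (m.+1 - j)%N; have em : m.+1 = (d + j)%N by rewrite subnK.
have -> : (j %| m.+1 = (j %| d))%N by rewrite em dvdn_addl.
have [dj|_] := boolP (j %| d)%N; last by rewrite !mulr0.
have -> : (m.+1 %/ j = (d %/ j).+1)%N by rewrite em divnDr// divnn j0 addn1.
have -> : m.+1%:R = j%:R * (d %/ j).+1%:R :> R by rewrite -natrM mulnS mulnC divnK// addnC -em.
rewrite factS natrM exprS.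
set q := (_ %/ j)%N.
have q0 : q.+1%:R != 0 :> R by rewrite pnatr_eq0.
have f0 : q`!%:R != 0 :> R by rewrite pnatr_eq0 -lt0n fact_gt0.
by move: q.+1%:R q`!%:R q0 f0 => y z y0 z0; field; rewrite y0 z0.
Qed.

(** The series of exp (c X^j) cut at l = k: for j >= 1 the coefficients of order at most k are
    exact, and the range of l is that of [s_coef]. *)
Definition exp_trunc (k : nat) (c : R) (j : nat) : {poly R} :=
  \sum_(l < k.+1) (c ^+ l / l`!%:R) *: 'X^(j * l).

Lemma coef_exp_trunc k c j m : (0 < j)%N -> (m <= k)%N ->
  (exp_trunc k c j)`_m = taylor (fun x : R => expR (c * x ^+ j)) m.
Proof.
move=> j0 mk; rewrite taylor_expR_monomial// coef_sum.
under eq_bigr do rewrite coefZ coefXn.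
case: ifP => [/dvdnP[q mq]|jm]; last first.
  rewrite big1// => l _; case: eqP => [e|]; rewrite ?mulr0//.
  by rewrite e dvdn_mulr in jm.
have qk : (q < k.+1)%N by rewrite ltnS (leq_trans _ mk)// mq leq_pmulr.
rewrite (bigD1 (Ordinal qk))//= big1 ?addr0; last first.
  move=> l lq; rewrite (_ : (m == _) = false) ?mulr0//.
  apply: contraNF lq; rewrite mq mulnC eqn_pmul2l// => /eqP h.
  by apply/eqP/val_inj.
by rewrite mq mulnC eqxx mulr1 mulKn.
Qed.

(** Products of polynomials and of Taylor series are the same convolution, so agreement up to order
    k persists. Smoothness is part of the conclusion because [taylorM] needs it in the induction. *)
Lemma taylor_prod_poly (k : nat) (I : Type) (s : seq I) (F : I -> R -> R) (p : I -> {poly R}) m :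
  (forall i, smooth (F i)) -> (forall i m, (m <= k)%N -> (p i)`_m = taylor (F i) m) ->
  (m <= k)%N -> smooth (fun x => \prod_(i <- s) F i x) /\
  (\prod_(i <- s) p i)`_m = taylor (fun x => \prod_(i <- s) F i x) m.
Proof.
move=> sF pF; elim: s m => [|i s IH] m mk.
  rewrite big_nil (_ : (fun x => _) = fun=> 1); last by apply/funext => x; rewrite big_nil.
  by split; [exact: smooth_cst|rewrite taylor_cst coef1; case: m {mk}].
have [sP _] := IH 0 isT.
rewrite big_cons (_ : (fun x => _) = fun x => F i x * \prod_(j <- s) F j x); last first.
  by apply/funext => x; rewrite big_cons.
split; first exact: smoothM (sF i) sP.
rewrite (taylorM _ (sF i) sP) coefM; apply: eq_bigr => j _.
have jm : (j <= m)%N by rewrite -ltnS.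
rewrite pF ?(leq_trans jm)//; congr (_ * _).
by case: (IH (m - j)%N) => //; rewrite (leq_trans _ mk)// leq_subr.
Qed.

End exponential_generating_functions.

Section M_fun_taylor.
Context {R : realType}.

Lemma M_funE n L : M_fun n L = fun x : R => expR (\sum_(j <- index_iota 1 L.+1) beta_coef n j / j%:R * x ^+ j).
Proof. by []. Qed.

(** Both sequences start at 1 and obey the same recursion; up to order L the truncation of the
    exponent is invisible. *)
Lemma taylor_M_fun n L m : (m <= L)%N -> taylor (M_fun n L : R -> R) m = signed_taylor n m.
Proof.
have [N] := ubnP m; elim: N m => // N IH [|m]; rewrite ltnS => mN mL.
  rewrite taylor0 signed_taylor0 /M_fun big1_seq ?expR0// => j /andP[_].
  by rewrite mem_index_iota => /andP[j0 _]; rewrite expr0n eqn0Ngt j0 mulr0.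
have n0 : m.+1%:R != 0 :> R by rewrite pnatr_eq0.
have sm j := @smooth_monomial R (beta_coef n j / j%:R) j.
apply: (mulfI n0); rewrite M_funE (taylor_expR_comp _ (smooth_sum _ sm)) signed_taylor_beta.
rewrite -(big_mkord xpredT (fun i => i%:R * taylor (fun x => \sum_(j <- index_iota 1 L.+1) beta_coef n j / j%:R * x ^+ j) i *
   taylor (M_fun n L : R -> R) (m.+1 - i))).
rewrite big_ltn// !mul0r add0r; apply: eq_big_nat => i /andP[i1 im].
rewrite IH; last 2 first.
- by move: i1 im mN; clear; lia.
- by move: i1 im mL; clear; lia.
congr (_ * _); rewrite (taylor_sum _ _ sm).
under eq_bigr do rewrite taylor_monomial.
have iL : i \in index_iota 1 L.+1 by rewrite mem_index_iota i1; move: im mL; clear; lia.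
rewrite (bigD1_seq i)//=; last exact: iota_uniq.
rewrite big1 ?addr0; last by move=> j ji; rewrite eq_sym (negbTE ji) mulr0.
by rewrite eqxx mulr1 mulrC divfK// pnatr_eq0 -lt0n.
Qed.

(** Distributing the product over the choice functions l turns the constraint on l into the
    extraction of one coefficient. *)
Lemma s_coefE n k : s_coef n k =
  (\prod_(i < k) exp_trunc k (beta_coef n i.+1 / i.+1%:R) i.+1)`_k :> R.
Proof.
rewrite /exp_trunc bigA_distr_bigA/= coef_sum /s_coef big_mkcond/=; apply: eq_bigr => l _.
have -> : \prod_(i < k) ((beta_coef n i.+1 / i.+1%:R) ^+ l i / (l i)`!%:R *: 'X^(i.+1 * l i)) =
   (\prod_(i < k) ((beta_coef n i.+1 / i.+1%:R) ^+ l i / (l i)`!%:R)) *: 'X^(\sum_(i < k) i.+1 * l i) :> {poly R}.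
  rewrite scaler_prod; congr (_ *: _).
  by rewrite (big_morph (fun m : nat => 'X^m : {poly R}) (@exprD _ _) (expr0 _)).
rewrite coefZ coefXn eq_sym; case: eqP => _; rewrite ?mulr0// mulr1.
by apply: eq_bigr => i _; rewrite [in RHS]expr_div_n [in LHS]invfM mulrA.
Qed.

Lemma s_coef_taylor n k : s_coef n k = taylor (M_fun n k : R -> R) k.
Proof.
rewrite s_coefE; have sm (i : 'I_k) := smooth_expR_comp (@smooth_monomial R (beta_coef n i.+1 / i.+1%:R) i.+1).
have pF (i : 'I_k) m (mk : (m <= k)%N) := coef_exp_trunc (beta_coef n i.+1 / i.+1%:R : R) (ltn0Sn i) mk.
have [_ ->] := taylor_prod_poly (index_enum 'I_k) sm pF (leqnn k).
congr taylor; apply/funext => x; rewrite /M_fun big_add1/= big_mkord expR_sum.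
by [].
Qed.

End M_fun_taylor.

Theorem theorem2p8 (R : realType) (d : measure_display) (T : measurableType d)
    (P : probability T R) (W1 W2 : R -> {RV P >-> R})
    (hW1 : is_wiener W1) (hW2 : is_wiener W2)
    (hW12 : independent_processes W1 W2)
    (t : R) (ht : 0 <= t)
    (A : {RV P >-> R}) (hA : is_area_integral W1 W2 t A) (n k : nat) :
  [/\ area_moment W1 W2 A t n k 0
        = ((-1) ^+ k * (((2 * n)`!)%:R / (2 ^+ n * (n`!)%:R))
           * derive1n (2 * k) (r_fun n) 0)%:E,
      (-1) ^+ k * (((2 * n)`!)%:R / (2 ^+ n * (n`!)%:R))
        * derive1n (2 * k) (r_fun n) 0
        = ((2 * n)`!)%:R * ((2 * k)`!)%:R / (2 ^+ n * (n`!)%:R)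
          * s_coef n k :> R &
      ((2 * n)`!)%:R * ((2 * k)`!)%:R / (2 ^+ n * (n`!)%:R) * s_coef n k
        = ((2 * n)`!)%:R / (2 ^+ n * (n`!)%:R)
          * (((2 * k)`!)%:R / (k`!)%:R) * derive1n k (M_fun n k) 0 :> R].
Proof.
have derive1n_taylor m (f : R -> R) : derive1n m f 0 = m`!%:R * taylor f m.
  by rewrite /taylor mulrC divfK// pnatr_eq0 -lt0n fact_gt0.
have k0 : k`!%:R != 0 :> R by rewrite pnatr_eq0 -lt0n fact_gt0.
have s_alpha : s_coef n k = signed_taylor n k :> R by rewrite s_coef_taylor taylor_M_fun.
have r_alpha : (-1) ^+ k * (((2 * n)`!)%:R / (2 ^+ n * (n`!)%:R)) * derive1n (2 * k) (r_fun n) 0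
    = ((2 * n)`!)%:R / (2 ^+ n * (n`!)%:R) * ((2 * k)`!%:R * signed_taylor n k) :> R.
  by rewrite derive1n_taylor /signed_taylor; move: (taylor _ _) => x; ring.
split.
(* The recursion at k = 0 holds because every [signed_taylor n 0] is 1. *)
- rewrite r_alpha (area_momentE hW1 hW2 hW12 ht hA (signed_taylor0 0)
    (fun n => congr1 (fun x => n.+1%:R * x) (etrans (signed_taylor0 n.+1) (esym (signed_taylor0 n))))
    signed_taylor_rec).
  rewrite /limit_moment addn0 /area_factor gaussian_moment_even mulr1.
  have half m : (2 * m)./2 = m by rewrite mul2n doubleK.
  by rewrite oddM !half.
- by rewrite r_alpha s_alpha; ring.
- rewrite derive1n_taylor -s_coef_taylor; move: (s_coef _ _) => x.
  by rewrite [_ * (k`!%:R * _)]mulrA -[_ * _ * k`!%:R]mulrA divfK//; ring.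
Qed.
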